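(* Let $\#\Theta[-\frac\alpha2,\frac\alpha2]$ be the number of indices $k$ with $\arg(z_k)\in[-\frac\alpha2,\frac\alpha2]$, under $P_N$ (by rotation invariance it is enough to consider such symmetric intervals). (i) If $\alpha>0$ remains fixed while $N\uparrow\infty$, then $$\mathrm{Var}_N\Bigl(\#\Theta[-\tfrac\alpha2,\tfrac\alpha2]\Bigr)=\sqrt N\,\frac1{\pi^{3/2}}+O(\log N).$$ (ii) If instead $\alpha=\alpha(N)\downarrow0$ with $N\alpha(N)\uparrow\infty$, there are the following cases: - if $\lim_{N\uparrow\infty}\sqrt N\alpha=\infty$, then $\mathrm{Var}_N(\#\Theta[-\frac\alpha2,\frac\alpha2])=\sqrt N\,\frac1{\pi^{3/2}}(1+o(1))$; - if $\lim_{N\uparrow\infty}\sqrt N\alpha=\beta>0$, then $\mathrm{Var}_N(\#\Theta[-\frac\alpha2,\frac\alpha2])=\sqrt N\,\frac1{\pi^{3/2}}I_{arg}(\beta)+O(\log N)$; - if $\lim_{N\uparrow\infty}\sqrt N\alpha=0$, then $\mathrm{Var}_N(\#\Theta[-\frac\alpha2,\frac\alpha2])=\frac{N\alpha}{2\pi}(1+o(1))$. Here $$I_{arg}(\beta)=\int_0^1\frac{1-e^{-\beta^2x}}{2\sqrt x}\,dx+\beta\int_0^1\int_{\beta\sqrt x}^\infty e^{-\theta^2}\,d\theta\,dx,$$ and $I_{arg}(\beta)\ge0$, $\lim_{\beta\downarrow0}I_{arg}(\beta)=0$, $\lim_{\beta\uparrow\infty}I_{arg}(\beta)=1$.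
   Context: Ginibre's complex ensemble: $P_N$ is the probability measure on $\mathbb{C}^N$ given by $$dP_N(z_1,\dots,z_N)=\frac1{Z_N}\prod_{1\le \ell<k\le N}|z_\ell-z_k|^2\,\mu_N(dz_1)\cdots\mu_N(dz_N),\qquad \mu_N(dz)=e^{-N|z|^2}\,d\Re(z)\,d\Im(z),$$ with $Z_N$ the normalizing constant. $\mathrm{Var}_N$ is the variance under $P_N$. Arguments are taken in $[-\pi,\pi]$, in radians. (In the definition of $I_{arg}$, $d\theta$ and $dx$ are ordinary Lebesgue measure.)
   Formalization: In (i) α<2π is required (at α≥2π the variance is 0). If √Nα→β, the O(log N) error holds with I_arg(√Nα); with I_arg(β) it is false without a rate (α=(β+1/log N)/√N), so the error is o(√N), or O(log N) if √N(√Nα−β)=O(log N). *)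

(* Defs.v *)
From HB Require Import structures.
From mathcomp Require Import all_boot all_order all_algebra.
From mathcomp Require Import complex.
From mathcomp Require Import all_classical all_reals all_analysis.
From mathcomp Require Import measurable_realfun.

Set Implicit Arguments.
Unset Strict Implicit.
Unset Printing Implicit Defensive.

Import Order.TTheory GRing.Theory Num.Theory.
Import numFieldNormedType.Exports.

Local Open Scope classical_set_scope.
Local Open Scope ring_scope.

Section density.
Context d (T : measurableType d) (R : realType).
Local Open Scope ereal_scope.

(* The measure f(x) mu(dx).  The proofs [mf] and [f0] are arguments so that the
   measure instance below can be inferred. *)
Definition mdensity (mu : {measure set T -> \bar R}) (f : T -> R)
    (mf : measurable_fun setT f) (f0 : forall x, (0 <= f x)%R) : set T -> \bar R :=
  fun A => \int[mu]_(x in A) (f x)%:E.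

Section measure.
Variables (mu : {measure set T -> \bar R}) (f : T -> R).
Hypotheses (mf : measurable_fun setT f) (f0 : forall x, (0 <= f x)%R).

Let mdensity0 : mdensity mu mf f0 set0 = 0.
Proof. by rewrite /mdensity integral_set0. Qed.

Let mdensity_ge0 A : 0 <= mdensity mu mf f0 A.
Proof. by apply: integral_ge0 => x _; rewrite lee_fin. Qed.

Let mdensity_sigma_additive : semi_sigma_additive (mdensity mu mf f0).
Proof.
move=> F mF tF mUF; rewrite /mdensity; apply: cvg_toP.
  apply: ereal_nondecreasing_is_cvgn => m n mn.
  apply: lee_sum_nneg_natr => // k _ _; apply: integral_ge0 => x _.
  by rewrite lee_fin.
rewrite ge0_integral_bigcup//=.
  by apply/measurable_EFinP; exact: measurable_funTS.
by move=> x _; rewrite lee_fin.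
Qed.

HB.instance Definition _ := isMeasure.Build _ _ _ (mdensity mu mf f0)
  mdensity0 mdensity_ge0 mdensity_sigma_additive.
End measure.

Section sigma_finite.
Variables (mu : {sigma_finite_measure set T -> \bar R}) (f : T -> R).
Hypotheses (mf : measurable_fun setT f) (f0 : forall x, (0 <= f x)%R).

Let mdensity_sigma_finite : sigma_finite setT (mdensity mu mf f0).
Proof.
have /sigma_finiteP[F [TF ndF Foo]] := sigma_finiteT mu.
have mG n : measurable (F n `&` f @^-1` `]-oo, (n%:R)%R]%classic).
  apply: measurableI; first by case: (Foo n).
  by rewrite -[X in measurable X]setTI; exact: mf.
exists (fun n => F n `&` f @^-1` `]-oo, (n%:R)%R]%classic).
  apply/seteqP; split=> // x _.
  have : [set: T] x by [].
  rewrite TF => -[k _ Fkx].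
  pose m := (Num.truncn (f x)).+1.
  exists (maxn k m) => //; split.
    by have /subsetPset := ndF _ _ (leq_maxl k m); exact.
  rewrite /= in_itv/=; apply: (@le_trans _ _ m%:R).
    by apply/ltW; rewrite /m; exact: truncnS_gt.
  by rewrite ler_nat leq_maxr.
move=> n; split; first exact: mG.
have [mFn Fnoo] := Foo n.
rewrite /mdensity.
apply: (@le_lt_trans _ _ (\int[mu]_(x in F n `&` f @^-1` `]-oo, (n%:R)%R]%classic) (n%:R)%:E)).
  apply: ge0_le_integral => //=.
  - by move=> x _; rewrite lee_fin.
  - by apply/measurable_EFinP; exact: measurable_funTS.
  - by move=> x [_]; rewrite in_itv/= lee_fin.
rewrite integral_cst//= lte_mul_pinfty ?lee_fin//.
apply: le_lt_trans Fnoo; apply: le_measure; rewrite ?inE//.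
Qed.

HB.instance Definition _ := Measure_isSigmaFinite.Build _ _ _
  (mdensity mu mf f0) mdensity_sigma_finite.
End sigma_finite.
End density.

Section product.
Context d1 d2 (T1 : measurableType d1) (T2 : measurableType d2) (R : realType).
Local Open Scope ereal_scope.

(* An alias of the product measure of the library: on [m1 \x m2] itself the
   sigma-finite instance that gets inferred is the one for products of
   subprobabilities. *)
Definition mprod (m1 : {sigma_finite_measure set T1 -> \bar R})
    (m2 : {sigma_finite_measure set T2 -> \bar R}) : set (T1 * T2) -> \bar R :=
  m1 \x m2.

Variables (m1 : {sigma_finite_measure set T1 -> \bar R})
  (m2 : {sigma_finite_measure set T2 -> \bar R}).

HB.instance Definition _ := Measure.copy (mprod m1 m2) (m1 \x m2).

Let mprod_sigma_finite : sigma_finite setT (mprod m1 m2).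
Proof.
have /sigma_finiteP[F [TF ndF Foo]] := sigma_finiteT m1.
have /sigma_finiteP[G [TG ndG Goo]] := sigma_finiteT m2.
exists (fun n => F n `*` G n).
 rewrite -setXTT TF TG predeqE => -[x y]; split.
    move=> [/= [n _ Fnx] [k _ Gky]]; exists (maxn n k) => //; split.
    - by move: x Fnx; exact/subsetPset/ndF/leq_maxl.
    - by move: y Gky; exact/subsetPset/ndG/leq_maxr.
  by move=> [n _ []/= ? ?]; split; exists n.
move=> k; have [? ?] := Foo k; have [? ?] := Goo k.
split; first exact: measurableX.
by rewrite /mprod product_measure1E// lte_mul_pinfty// ge0_fin_numE.
Qed.

HB.instance Definition _ := Measure_isSigmaFinite.Build _ _ _ (mprod m1 m2)
  mprod_sigma_finite.
End product.

Section product_power.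
Context d (T : measurableType d) (R : realType).
Local Open Scope ereal_scope.

Definition tuple_of_pair n (p : T * n.-tuple T) : n.+1.-tuple T :=
  [tuple of p.1 :: p.2].

Lemma measurable_tuple_of_pair n :
  measurable_fun setT (@tuple_of_pair n).
Proof. by apply: measurable_cons. Qed.

(* The product m1 (x) m2, transported from T x T^n to T^(n+1). *)
Definition mcons n (m1 : {sigma_finite_measure set T -> \bar R})
    (m2 : {sigma_finite_measure set (n.-tuple T) -> \bar R}) :
    set (n.+1.-tuple T) -> \bar R :=
  pushforward (mprod m1 m2) (@tuple_of_pair n).

Section instances.
Variables (n : nat) (m1 : {sigma_finite_measure set T -> \bar R})
  (m2 : {sigma_finite_measure set (n.-tuple T) -> \bar R}).

Let m12 : {measure set (n.+1.-tuple T) -> \bar R} :=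
  measure_function_pushforward__canonical__measure_function_Measure
    (mprod m1 m2) (@measurable_tuple_of_pair n).

HB.instance Definition _ := Measure.copy (mcons m1 m2) m12.

Let mcons_sigma_finite : sigma_finite setT (mcons m1 m2).
Proof.
have [F TF Foo] := sigma_finiteT (mprod m1 m2).
pose g (t : n.+1.-tuple T) := (thead t, [tuple of behead t]).
have mg : measurable_fun setT g.
  apply: measurable_fun_pair; first exact: measurable_tnth.
  exact: measurable_behead.
have gK : cancel (@tuple_of_pair n) g.
  move=> [x t]; rewrite /g /tuple_of_pair/= theadE; congr pair.
  exact/val_inj.
exists (fun k => g @^-1` F k).
  by rewrite -preimage_bigcup -TF preimage_setT.
move=> k; have [mF oo] := Foo k; split.
  by rewrite -[X in measurable X]setTI; exact: mg.
rewrite /mcons /pushforward -comp_preimage.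
by rewrite (_ : g \o _ = id) ?preimage_id//; apply/funext => p; exact: gK.
Qed.

HB.instance Definition _ := Measure_isSigmaFinite.Build _ _ _
  (mcons m1 m2) mcons_sigma_finite.
End instances.

(* The n-fold product mu (x) ... (x) mu; T^0 is a single point, of mass 1. *)
Fixpoint mpower (mu : {sigma_finite_measure set T -> \bar R}) (n : nat) :
    {sigma_finite_measure set (n.-tuple T) -> \bar R} :=
  match n with
  | 0%N => \d_([tuple] : 0.-tuple T)
  | n'.+1 => mcons mu (mpower mu n')
  end.

End product_power.

Section ginibre.
Context (R : realType).

(* The complex plane carries the Borel sigma-algebra and the Lebesgue measure
   d Re(z) d Im(z) of R * R; moduli are computed in R[i], since the norm of
   R * R in the library is the sup norm. *)
Definition plane : measurableType _ :=
  (measurableTypeR R * measurableTypeR R)%type.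
Definition cplx (z : plane) : R[i] := (z.1 +i* z.2)%C.

Lemma normc_sqrE (z : R[i]) : Normc.normc z ^+ 2 = complex.Re z ^+ 2 + complex.Im z ^+ 2.
Proof. by case: z => a b /=; rewrite sqr_sqrtr// addr_ge0// sqr_ge0. Qed.

Lemma measurable_normc2 : measurable_fun [set: plane]
  (fun z => Normc.normc (cplx z) ^+ 2).
Proof.
under eq_fun do rewrite normc_sqrE.
by apply: measurable_funD; apply: measurable_funX;
  [exact: measurable_fst|exact: measurable_snd].
Qed.

(* The principal argument, in ]-pi, pi]; at 0 it takes the junk value pi / 2. *)
Definition arg (z : R[i]) : R :=
  if 0 <= complex.Im z then acos (complex.Re z / Normc.normc z)
  else - acos (complex.Re z / Normc.normc z).

Definition gauss_weight (N : nat) (z : plane) : R :=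
  expR (- (N%:R * Normc.normc (cplx z) ^+ 2)).

Lemma measurable_gauss_weight N : measurable_fun setT (gauss_weight N).
Proof.
apply: measurableT_comp => //; apply: measurableT_comp => //.
by apply: measurable_funM => //; exact: measurable_normc2.
Qed.

Lemma gauss_weight_ge0 N z : 0 <= gauss_weight N z.
Proof. exact: expR_ge0. Qed.

Definition leb2 : {sigma_finite_measure set plane -> \bar R} :=
  mprod (@lebesgue_measure R) (@lebesgue_measure R).

(* mu_N(dz) = exp (- N |z|^2) d Re(z) d Im(z) *)
Definition muN (N : nat) : {sigma_finite_measure set plane -> \bar R} :=
  mdensity leb2 (@measurable_gauss_weight N) (@gauss_weight_ge0 N).

(* The product of |z_l - z_k|^2 over the pairs l < k. *)
Definition vandermonde2 (N : nat) (z : N.-tuple plane) : R :=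
  \prod_(k < N) \prod_(l < N | (l < k)%N)
    Normc.normc (cplx (tnth z l) - cplx (tnth z k)) ^+ 2.

Lemma measurable_vandermonde2 N : measurable_fun setT (@vandermonde2 N).
Proof.
pose h (k l : 'I_N) (z : N.-tuple plane) : R :=
  if (l < k)%N then ((tnth z l).1 - (tnth z k).1) ^+ 2 +
                    ((tnth z l).2 - (tnth z k).2) ^+ 2 else 1.
have mh k l : measurable_fun setT (h k l).
  rewrite /h; case: (_ < _)%N; last exact: measurable_cst.
  have m1 (i : 'I_N) : measurable_fun setT (fun z : N.-tuple plane => (tnth z i).1 : R).
    exact: measurableT_comp measurable_fst (measurable_tnth i).
  have m2 (i : 'I_N) : measurable_fun setT (fun z : N.-tuple plane => (tnth z i).2 : R).
    exact: measurableT_comp measurable_snd (measurable_tnth i).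
  apply: measurable_funD; apply: measurable_funX.
    exact: measurable_funB (m1 l) (m1 k).
  exact: measurable_funB (m2 l) (m2 k).
have -> : @vandermonde2 N = fun z => \prod_(k < N) \prod_(l < N) h k l z.
  apply/funext => z; apply: eq_bigr => k _.
  rewrite big_mkcond; apply: eq_bigr => l _.
  by rewrite /h normc_sqrE.
apply: (@measurable_prod _ _ _ _ _ _ (fun k z => \prod_(l < N) h k l z)) => k _.
exact: (@measurable_prod _ _ _ _ _ _ (h k)).
Qed.

Lemma vandermonde2_ge0 N (z : N.-tuple plane) : 0 <= vandermonde2 z.
Proof. by apply: prodr_ge0 => k _; apply: prodr_ge0 => l _; exact: sqr_ge0. Qed.

Definition ginibre_weight (N : nat) : {measure set (N.-tuple plane) -> \bar R} :=
  mdensity (mpower (muN N) N) (@measurable_vandermonde2 N) (@vandermonde2_ge0 N).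

(* [mnormalize] divides by the total mass Z_N.  Its second argument is a default
   for total mass 0 or +oo, which does not occur here. *)
Definition ginibre (N : nat) : probability (N.-tuple plane) R :=
  mnormalize (ginibre_weight N) point.

(* Number of indices k with arg z_k in [a, b], as a real random variable. *)
Definition count_arg (a b : R) (N : nat) (z : N.-tuple plane) : R :=
  #|[pred k : 'I_N | a <= arg (cplx (tnth z k)) <= b]|%:R.

Definition var_sector (N : nat) (alpha : R) : R :=
  fine 'V_(ginibre N)[@count_arg (- (alpha / 2)) (alpha / 2) N].

(* The integrand of the first integral is 0 / 0 = 0 at x = 0. *)
Definition I_arg (beta : R) : R :=
  \int[@lebesgue_measure R]_(x in `[0, 1])
    ((1 - expR (- (beta ^+ 2 * x))) / (2 * Num.sqrt x)) +
  beta * \int[@lebesgue_measure R]_(x in `[0, 1])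
    \int[@lebesgue_measure R]_(t in `[beta * Num.sqrt x, +oo[)
      expR (- t ^+ 2).

End ginibre.

(* Main.v *)
From HB Require Import structures.
Require Import Defs.
From mathcomp Require Import all_boot all_order all_algebra.
From mathcomp Require Import fingroup perm.
From mathcomp Require Import complex.
From mathcomp Require Import all_classical all_reals all_analysis.
From mathcomp Require Import measurable_realfun.
From mathcomp Require Import ring lra.

Import Order.TTheory GRing.Theory Num.Theory.
Import numFieldNormedType.Exports.

Set Implicit Arguments.
Unset Strict Implicit.
Unset Printing Implicit Defensive.

Local Open Scope classical_set_scope.
Local Open Scope ring_scope.

(** The points z_1, ..., z_N form a determinantal process.  The Vandermonde weight
is |det (z_k^j)|^2 and the monomials are orthogonal for mu_N, so for an
indicator f the variance of sum_k f(z_k) is tr K - tr K^2, where K is the Gram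
matrix of f in the normalized monomials ([var_count], by expanding the two
determinants).  For f the indicator of a sector, polar coordinates factor each
entry of K into a radial Gaussian moment and an angular sine, and the variance
becomes ([var_sector_overlap])

  N alpha / (2 pi) - sum_(i, j < N) overlap i j (sin (d alpha / 2) / (pi d))^2

with d = i - j, where overlap i j = pi C(n, i) / (2^(n+1) W_n) for n = i + j,
and W_n is the integral of cos^n over [0, pi/2].

Two remarks make this double sum tractable.  Its off-diagonal terms are at most
1 / (pi d)^2, so that replacing the square i, j < N by the triangle
i + j < 2 N costs no more than a harmonic sum, which is O(log N)
([square_triangle]).  And along an antidiagonal i + j = n the overlap is
binomial, while the squared sine is a Fourier coefficient of
t |-> min(alpha, t); since sum_i C(n, i) cos ((2 i - n) t) = (2 cos t)^n, the
antidiagonal collapses to the integral of min(alpha, t) cos^n t over [0, pi],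
divided by 4 pi W_n ([sum_overlap_kernel]).

The part of that integral near pi carries the sign (-1)^n in front of
sequences which are monotone up to O(1/n); its sum over n is O(log N)
([sum_alternating_half_ratio]).  In the part near 0, cos^n t may be replaced by
exp (- n t^2 / 2), with a relative error O(n t^4) that contributes O(1/n)
([half_ratio_arg_density]).  What is left is (2 / sqrt pi) h_alpha (n / 2),
where h_beta is the sum of the two integrands in I_arg beta.  As
sqrt N h_alpha (x) = h_(sqrt N alpha) (x / N), summing over n < 2 N gives
2 sqrt N times a Riemann sum of h_(sqrt N alpha) on [0, 1]; this function being
monotone, the result is within O(1) of 2 sqrt N I_arg (sqrt N alpha).  Hence,
uniformly for alpha in [0, pi] ([var_sector_log]),

  Var = sqrt N pi^(-3/2) I_arg (sqrt N alpha) + O(log N).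

Angles above pi reduce to those below by taking complements, and almost every
case follows since I_arg is 1-Lipschitz, positive, and |1 - I_arg beta| is at
most 3 / beta.  Only for sqrt N alpha -> 0 may the main term N alpha / (2 pi) be
smaller than log N; there the double sum itself is O(alpha^2 N^(3/2)), which is
o(N alpha) ([var_sector_small]). *)

(** * Densities, scalings and polar coordinates *)

Section mdensity_integral.
Import HBNNSimple.

Lemma ge0_integral_mdensity d (T : measurableType d) (R : realType)
    (mu : {measure set T -> \bar R}) (f : T -> R)
    (mf : measurable_fun setT f) (f0 : forall x, (0 <= f x)%R) (g : T -> \bar R) :
  measurable_fun setT g -> (forall x, 0 <= g x)%E ->
  (\int[mdensity mu mf f0]_x g x = \int[mu]_x (g x * (f x)%:E))%E.
Proof.
move=> mg g0; pose h := nnsfun_approx measurableT mg.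
have mfE : measurable_fun setT (EFin \o f) by exact/measurable_EFinP.
have -> : (\int[mdensity mu mf f0]_x g x =
    limn (fun n => \int[mdensity mu mf f0]_x (h n x)%:E))%E.
  rewrite -monotone_convergence//=.
  - by apply: eq_integral => x _; apply/esym/cvg_lim => //; exact: cvg_nnsfun_approx.
  - by move=> n; apply/measurable_EFinP.
  - by move=> n x _; rewrite lee_fin.
  - by move=> x _ a b ab; rewrite lee_fin; exact/lefP/nd_nnsfun_approx.
have -> : (\int[mu]_x (g x * (f x)%:E) =
    limn (fun n => \int[mu]_x ((h n x)%:E * (f x)%:E)))%E.
  rewrite -monotone_convergence//=.
  - apply: eq_integral => x _; apply/esym/cvg_lim => //; apply: cvgeZr => //.
    exact: cvg_nnsfun_approx.
  - by move=> n; apply: emeasurable_funM => //; apply/measurable_EFinP.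
  - by move=> n x _; rewrite mule_ge0// lee_fin.
  - by move=> x _ a b ab; rewrite lee_wpmul2r// lee_fin//; exact/lefP/nd_nnsfun_approx.
congr (limn _); apply/funext => n.
under [LHS]eq_integral do rewrite fimfunE -fsumEFin//.
rewrite ge0_integral_fsum//; last 2 first.
  - by move=> r; exact/measurable_EFinP/measurableT_comp.
  - by move=> r x _; rewrite EFinM nnfun_muleindic_ge0.
under [RHS]eq_integral => x _.
  rewrite fimfunE -fsumEFin// ge0_mule_fsuml; last first.
    by move=> r; rewrite EFinM nnfun_muleindic_ge0.
  over.
rewrite ge0_integral_fsum//; last 2 first.
  - move=> r; apply: emeasurable_funM => //.
    exact/measurable_EFinP/measurableT_comp.
  - by move=> r x _; rewrite EFinM mule_ge0 ?lee_fin// -?EFinM -?lee_fin ?EFinM ?nnfun_muleindic_ge0.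
apply: eq_fsbigr => r _; rewrite integralZl_indic_nnsfun//.
rewrite integral_indic// setIT.
have [r0|r0] := leP 0%R r.
  under [RHS]eq_integral do rewrite EFinM -muleA.
  rewrite ge0_integralZl//; last 2 first.
  - by apply: emeasurable_funM => //; apply/measurable_EFinP.
  - by move=> x _; rewrite mule_ge0// lee_fin.
  congr (_ * _)%E; rewrite /= /mdensity integral_mkcond/=.
  by apply: eq_integral => x _; rewrite /= patchE indicE; case: ifP; rewrite ?mul1e ?mul0e.
rewrite preimage_nnfun0// measure0 mule0 integral0_eq// => x _.
by rewrite indicE in_set0 mulr0 mul0e.
Qed.
End mdensity_integral.

(** Both sides are measures that give ]a, b] the length b - a, and such a measure
is unique. *)
Lemma lebesgue_measure_scale (R : realType) (c : R) (A : set R) :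
  0 < c -> measurable A ->
  (c%:E * pushforward lebesgue_measure ( *%R c : R -> measurableTypeR R) A =
   lebesgue_measure A)%E.
Proof.
move=> c0 mA.
have mc : measurable_fun setT ( *%R c : measurableTypeR R -> measurableTypeR R).
  by apply: measurable_funM => //; exact: measurable_cst.
pose m := mscale (NngNum (ltW c0))
  (measure_function_pushforward__canonical__measure_function_Measure lebesgue_measure mc).
suff : lebesgue_measure A = m A by [].
apply: lebesgue_measure_unique => // X /ocitvP[->|[[a b]/= ab ->]].
  by rewrite !measure0.
rewrite /m /mscale/= /pushforward.
have -> : *%R c @^-1` `]a, b]%classic = `]a / c, b / c]%classic :> set R.
  by apply/seteqP; split => x /=; rewrite !in_itv/= ltr_pdivrMr// ler_pdivlMr// (mulrC x).
rewrite !lebesgue_measure_itv/= !lte_fin ab ltr_pM2r ?invr_gt0// ab.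
by rewrite -EFinD -EFinM -mulrBl mulrC divfK ?gt_eqF.
Qed.

Lemma ge0_integral_scale_gt0 (R : realType) (c : R) (f : R -> \bar R) :
  0 < c -> measurable_fun setT f -> (forall x, 0 <= f x)%E ->
  (c%:E * \int[lebesgue_measure]_x f (c * x)%R = \int[lebesgue_measure]_x f x)%E.
Proof.
move=> c0 mf f0.
have mc : measurable_fun setT ( *%R c : measurableTypeR R -> measurableTypeR R).
  by apply: measurable_funM => //; exact: measurable_cst.
pose p := measure_function_pushforward__canonical__measure_function_Measure
  (@lebesgue_measure R) mc.
have := @ge0_integral_pushforward _ _ _ _ R _ mc (@lebesgue_measure R) setT f
   measurableT mf (fun x _ => f0 x).
rewrite preimage_setT => /= <-.
rewrite -[c]/((NngNum (ltW c0))%:num) -(@ge0_integral_mscale _ _ _ p setT measurableT (NngNum (ltW c0)))//.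
apply: eq_measure_integral => /= A mA _.
exact: lebesgue_measure_scale.
Qed.

Lemma ge0_integralN (R : realType) (f : R -> \bar R) :
  measurable_fun setT f -> (forall x, 0 <= f x)%E ->
  (\int[lebesgue_measure]_x f (- x)%R = \int[lebesgue_measure]_x f x)%E.
Proof.
move=> mf f0.
have := @ge0_integral_pushforward _ _ (measurableTypeR R) (measurableTypeR R) R
  (-%R) _ (@lebesgue_measure R) setT f measurableT mf (fun x _ => f0 x).
rewrite preimage_setT => /= <-//.
by apply: eq_measure_integral => /= A mA _; exact: lebesgue_measureN.
Qed.

Lemma ge0_integral_scale (R : realType) (c : R) (f : R -> \bar R) :
  c != 0 -> measurable_fun setT f -> (forall x, 0 <= f x)%E ->
  (`|c|%:E * \int[lebesgue_measure]_x f (c * x)%R = \int[lebesgue_measure]_x f x)%E.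
Proof.
move=> c0 mf f0; have [cp|cn|/eqP] := ltgtP c 0; last by rewrite (negbTE c0).
  rewrite ltr0_norm// -(ge0_integralN mf f0).
  under eq_integral do rewrite -[(c * _)%R]opprK -mulNr.
  rewrite (@ge0_integral_scale_gt0 R (- c) (f \o -%R)) ?oppr_gt0//.
    exact: measurableT_comp.
  by move=> x /=.
by rewrite gtr0_norm// ge0_integral_scale_gt0.
Qed.

Lemma atan_itv (R : realType) (x : R) : atan x \in `](- (pi / 2)), (pi / 2)[.
Proof. by rewrite in_itv/= atan_gtNpi2 atan_ltpi2. Qed.

Lemma ltr_atan (R : realType) : {mono (@atan R) : x y / x < y}.
Proof. by move=> x y; rewrite -(ltr_tan (atan_itv x) (atan_itv y)) !atanK. Qed.

Lemma cos_gt0_itv (R : realType) (t : R) : t \in `](- (pi / 2)), (pi / 2)[ -> 0 < cos t.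
Proof. by rewrite in_itv/= => /cos_gt0_pihalf. Qed.

Lemma measurable_oneDsqrV (R : realType) :
  measurable_fun setT (fun u : measurableTypeR R => (1 + u ^+ 2)^-1).
Proof.
apply: continuous_measurable_fun => u; apply: cvgV; first by rewrite gt_eqF// ltr_pwDl// sqr_ge0.
apply: cvgD; first exact: cvg_cst.
exact: (@exprn_continuous _ 2).
Qed.

Lemma integral_itv_atan (R : realType) (a b : R) : a < b ->
  (\int[lebesgue_measure]_(x in `]a, b]) ((1 + x ^+ 2)^-1)%:E =
   (atan b - atan a)%:E)%E.
Proof.
move=> ab; rewrite integral_itv_obnd_cbnd; last first.
  by apply/measurable_EFinP; apply: measurable_funTS; exact: measurable_oneDsqrV.
rewrite (@continuous_FTC2 _ (fun x => (1 + x ^+ 2)^-1) atan)//.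
- apply: continuous_subspaceT => u; apply: cvgV; first by rewrite gt_eqF// ltr_pwDl// sqr_ge0.
  apply: cvgD; first exact: cvg_cst.
  exact: (@exprn_continuous _ 2).
- split.
  + by move=> x _; apply: ex_derive; exact: is_derive1_atan.
  + exact/cvg_at_right_filter/continuous_atan.
  + exact/cvg_at_left_filter/continuous_atan.
- by move=> x _; rewrite derive1_atan.
Qed.

(** The change of variables t = atan u holds for every nonnegative measurable K
once the image of du / (1 + u^2) is identified with Lebesgue measure on
]-pi/2, pi/2[; by uniqueness it is enough to compare them on intervals, where
atan is a primitive of the density. *)
Lemma ge0_integral_atan (R : realType) (K : R -> \bar R) :
  measurable_fun setT K -> (forall t, 0 <= K t)%E ->
  (\int[lebesgue_measure]_u (K (atan u) * ((1 + u ^+ 2)^-1)%:E) =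
   \int[lebesgue_measure]_(t in `](- (pi / 2))%R, (pi / 2)%R[) K t)%E.
Proof.
move=> mK K0.
pose I := `](- (pi / 2))%R, (pi / 2)%R[%classic : set R.
have mI : measurable I by exact: measurable_itv.
have mA : measurable_fun setT (@atan R).
  by apply: continuous_measurable_fun => x; exact: continuous_atan.
pose tan' := tan \_ I : R -> R.
have mt : measurable_fun setT (tan' : measurableTypeR R -> measurableTypeR R).
  apply: (measurable_restrictT _ mI).1; apply: open_continuous_measurable_fun.
    exact: interval_open.
  move=> x; rewrite inE/= => xI; apply: continuous_tan.
  by rewrite gt_eqF// cos_gt0_itv.
have mtV (X : set R) : measurable X -> measurable (tan' @^-1` X).
  by move=> mX; rewrite -[X in measurable X]setTI; exact: mt.
have m1I : measurable_fun setT (\1_I : R -> R) by exact: measurable_indic.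
have I0 (t : R) : 0 <= \1_I t :> R by rewrite indicE ler0n.
have w0 (u : R) : 0 <= (1 + u ^+ 2)^-1 by rewrite invr_ge0 addr_ge0// sqr_ge0.
pose m1 : {measure set (measurableTypeR R) -> \bar R} := mdensity lebesgue_measure (@measurable_oneDsqrV R) w0.
pose m2 := measure_function_pushforward__canonical__measure_function_Measure
   (mdensity (@lebesgue_measure R) m1I I0) mt.
have m12 (a b : R) : a < b -> m1 (`]a, b]%classic : set R) = m2 (`]a, b]%classic : set R).
  move=> ab; rewrite /m1/= /mdensity integral_itv_atan// /m2/= /pushforward /mdensity.
  rewrite integral_indic//; last by apply: mtV; exact: measurable_itv.
  rewrite setIC.
  have -> : tan' @^-1` `]a, b] `&` I = `]atan a, atan b]%classic.
    apply/seteqP; split => [t [/= tab tI]|t /=].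
      move: tab; rewrite /tan' patchE mem_set// !in_itv/= => /andP[h1 h2].
      rewrite -[t]tanK//.
      by rewrite ltr_atan h1 leNgt ltr_atan -leNgt.
    rewrite in_itv/= => /andP[h1 h2].
    have tI : I t.
      by rewrite /I/= in_itv/= (lt_trans (atan_gtNpi2 a) h1)/= (le_lt_trans h2)// atan_ltpi2.
    split => //; rewrite /tan' patchE mem_set// in_itv/=.
    by rewrite -ltr_atan leNgt -(ltr_atan b) -leNgt tanK// h1.
  by have := lebesgue_measure_itv `]atan a, atan b]; rewrite /= lte_fin ltr_atan ab -EFinB => <-.
have m12' : forall A, measurable A -> m1 A = m2 A.
  apply: (@measure_unique _ R (measurableTypeR R) (@ocitv R) (fun k => `](- k%:R), k%:R]%classic)) => //.
  - exact: ocitvI.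
  - by move=> i; exact: is_ocitv.
  - apply/seteqP; split => // x _.
    exists (Num.truncn `|x|).+1 => //=; rewrite in_itv/=.
    have := truncnS_gt `|x|; rewrite ltr_norml => /andP[-> /ltW ->] //.
  - by move=> A /ocitvP[->|[[a b]/= ab ->]]; [rewrite !measure0|exact: m12].
  - case=> [|k]; first by rewrite oppr0 set_itvoc0 measure0.
    rewrite /m1/= /mdensity integral_itv_atan ?ltry//.
    by rewrite gtrN.
have mKa : measurable_fun (setT : set (measurableTypeR R)) (fun u => K (atan u)).
  exact: measurableT_comp.
transitivity (\int[m1]_u K (atan u))%E.
  by rewrite /m1/= ge0_integral_mdensity.
rewrite (eq_measure_integral m2); last by move=> A mA' _; exact: m12'.
rewrite (@ge0_integral_pushforward _ _ _ _ R _ mt _ setT (fun u => K (atan u)))//.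
rewrite preimage_setT.
transitivity (\int[mdensity (@lebesgue_measure R) m1I I0]_t K (atan (tan' t)))%E => //.
have mKt : measurable_fun (setT : set (measurableTypeR R)) (fun t => K (atan (tan' t))).
  by apply: (measurableT_comp mKa).
rewrite (@ge0_integral_mdensity _ (measurableTypeR R) R lebesgue_measure _ m1I I0 _ mKt)//.
rewrite [RHS]integral_mkcond; apply: eq_integral => t _.
rewrite /= indicE !patchE /tan' patchE; case: ifPn => [tI|_]; last by rewrite mule0.
by rewrite mule1 tanK//; move: tI; rewrite inE.
Qed.

(** With a signed radius r and t in ]-pi/2, pi/2[, polar coordinates come from two
one-dimensional substitutions: y = x u inside Fubini, whose Jacobian is |x|,
then u = tan t, and finally x = r cos t after exchanging the integrals. *)
Lemma ge0_integral_polar (R : realType) (f : R * R -> \bar R) :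
  measurable_fun setT (f : plane R -> \bar R) -> (forall z, 0 <= f z)%E ->
  (\int[leb2 R]_z f z =
   \int[lebesgue_measure]_(t in `](- (pi / 2))%R, (pi / 2)%R[)
     \int[lebesgue_measure]_r (`|r|%:E * f (r * cos t, r * sin t)%R))%E.
Proof.
move=> mf f0.
pose T : measurableType _ := measurableTypeR R.
pose mu : {sigma_finite_measure set T -> \bar R} := @lebesgue_measure R.
transitivity (\int[mu \x mu]_z f z)%E => //.
rewrite (@fubini_tonelli1 _ _ T T R mu mu f mf f0) /fubini_F.
have mN : measurable_fun setT (fun x : T => `|x|%:E).
  by apply/measurable_EFinP; exact: normr_measurable.
pose g (z : T * T) : \bar R := (`|z.1|%:E * f (z.1, z.1 * z.2)%R)%E.
have g0 z : (0 <= g z)%E by rewrite /g mule_ge0// lee_fin.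
have mg : measurable_fun setT g.
  apply: emeasurable_funM; first exact: measurableT_comp mN measurable_fst.
  apply: (measurableT_comp mf); apply: measurable_fun_pair; first exact: measurable_fst.
  by apply: measurable_funM; [exact: measurable_fst|exact: measurable_snd].
have mT0 : measurable (setT `\ (0 : R) : set T).
  by apply: measurableD => //; exact: measurable_set1.
(* The line x = 0, where y = x u degenerates, is negligible. *)
transitivity (\int[mu]_x \int[mu]_u g (x, u))%E.
  have mF : measurable_fun (setT `\ (0 : R) : set T) (fun x => \int[mu]_y f (x, y))%E.
    by apply: measurable_funTS; exact: (@measurable_fun_fubini_tonelli_F _ _ T T R mu f mf f0).
  have mG : measurable_fun (setT `\ (0 : R) : set T) (fun x => \int[mu]_u g (x, u))%E.
    by apply: measurable_funTS; exact: (@measurable_fun_fubini_tonelli_F _ _ T T R mu g mg g0).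
  apply: etrans; first exact/esym/(@integral_setD1 R _ 0 setT mT0 mF).
  apply: etrans; last exact: (@integral_setD1 R _ 0 setT mT0 mG).
  apply: eq_integral => x; rewrite inE/= => -[_ /eqP x0].
  have mfx : measurable_fun setT (fun y : T => f (x, y)).
    by apply: (measurableT_comp mf); exact: measurable_fun_pair.
  rewrite /g/= ge0_integralZl//; last first.
    apply: (measurableT_comp mfx); apply: measurable_funM => //; exact: measurable_cst.
  by rewrite (@ge0_integral_scale _ x (fun y => f (x, y))).
apply: etrans; first exact: (@fubini_tonelli _ _ T T R mu mu g mg g0).
pose h (z : T * T) : \bar R := (`|z.2|%:E * f (z.2 * cos z.1, z.2 * sin z.1)%R)%E.
have h0 z : (0 <= h z)%E by rewrite /h mule_ge0// lee_fin.
have mh : measurable_fun setT h.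
  apply: emeasurable_funM; first exact: measurableT_comp mN measurable_snd.
  apply: (measurableT_comp mf); apply: measurable_fun_pair.
    apply: measurable_funM; first exact: measurable_snd.
    apply: measurableT_comp measurable_fst; apply: continuous_measurable_fun.
    exact: continuous_cos.
  apply: measurable_funM; first exact: measurable_snd.
  apply: measurableT_comp measurable_fst; apply: continuous_measurable_fun.
  exact: continuous_sin.
rewrite -(@ge0_integral_atan _ (fun t => \int[mu]_r h (t, r))%E)//; last 2 first.
- exact: (@measurable_fun_fubini_tonelli_F _ _ T T R mu h mh h0).
- by move=> t; exact: integral_ge0.
apply: eq_integral => u _; rewrite /g/h/=.
have c0 : 0 < cos (atan u) by exact: cos_gt0_itv (atan_itv u).
have mhu : measurable_fun setT (fun r : T => h (atan u, r)).
  by apply: (measurableT_comp mh); exact: measurable_fun_pair.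
have mgu : measurable_fun setT (fun x : T => g (x, u)).
  by apply: (measurableT_comp mg); exact: measurable_fun_pair.
have := @ge0_integral_scale_gt0 _ (cos (atan u)) (fun x => g (x, u)) c0 mgu (fun=> g0 _).
rewrite /g/= => <-.
have -> : (1 + u ^+ 2)^-1 = cos (atan u) * cos (atan u).
  by rewrite cos_atan -invfM -expr2 sqr_sqrtr// addr_ge0// sqr_ge0.
have s_cu : sin (atan u) = cos (atan u) * u.
  by rewrite -[X in _ * X](atanK u) /tan mulrCA mulfV ?mulr1// gt_eqF.
rewrite [RHS]muleC EFinM -muleA; congr (_ * _)%E.
rewrite -(@ge0_integralZl _ T R mu setT measurableT (fun r => h (atan u, r)) mhu)//; last first.
  by rewrite lee_fin ltW.
apply: eq_integral => r _.
rewrite /h/= normrM (gtr0_norm c0) EFinM -muleA s_cu; congr (_ * (_ * f (_, _)))%E.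
- by rewrite mulrC.
- by rewrite mulrCA mulrA.
Qed.

(** * Integrals of complex functions against product measures *)

Lemma integrable_mulc d (T : measurableType d) (R : realType)
    (mu : {measure set T -> \bar R}) (D : set T) (c : R) (h : T -> R) :
  measurable D -> mu.-integrable D (EFin \o h) ->
  mu.-integrable D (EFin \o (fun t => c * h t)).
Proof. by move=> mD ih; rewrite /comp; under eq_fun do rewrite EFinM; exact: integrableZl. Qed.

Lemma integrable_addf d (T : measurableType d) (R : realType)
    (mu : {measure set T -> \bar R}) (D : set T) (g h : T -> R) :
  measurable D -> mu.-integrable D (EFin \o g) -> mu.-integrable D (EFin \o h) ->
  mu.-integrable D (EFin \o (fun t => g t + h t)).
Proof. by move=> mD ig ih; rewrite /comp; under eq_fun do rewrite EFinD; exact: integrableD. Qed.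

Section complex_integral.
Context d (T : measurableType d) (R : realType).
Implicit Types (mu : {measure set T -> \bar R}) (f g : T -> R[i]).

Definition cintegrable mu f :=
  mu.-integrable setT (EFin \o (fun t => complex.Re (f t))) /\
  mu.-integrable setT (EFin \o (fun t => complex.Im (f t))).

Definition cint mu f : R[i] :=
  ((\int[mu]_t complex.Re (f t)) +i* (\int[mu]_t complex.Im (f t)))%C.

Lemma ReD (x y : R[i]) : complex.Re (x + y) = complex.Re x + complex.Re y.
Proof. by case: x y => [a b] [c e]. Qed.
Lemma ImD (x y : R[i]) : complex.Im (x + y) = complex.Im x + complex.Im y.
Proof. by case: x y => [a b] [c e]. Qed.
Lemma ReM (x y : R[i]) :
  complex.Re (x * y) = complex.Re x * complex.Re y - complex.Im x * complex.Im y.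
Proof. by case: x y => [a b] [c e]. Qed.
Lemma ImM (x y : R[i]) :
  complex.Im (x * y) = complex.Re x * complex.Im y + complex.Im x * complex.Re y.
Proof. by case: x y => [a b] [c e]. Qed.

Lemma cintegrable0 mu : cintegrable mu (fun=> 0).
Proof. by split; exact: integrable0. Qed.

Lemma cint0 mu : cint mu (fun=> 0) = 0.
Proof. by rewrite /cint /= /Rintegral !integral0. Qed.

Lemma cintegrableD mu f g : cintegrable mu f -> cintegrable mu g ->
  cintegrable mu (fun t => f t + g t).
Proof.
move=> [f1 f2] [g1 g2]; split; rewrite /comp.
  by under eq_fun do rewrite ReD EFinD; exact: integrableD.
by under eq_fun do rewrite ImD EFinD; exact: integrableD.
Qed.

Lemma cintD mu f g : cintegrable mu f -> cintegrable mu g ->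
  cint mu (fun t => f t + g t) = cint mu f + cint mu g.
Proof.
move=> [f1 f2] [g1 g2]; rewrite /cint; apply/eqP; rewrite eq_complex/=.
by rewrite -!RintegralD//; apply/andP; split; apply/eqP; apply: eq_Rintegral => t _;
  rewrite ?ReD ?ImD.
Qed.

Lemma cintegrableZ mu (c : R[i]) f : cintegrable mu f -> cintegrable mu (fun t => c * f t).
Proof.
move=> [f1 f2]; split; rewrite /comp.
  under eq_fun do rewrite ReM EFinB !EFinM.
  by apply: integrableB => //; exact: integrableZl.
under eq_fun do rewrite ImM EFinD !EFinM.
by apply: integrableD => //; exact: integrableZl.
Qed.

Lemma cintZ mu (c : R[i]) f : cintegrable mu f ->
  cint mu (fun t => c * f t) = c * cint mu f.
Proof.
move=> [f1 f2]; rewrite /cint; apply/eqP; rewrite eq_complex ReM ImM/=.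
apply/andP; split; apply/eqP.
  under eq_Rintegral do rewrite ReM.
  by rewrite RintegralB ?RintegralZl//; exact: integrable_mulc.
under eq_Rintegral do rewrite ImM.
by rewrite RintegralD ?RintegralZl//; exact: integrable_mulc.
Qed.

Lemma cintegrable_sum mu (I : Type) (s : seq I) (P : pred I) (F : I -> T -> R[i]) :
  (forall i, P i -> cintegrable mu (F i)) ->
  cintegrable mu (fun t => \sum_(i <- s | P i) F i t).
Proof.
move=> h; elim: s => [|i s ih].
  by under eq_fun do rewrite big_nil; exact: cintegrable0.
have -> : (fun t => \sum_(j <- i :: s | P j) F j t) =
    (fun t => if P i then F i t + \sum_(j <- s | P j) F j t else \sum_(j <- s | P j) F j t).
  by apply/funext => t; rewrite big_cons.
by have [Pi|//] := boolP (P i); apply: cintegrableD => //; exact: h.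
Qed.

Lemma cint_sum mu (I : Type) (s : seq I) (P : pred I) (F : I -> T -> R[i]) :
  (forall i, P i -> cintegrable mu (F i)) ->
  cint mu (fun t => \sum_(i <- s | P i) F i t) = \sum_(i <- s | P i) cint mu (F i).
Proof.
move=> h; elim: s => [|i s ih].
  by rewrite big_nil -[RHS](cint0 mu); congr cint; apply/funext => t; rewrite big_nil.
rewrite big_cons -ih; case: ifPn => Pi.
  rewrite -cintD; [|exact: h|exact: cintegrable_sum].
  by congr cint; apply/funext => t; rewrite big_cons Pi.
by congr cint; apply/funext => t; rewrite big_cons (negbTE Pi).
Qed.

End complex_integral.

Lemma integrable_mprod d1 d2 (T1 : measurableType d1) (T2 : measurableType d2)
    (R : realType) (m1 : {sigma_finite_measure set T1 -> \bar R})
    (m2 : {sigma_finite_measure set T2 -> \bar R}) (f : T1 -> R) (g : T2 -> R) :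
  m1.-integrable setT (EFin \o f) -> m2.-integrable setT (EFin \o g) ->
  (mprod m1 m2).-integrable setT (EFin \o (fun z => f z.1 * g z.2)).
Proof.
move=> iff ig.
have mf : measurable_fun setT f by apply/measurable_EFinP; exact: measurable_int iff.
have mg : measurable_fun setT g by apply/measurable_EFinP; exact: measurable_int ig.
have mfg : measurable_fun setT (EFin \o (fun z : T1 * T2 => f z.1 * g z.2)).
  apply/measurable_EFinP/measurable_funM; [exact: measurableT_comp mf measurable_fst|
    exact: measurableT_comp mg measurable_snd].
suff : (m1 \x m2)%E.-integrable setT (EFin \o (fun z => f z.1 * g z.2)) by [].
apply/(@integrable12ltyP _ _ T1 T2 R m1 m2 _ mfg).
have -> : (\int[m1]_x \int[m2]_y `|(EFin \o (fun z : T1 * T2 => f z.1 * g z.2)%R) (x, y)| =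
   \int[m1]_x (`|(EFin \o f) x| * \int[m2]_y `|(EFin \o g) y|))%E.
  apply: eq_integral => x _; rewrite -ge0_integralZl//; last first.
    by apply: measurableT_comp => //; exact/measurable_EFinP.
  by apply: eq_integral => y _; rewrite /= normrM EFinM.
move/integrableP: iff => [mf' ifoo]; move/integrableP: ig => [mg' igoo].
rewrite ge0_integralZr//; last 2 first.
- by apply: measurableT_comp.
- exact: integral_ge0.
by rewrite lte_mul_pinfty ?integral_ge0// ge0_fin_numE ?integral_ge0.
Qed.

Lemma Rintegral_mprod d1 d2 (T1 : measurableType d1) (T2 : measurableType d2)
    (R : realType) (m1 : {sigma_finite_measure set T1 -> \bar R})
    (m2 : {sigma_finite_measure set T2 -> \bar R}) (f : T1 -> R) (g : T2 -> R) :
  m1.-integrable setT (EFin \o f) -> m2.-integrable setT (EFin \o g) ->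
  \int[mprod m1 m2]_z (f z.1 * g z.2) = \int[m1]_x f x * \int[m2]_y g y.
Proof.
move=> iff ig.
have ifg : (m1 \x m2)%E.-integrable setT (EFin \o (fun z => f z.1 * g z.2)).
  exact: integrable_mprod iff ig.
have := @integral12_prod_meas1 _ _ T1 T2 R m1 m2 _ ifg.
rewrite /fubini_F => h; rewrite /Rintegral.
transitivity (fine (\int[(m1 \x m2)%E]_z (EFin \o (fun z => f z.1 * g z.2)%R) z)%E) => //.
rewrite -h -[X in _ * X]/(fine _).
have gfin : (\int[m2]_y (g y)%:E \is a fin_num)%E by exact: integrable_fin_num ig.
have ffin : (\int[m1]_y (f y)%:E \is a fin_num)%E by exact: integrable_fin_num iff.
rewrite -fineM//; congr fine.
rewrite -(fineK gfin) -integralZr//.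
by apply: eq_integral => x _; rewrite fineK// -integralZl.
Qed.

Section complex_product.
Context d1 d2 (T1 : measurableType d1) (T2 : measurableType d2) (R : realType).
Variables (m1 : {sigma_finite_measure set T1 -> \bar R})
  (m2 : {sigma_finite_measure set T2 -> \bar R}).
Variables (f : T1 -> R[i]) (g : T2 -> R[i]).
Hypotheses (cf : cintegrable m1 f) (cg : cintegrable m2 g).

Lemma cintegrable_mprod : cintegrable (mprod m1 m2) (fun z => f z.1 * g z.2).
Proof.
case: cf cg => [f1 f2] [g1 g2]; split; rewrite /comp.
  by under eq_fun do rewrite ReM EFinB; apply: integrableB => //;
    [exact: (integrable_mprod f1 g1)|exact: (integrable_mprod f2 g2)].
by under eq_fun do rewrite ImM EFinD; apply: integrableD => //;
  [exact: (integrable_mprod f1 g2)|exact: (integrable_mprod f2 g1)].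
Qed.

Lemma cint_mprod : cint (mprod m1 m2) (fun z => f z.1 * g z.2) = cint m1 f * cint m2 g.
Proof.
case: cf cg => [f1 f2] [g1 g2]; rewrite /cint; apply/eqP.
rewrite eq_complex ReM ImM/= -!Rintegral_mprod//.
apply/andP; split; apply/eqP.
  under [LHS]eq_Rintegral do rewrite ReM.
  by rewrite RintegralB//; [exact: (integrable_mprod f1 g1)|exact: (integrable_mprod f2 g2)].
under [LHS]eq_Rintegral do rewrite ImM.
by rewrite RintegralD//; [exact: (integrable_mprod f1 g2)|exact: (integrable_mprod f2 g1)].
Qed.
End complex_product.

Section mcons_integral.
Context d (T : measurableType d) (R : realType) (n : nat).
Variables (m1 : {sigma_finite_measure set T -> \bar R})
  (m2 : {sigma_finite_measure set (n.-tuple T) -> \bar R}).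

Lemma measurable_mcons (F : n.+1.-tuple T -> R) :
  measurable_fun setT (F \o @tuple_of_pair _ T n) -> measurable_fun setT F.
Proof.
move=> mF; pose g (t : n.+1.-tuple T) := (thead t, [tuple of behead t]).
have mg : measurable_fun setT g.
  apply: measurable_fun_pair; first exact: measurable_tnth.
  exact: measurable_behead.
have -> : F = (F \o @tuple_of_pair _ T n) \o g.
  apply/funext => t /=; rewrite /g /tuple_of_pair/=; congr F.
  by rewrite [LHS]tuple_eta.
exact: measurableT_comp mF mg.
Qed.

Lemma integrable_mcons (F : n.+1.-tuple T -> R) :
  (mprod m1 m2).-integrable setT (EFin \o (F \o @tuple_of_pair _ T n)) ->
  (mcons m1 m2).-integrable setT (EFin \o F).
Proof.
move=> iF; apply: integrable_pushforward => //.
- exact: measurable_tuple_of_pair.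
- have := measurable_int _ iF => /measurable_EFinP mF.
  apply/measurable_EFinP; exact: measurable_mcons.
Qed.

Lemma Rintegral_mcons (F : n.+1.-tuple T -> R) :
  (mprod m1 m2).-integrable setT (EFin \o (F \o @tuple_of_pair _ T n)) ->
  \int[mcons m1 m2]_t F t = \int[mprod m1 m2]_z F (tuple_of_pair z).
Proof.
move=> iF; rewrite /Rintegral; congr fine.
have mF : measurable_fun setT (EFin \o F).
  have := measurable_int _ iF => /measurable_EFinP mF'.
  apply/measurable_EFinP; exact: measurable_mcons.
exact: (@integral_pushforward _ _ _ _ R _ (@measurable_tuple_of_pair _ T n)
  (mprod m1 m2) setT (EFin \o F) mF iF measurableT).
Qed.
End mcons_integral.

(** The product measure is built one coordinate at a time, so this is Fubini
iterated along the tuple. *)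
Lemma cint_mpower d (T : measurableType d) (R : realType)
    (mu : {sigma_finite_measure set T -> \bar R}) (n : nat) (F : 'I_n -> T -> R[i]) :
  (forall k, cintegrable mu (F k)) ->
  cintegrable (mpower mu n) (fun t => \prod_(k < n) F k (tnth t k)) /\
  cint (mpower mu n) (fun t => \prod_(k < n) F k (tnth t k)) = \prod_(k < n) cint mu (F k).
Proof.
elim: n F => [|n IH] F hF.
  have -> : (fun t : 0.-tuple T => \prod_(k < 0) F k (tnth t k)) = fun=> 1.
    by apply/funext => t; rewrite big_ord0.
  rewrite big_ord0 /cint/= /Rintegral !integral_dirac//= indicE in_setT mulr1 mulr0; split => //.
  by split; rewrite /comp/=; exact: finite_measure_integrable_cst.
have [cG eG] := IH (fun k => F (lift ord0 k)) (fun k => hF (lift ord0 k)).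
pose G (t : n.-tuple T) := \prod_(k < n) F (lift ord0 k) (tnth t k).
have FE (z : T * n.-tuple T) :
    \prod_(k < n.+1) F k (tnth (tuple_of_pair z) k) = F ord0 z.1 * G z.2.
  rewrite big_ord_recl; congr (_ * _); apply: eq_bigr => k _.
  by rewrite [tnth _ (lift _ _)](tnth_nth z.1)/= -tnth_nth.
have [i1 i2] := cintegrable_mprod (hF ord0) cG.
have cE := cint_mprod (hF ord0) cG.
have j1 : (mprod mu (mpower mu n)).-integrable setT (EFin \o
   ((fun t : n.+1.-tuple T => complex.Re (\prod_(k < n.+1) F k (tnth t k))) \o @tuple_of_pair _ T n)).
  by rewrite /comp; under eq_fun do rewrite FE.
have j2 : (mprod mu (mpower mu n)).-integrable setT (EFin \o
   ((fun t : n.+1.-tuple T => complex.Im (\prod_(k < n.+1) F k (tnth t k))) \o @tuple_of_pair _ T n)).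
  by rewrite /comp; under eq_fun do rewrite FE.
split; first by split; exact: integrable_mcons.
rewrite big_ord_recl -eG -[X in X * _]/(cint mu (F ord0)) -cE /cint/=.
rewrite (Rintegral_mcons j1) (Rintegral_mcons j2).
by congr (_ +i* _)%C; apply: eq_Rintegral => z _; rewrite FE.
Qed.

(** * Squared determinants and their first two moments *)

(** Row k belongs to the k-th point and column i to the function phi i. *)
Definition slater (T : Type) (R : realType) (n : nat) (phi : 'I_n -> T -> R[i])
  (t : n.-tuple T) : R[i] := \det (\matrix_(k, i) phi i (tnth t k)).

(** Leibniz expansion of both determinants: each term factors over the points. *)
Lemma slater_sqrE (T : Type) (R : realType) (n : nat) (phi : 'I_n -> T -> R[i])
    (w : 'I_n -> T -> R[i]) (t : n.-tuple T) :
  slater phi t * conjc (slater phi t) * \prod_(k < n) w k (tnth t k) =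
  \sum_(s : 'S_n) \sum_(u : 'S_n) (-1) ^+ s * (-1) ^+ u *
     \prod_(k < n) (phi (s k) (tnth t k) * conjc (phi (u k) (tnth t k)) * w k (tnth t k)).
Proof.
rewrite /slater /determinant rmorph_sum/= big_distrlr/= mulr_suml.
apply: eq_bigr => s _; rewrite mulr_suml; apply: eq_bigr => u _.
rewrite rmorphM/= rmorph_sign rmorph_prod/= mulrACA -!mulrA; do 2 congr (_ * _).
rewrite -!big_split/=; apply: eq_bigr => k _.
by rewrite !mxE mulrA.
Qed.

Section andreief.
Context d (T : measurableType d) (R : realType).
Variables (mu : {sigma_finite_measure set T -> \bar R}) (n : nat).
Variables (phi w : 'I_n -> T -> R[i]).
Hypothesis ci : forall k i j,
  cintegrable mu (fun x => phi i x * conjc (phi j x) * w k x).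

Lemma cintegrable_andreief : cintegrable (mpower mu n)
  (fun t => slater phi t * conjc (slater phi t) * \prod_(k < n) w k (tnth t k)).
Proof.
under eq_fun do rewrite slater_sqrE.
apply: cintegrable_sum => s _; apply: cintegrable_sum => u _; apply: cintegrableZ.
exact: (cint_mpower (fun k => ci k (s k) (u k))).1.
Qed.

(** Andreief's identity, kept as a sum over pairs of permutations so that each
coordinate may carry its own weight. *)
Lemma cint_andreief : cint (mpower mu n)
    (fun t => slater phi t * conjc (slater phi t) * \prod_(k < n) w k (tnth t k)) =
  \sum_(s : 'S_n) \sum_(u : 'S_n) (-1) ^+ s * (-1) ^+ u *
     \prod_(k < n) cint mu (fun x => phi (s k) x * conjc (phi (u k) x) * w k x).
Proof.
under eq_fun do rewrite slater_sqrE.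
have cs (s u : 'S_n) := cint_mpower (fun k => ci k (s k) (u k)).
rewrite cint_sum; last first.
  by move=> s _; apply: cintegrable_sum => u _; apply: cintegrableZ; exact: (cs s u).1.
apply: eq_bigr => s _; rewrite cint_sum; last first.
  by move=> u _; apply: cintegrableZ; exact: (cs s u).1.
by apply: eq_bigr => u _; rewrite cintZ ?(cs s u).2//; exact: (cs s u).1.
Qed.
End andreief.

(** The values of u at p and q are the two values of s left over, in some order. *)
Lemma perm_eq_off2 (n : nat) (p q : 'I_n) (s u : 'S_n) :
  (forall k, k != p -> k != q -> u k = s k) -> u = s \/ u = (tperm p q * s)%g.
Proof.
move=> h.
have up : u p = s p \/ u p = s q.
  have [k /eqP] : exists k, u p == s k by exists ((s^-1)%g (u p)); rewrite permKV.
  have [->|kp] := eqVneq k p; first by left.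
  have [->|kq] := eqVneq k q; first by right.
  by rewrite -(h k kp kq) => /perm_inj pk; rewrite pk eqxx in kp.
have uq : u q = s p \/ u q = s q.
  have [k /eqP] : exists k, u q == s k by exists ((s^-1)%g (u q)); rewrite permKV.
  have [->|kp] := eqVneq k p; first by left.
  have [->|kq] := eqVneq k q; first by right.
  by rewrite -(h k kp kq) => /perm_inj pk; rewrite pk eqxx in kq.
have [pq|pq] := eqVneq p q.
  left; apply/permP => k; have [->|kp] := eqVneq k p; first by case: up; rewrite -?pq.
  by apply: h; rewrite -?pq.
have npq : u p != u q by rewrite (inj_eq perm_inj).
case: up uq => [up|up] [] uq.
- by rewrite up uq eqxx in npq.
- left; apply/permP => k; have [->//|kp] := eqVneq k p.
  by have [->//|kq] := eqVneq k q; exact: h.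
- right; apply/permP => k; rewrite permM; case: tpermP => [->//|->//|kp kq].
  by apply: h; apply/eqP.
- by rewrite up uq eqxx in npq.
Qed.

Section two_points.
Variables (C : comNzRingType) (n : nat) (H : 'I_n -> 'I_n -> C).

(** The matrix of the k-th factor when the statistic sits at the points p and q. *)
Let G (p q k i j : 'I_n) : C := if (k == p) || (k == q) then H i j else (i == j)%:R.

(** Away from p and q the factors are Kronecker symbols, so only u = s and
u = (p q) s survive, with opposite signs: this is the 2-by-2 determinant of a
determinantal process. *)
Lemma perm_sum2 (p q : 'I_n) : p != q ->
  \sum_(s : 'S_n) \sum_(u : 'S_n) (-1) ^+ s * (-1) ^+ u * \prod_k G p q k (s k) (u k) =
  \sum_(s : 'S_n) (H (s p) (s p) * H (s q) (s q) - H (s p) (s q) * H (s q) (s p)).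
Proof.
move=> pq; apply: eq_bigr => s _.
have Gprod u : (forall k, k != p -> k != q -> u k = s k) ->
    \prod_k G p q k (s k) (u k) = H (s p) (u p) * H (s q) (u q).
  move=> h; rewrite (bigD1 p)//= (bigD1 q)/=; last by rewrite eq_sym.
  rewrite big1 ?mulr1 /G ?eqxx ?orbT//= => k /andP[kp kq].
  by rewrite (negbTE kp) (negbTE kq)/= h// eqxx.
have st : (tperm p q * s)%g != s.
  apply/eqP => /(congr1 (fun u : 'S_n => u p)); rewrite permM tpermL => /perm_inj qp.
  by rewrite qp eqxx in pq.
rewrite (bigD1 s)//= (bigD1 (tperm p q * s)%g)//= [X in _ + (_ + X)]big1 ?addr0; last first.
  move=> u /andP[us ut].
  have [/existsP[k /and3P[kp kq uk]]|] := boolP [exists k, [&& k != p, k != q & u k != s k]].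
    rewrite (bigD1 k)//= {1}/G (negbTE kp) (negbTE kq)/= eq_sym (negbTE uk).
    by rewrite mul0r mulr0.
  rewrite negb_exists => /forallP h.
  have [] := @perm_eq_off2 n p q s u; last 2 first.
  - by move=> E; rewrite E eqxx in us.
  - by move=> E; rewrite E eqxx in ut.
  by move=> k kp kq; have := h k; rewrite kp kq/= negbK => /eqP.
rewrite Gprod// Gprod; last first.
  by move=> k kp kq; rewrite permM tpermD// eq_sym.
rewrite !permM tpermL tpermR odd_permM odd_tperm pq/= -signr_addb addbb mul1r.
by case: (odd_perm s) => /=; rewrite ?expr0 ?expr1 ?mul1r ?mulr1 ?mulN1r.
Qed.

Lemma perm_sum1 (p : 'I_n) :
  \sum_(s : 'S_n) \sum_(u : 'S_n) (-1) ^+ s * (-1) ^+ u * \prod_k G p p k (s k) (u k) =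
  \sum_(s : 'S_n) H (s p) (s p).
Proof.
apply: eq_bigr => s _.
rewrite (bigD1 s)//= [X in _ + X]big1 ?addr0; last first.
  move=> u us.
  have [/existsP[k /andP[kp uk]]|] := boolP [exists k, (k != p) && (u k != s k)].
    rewrite (bigD1 k)//= {1}/G (negbTE kp)/= eq_sym (negbTE uk).
    by rewrite mul0r mulr0.
  rewrite negb_exists => /forallP h.
  have [] := @perm_eq_off2 n p p s u; last 2 first.
  - by move=> E; rewrite E eqxx in us.
  - by rewrite tperm1 mul1g => E; rewrite E eqxx in us.
  by move=> k kp _; have := h k; rewrite kp/= negbK => /eqP.
rewrite -signr_addb addbb mul1r (bigD1 p)//= big1 ?mulr1 /G ?eqxx// => k kp.
by rewrite (negbTE kp)/= eqxx.
Qed.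

Lemma perm_sum0 :
  \sum_(s : 'S_n) \sum_(u : 'S_n) (-1) ^+ s * (-1) ^+ u *
    \prod_k ((s k == u k)%:R : C) = n`!%:R.
Proof.
rewrite -(card_Sn n) -sum1_card natr_sum/= [RHS](eq_bigl xpredT)//.
apply: eq_bigr => s _.
rewrite (bigD1 s)//= [X in _ + X]big1 ?addr0; last first.
  move=> u us.
  have [/existsP[k uk]|] := boolP [exists k, u k != s k].
    by rewrite (bigD1 k)//= eq_sym (negbTE uk) mul0r mulr0.
  rewrite negb_exists => /forallP h; case/eqP: us; apply/permP => k.
  by have := h k; rewrite negbK => /eqP.
by rewrite -signr_addb addbb mul1r big1// => k _; rewrite eqxx.
Qed.

(** For each s the values s p exhaust the indices. *)
Lemma sum_perm_diag (F : 'I_n -> C) :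
  \sum_(p < n) \sum_(s : 'S_n) F (s p) = n`!%:R * \sum_(i < n) F i.
Proof.
rewrite exchange_big/= (eq_bigr (fun=> \sum_i F i)); last first.
  by move=> s _; rewrite [RHS](reindex_inj (@perm_inj _ s)).
rewrite -(card_Sn n) -sum1_card natr_sum mulr_suml.
by apply: eq_big => // s _; rewrite mul1r.
Qed.

(** For fixed p, q and s, the index s q runs through everything except s p; the
missing term is the diagonal one, which vanishes. *)
Lemma sum_perm_offdiag (F : 'I_n -> 'I_n -> C) : (forall i, F i i = 0) ->
  \sum_(p < n) \sum_(q < n | p != q) \sum_(s : 'S_n) F (s p) (s q) =
  n`!%:R * \sum_(i < n) \sum_(j < n) F i j.
Proof.
move=> F0.
have -> : \sum_(p < n) \sum_(q < n | p != q) \sum_(s : 'S_n) F (s p) (s q) =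
    \sum_(p < n) \sum_(s : 'S_n) \sum_(j < n) F (s p) j.
  apply: eq_bigr => p _; rewrite exchange_big/=; apply: eq_bigr => s _.
  rewrite [RHS](reindex_inj (@perm_inj _ s))/= [RHS](bigD1 p)//= F0 add0r.
  by apply: eq_bigl => q; rewrite eq_sym.
exact: (sum_perm_diag (fun i => \sum_(j < n) F i j)).
Qed.
End two_points.

Section linear_statistics.
Context d (T : measurableType d) (R : realType).
Variables (mu : {sigma_finite_measure set T -> \bar R}) (n : nat).
Variables (phi : 'I_n -> T -> R[i]) (f : T -> R[i]).
Hypothesis phi_int : forall i j, cintegrable mu (fun x => phi i x * conjc (phi j x)).
Hypothesis phi_orth : forall i j, cint mu (fun x => phi i x * conjc (phi j x)) = (i == j)%:R.
Hypothesis f_idem : forall x, f x * f x = f x.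
Hypothesis f_int : forall i j, cintegrable mu (fun x => phi i x * conjc (phi j x) * f x).

Let H i j := cint mu (fun x => phi i x * conjc (phi j x) * f x).
Let D2 (t : n.-tuple T) := slater phi t * conjc (slater phi t).
Let w (p q k : 'I_n) : T -> R[i] := if (k == p) || (k == q) then f else fun=> 1.

Let w_int p q k i j : cintegrable mu (fun x => phi i x * conjc (phi j x) * w p q k x).
Proof.
rewrite /w; case: ifP => _ //.
by under eq_fun do rewrite mulr1; exact: phi_int.
Qed.

Let w_cint p q k i j : cint mu (fun x => phi i x * conjc (phi j x) * w p q k x) =
  if (k == p) || (k == q) then H i j else (i == j)%:R.
Proof.
rewrite /w; case: ifP => _ //.
by under eq_fun do rewrite mulr1; exact: phi_orth.
Qed.

Let w_prod2 p q (t : n.-tuple T) : p != q ->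
  \prod_(k < n) w p q k (tnth t k) = f (tnth t p) * f (tnth t q).
Proof.
move=> pq; rewrite (bigD1 p)//= (bigD1 q)/=; last by rewrite eq_sym.
rewrite /w !eqxx orbT/= big1 ?mulr1// => k /andP[kp kq].
by rewrite (negbTE kp) (negbTE kq).
Qed.

Let w_prod1 p (t : n.-tuple T) : \prod_(k < n) w p p k (tnth t k) = f (tnth t p).
Proof.
rewrite (bigD1 p)//= /w !eqxx/= big1 ?mulr1// => k kp.
by rewrite (negbTE kp).
Qed.

Lemma slater_norm : cintegrable (mpower mu n) D2 /\ cint (mpower mu n) D2 = n`!%:R.
Proof.
have ci (k i j : 'I_n) : cintegrable mu (fun x => phi i x * conjc (phi j x) * 1).
  by under eq_fun do rewrite mulr1; exact: phi_int.
have DE : D2 = fun t => slater phi t * conjc (slater phi t) * \prod_(k < n) 1.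
  by apply/funext => t; rewrite big1// mulr1.
rewrite DE; split; first exact: (cintegrable_andreief ci).
rewrite (cint_andreief ci) -[RHS](@perm_sum0 R[i] n).
apply: eq_bigr => s _; apply: eq_bigr => u _; congr (_ * _); apply: eq_bigr => k _.
by under eq_fun do rewrite mulr1; rewrite phi_orth.
Qed.

Lemma slater_mean :
  cintegrable (mpower mu n) (fun t => D2 t * \sum_(p < n) f (tnth t p)) /\
  cint (mpower mu n) (fun t => D2 t * \sum_(p < n) f (tnth t p)) =
  n`!%:R * \sum_(i < n) H i i.
Proof.
have E : (fun t => D2 t * \sum_(p < n) f (tnth t p)) =
    fun t => \sum_(p < n) (D2 t * \prod_(k < n) w p p k (tnth t k)).
  by apply/funext => t; rewrite mulr_sumr; apply: eq_bigr => p _; rewrite w_prod1.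
have ci p := cintegrable_andreief (w_int p p).
rewrite E; split; first by apply: cintegrable_sum => p _; exact: ci.
rewrite cint_sum; last by move=> p _; exact: ci.
rewrite -(sum_perm_diag (fun i => H i i)); apply: eq_bigr => p _.
rewrite /D2 (cint_andreief (w_int p p)) -perm_sum1.
apply: eq_bigr => s _; apply: eq_bigr => u _; congr (_ * _); apply: eq_bigr => k _.
by rewrite w_cint.
Qed.

(** Since f is idempotent, the terms p = q of the square give back the first
moment; the others are two-point functions. *)
Lemma slater_second_moment :
  cintegrable (mpower mu n) (fun t => D2 t * (\sum_(p < n) f (tnth t p)) ^+ 2) /\
  cint (mpower mu n) (fun t => D2 t * (\sum_(p < n) f (tnth t p)) ^+ 2) =
  n`!%:R * (\sum_(i < n) H i i +
            \sum_(i < n) \sum_(j < n) (H i i * H j j - H i j * H j i)).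
Proof.
have E : (fun t => D2 t * (\sum_(p < n) f (tnth t p)) ^+ 2) =
    fun t => D2 t * (\sum_(p < n) f (tnth t p)) +
      \sum_(p < n) \sum_(q < n | p != q) (D2 t * \prod_(k < n) w p q k (tnth t k)).
  apply/funext => t; rewrite expr2 big_distrlr/= mulr_sumr mulr_sumr -big_split/=.
  apply: eq_bigr => p _; rewrite mulr_sumr (bigD1 p)//= f_idem; congr (_ + _).
  apply: eq_big => [q|q pq]; first by rewrite eq_sym.
  by rewrite w_prod2// eq_sym.
have ci p q := cintegrable_andreief (w_int p q).
have [m1 m2] := slater_mean.
have cs : cintegrable (mpower mu n) (fun t =>
    \sum_(p < n) \sum_(q < n | p != q) (D2 t * \prod_(k < n) w p q k (tnth t k))).
  by apply: cintegrable_sum => p _; apply: cintegrable_sum => q _; exact: ci.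
rewrite E; split; first exact: cintegrableD.
rewrite cintD// m2 mulrDr; congr (_ + _).
rewrite -(sum_perm_offdiag (F := fun i j => H i i * H j j - H i j * H j i)); last first.
  by move=> i; rewrite subrr.
rewrite cint_sum; last by move=> p _; apply: cintegrable_sum => q _; exact: ci.
apply: eq_bigr => p _; rewrite cint_sum; last by move=> q _; exact: ci.
apply: eq_bigr => q pq; rewrite /D2 (cint_andreief (w_int p q)) -perm_sum2//.
apply: eq_bigr => s _; apply: eq_bigr => u _; congr (_ * _); apply: eq_bigr => k _.
by rewrite w_cint.
Qed.
End linear_statistics.

(** * Calculus on the real line *)

Section calculus.
Context {R : realType}.
Implicit Types (f g G : R -> R) (a b : R).
Local Notation mu := (@lebesgue_measure R).

Lemma is_derive_continuous G g : (forall x, is_derive x (1 : R) G (g x)) -> continuous G.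
Proof.
move=> dG x; apply: differentiable_continuous; apply/derivable1_diffP.
exact: ex_derive.
Qed.

Lemma continuous_integrable g a b : continuous g -> mu.-integrable `[a, b] (EFin \o g).
Proof.
move=> cg; apply: continuous_compact_integrable; first exact: segment_compact.
exact: continuous_subspaceT.
Qed.

Lemma integral_is_derive G g a b : (forall x, is_derive x (1 : R) G (g x)) ->
  continuous g -> a <= b -> (\int[mu]_(x in `[a, b]) (g x)%:E = (G b - G a)%:E)%E.
Proof.
move=> dG cg; rewrite le_eqVlt => /predU1P[->|ab].
  by rewrite set_itv1 integral_set1 subrr.
have cG := is_derive_continuous dG.
rewrite (@continuous_FTC2 _ g G)//.
- exact: continuous_subspaceT.
- split; first by move=> x _; exact: ex_derive.
  + exact/cvg_at_right_filter/cG.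
  + exact/cvg_at_left_filter/cG.
- by move=> x _; rewrite derive1E; exact: derive_val.
Qed.

Lemma Rintegral_is_derive G g a b : (forall x, is_derive x (1 : R) G (g x)) ->
  continuous g -> a <= b -> \int[mu]_(x in `[a, b]) g x = G b - G a.
Proof. by move=> dG cg ab; rewrite /Rintegral (integral_is_derive dG). Qed.

(** Turns the signed radius of [ge0_integral_polar] into a radius r >= 0 and the
two directions t and t + pi. *)
Lemma ge0_integralT_fold (h : R -> \bar R) : measurable_fun setT h ->
  (forall x, 0 <= h x)%E ->
  (\int[mu]_x h x = \int[mu]_(x in `[0%R, +oo[) h x + \int[mu]_(x in `[0%R, +oo[) h (- x)%R)%E.
Proof.
move=> mh h0.
have mhN : measurable_fun setT (fun x : measurableTypeR R => h (- x)).
  exact: measurableT_comp.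
rewrite (@ge0_integration_by_substitution0 _ (fun x => h (- x)))//.
under [X in (_ = _ + X)%E]eq_integral do rewrite opprK.
rewrite -(@integral_itv_bndo_bndc _ -oo%O 0 h); last exact: measurable_funTS.
rewrite -ge0_integral_setU//=.
- congr (integral _ _ _); apply/seteqP; split => // x _.
  by rewrite /= !in_itv/= andbT; case: leP => ?; [left|right].
- exact: measurable_funTS.
- by apply/disj_setPS => x [] /=; rewrite !in_itv/= andbT => x0 /(le_lt_trans x0); rewrite ltxx.
Qed.
End calculus.

(** * Sectors in polar coordinates *)

Lemma cos_norm (R : realType) (t : R) : cos `|t| = cos t.
Proof. by case: (ler0P t) => _; rewrite ?cosN. Qed.

Lemma ler_cos_itv (R : realType) (x y : R) :
  0 <= x <= pi -> 0 <= y <= pi -> (cos x <= cos y) = (y <= x).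
Proof. by move=> hx hy; rewrite !leNgt ltr_cos ?in_itv. Qed.

Lemma measurable_fun_le_nat (R : realType) (u v : R -> R) :
  measurable_fun setT u -> measurable_fun setT v ->
  measurable_fun setT (fun t => (u t <= v t)%R%:R : R).
Proof.
move=> mu mv.
have -> : (fun t => (u t <= v t)%R%:R : R) = fun t => if u t <= v t then 1 else 0.
  by apply/funext => t; case: (_ <= _).
by apply: measurable_fun_ifT => //; exact: measurable_fun_ler.
Qed.

Section sector_angle.
Context {R : realType}.
Local Notation mu := (@lebesgue_measure R).
Variables (g G : R -> R) (c : R).
Hypotheses (cg : continuous g) (g0 : forall x, 0 <= g x)
  (dG : forall x, is_derive x (1 : R) G (g x))
  (Gper : forall x, G (x + pi *+ 2) = G x + c).

Let mg : measurable_fun setT (g : measurableTypeR R -> _) := continuous_measurable_fun cg.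
Let cgpi : continuous (fun t => g (t + pi)).
Proof.
move=> t; apply: (@continuous_comp _ _ _ (fun t => t + pi) g); last exact: cg.
by apply: cvgD => //; exact: cvg_cst.
Qed.
Let dGpi x : is_derive x (1 : R) (fun t => G (t + pi)) (g (x + pi)).
Proof.
have dG' := dG (x + pi).
have d1 : is_derive x (1 : R) (fun t : R => t + pi) 1 by apply: is_derive_eq; rewrite addr0.
by have := @is_derive1_comp R G (fun t => t + pi) x _ _ dG' d1; rewrite mulr1.
Qed.

(** The directions t in ]-pi/2, pi/2[ and t + pi together cover the circle. For
a <= pi/2 only the first ones meet the arc; for a > pi/2 all of them do, and
the second ones miss exactly |t| < pi - a, which the periodicity of G up to
the constant c accounts for. *)
Lemma integral_sector_angle (a : R) : 0 <= a <= pi ->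
  (\int[mu]_(t in `](- (pi / 2))%R, (pi / 2)%R[)
    (g t * (cos a <= cos t)%R%:R + g (t + pi) * (cos a <= cos (t + pi))%R%:R)%:E =
   (G a - G (- a))%:E)%E.
Proof.
move=> /andP[a0 api].
have pi0 := @pi_gt0 R.
have mcos : measurable_fun setT (cos : R -> R) by apply: continuous_measurable_fun; exact: continuous_cos.
have mabs : measurable_fun setT (fun t : R => `|t|) by exact: normr_measurable.
have [a2|a2] := leP a (pi / 2).
  under eq_integral => t.
    rewrite mem_setE in_itv/= => tI.
    have t2 : `|t| < pi / 2 by rewrite ltr_norml.
    have -> : cos a <= cos (t + pi) = false.
      apply/negbTE; rewrite -ltNge cosDpi (@lt_le_trans _ _ 0)//.
        by rewrite oppr_lt0 cos_gt0_pihalf.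
      by rewrite cos_ge0_pihalf// a2 andbT (le_trans _ a0)// oppr_le0 ltW// divr_gt0.
    have -> : (cos a <= cos t) = (`|t| <= a).
      rewrite -(cos_norm t) ler_cos_itv ?a0//= normr_ge0/= ltW// (lt_le_trans t2)//.
      by rewrite ler_pdivrMr// ler_peMr ?ler1n// ltW.
    rewrite mulr0 addr0; over.
  rewrite -(@integral_itv_bndoo _ _ _ _ true false); last first.
    apply/measurable_EFinP/measurable_funTS/measurable_funM => //.
    by apply: measurable_fun_le_nat => //; exact: measurable_cst.
  rewrite -(integral_is_derive (g := g))//; last by rewrite -subr_ge0 opprK addr_ge0.
  rewrite integral_mkcond [RHS]integral_mkcond; apply: eq_integral => t _.
  rewrite !patchE !mem_setE !in_itv/= -!ler_norml.
  have [ta|ta] := leP `|t| a; last by rewrite mulr0 if_same.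
  by rewrite (le_trans ta a2) mulr1.
have b0 : 0 <= pi - a by rewrite subr_ge0.
have b2 : pi - a <= pi / 2.
  by rewrite lerBlDr -lerBlDl (_ : pi - pi / 2 = pi / 2) ?ltW// {1}[pi]splitr addrK.
under eq_integral => t.
  rewrite mem_setE in_itv/= => tI.
  have t2 : `|t| < pi / 2 by rewrite ltr_norml.
  have -> : (cos a <= cos (t + pi)) = (pi - a <= `|t|).
    have -> : cos (t + pi) = cos (pi - `|t|).
      rewrite cosDpi -(cos_norm t) -[in RHS]cosN opprB -[in RHS]cosD2pi mulr2n.
      by rewrite addrA subrK cosDpi.
    rewrite ler_cos_itv ?a0 ?api//; first by rewrite lerBlDl -lerBlDr.
    rewrite subr_ge0 gerBl normr_ge0 andbT ltW// (lt_le_trans t2)//.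
    by rewrite ler_pdivrMr// ler_peMr ?ler1n// ltW.
  have -> : cos a <= cos t.
    apply: (@le_trans _ _ 0); last by rewrite ltW// cos_gt0_pihalf.
    rewrite -cos_pihalf ler_cos_itv ?a0 ?api ?(ltW a2)//.
    by apply/andP; split; lra.
  rewrite mulr1; over.
rewrite -(@integral_itv_bndoo _ _ _ _ true false); last first.
  apply/measurable_EFinP/measurable_funTS/measurable_funD => //.
  apply: measurable_funM; first exact: continuous_measurable_fun.
  by apply: measurable_fun_le_nat => //; exact: measurable_cst.
pose h t := g (t + pi) * (pi - a <= `|t|)%R%:R.
have mh : measurable_fun setT h.
  apply: measurable_funM; first exact: continuous_measurable_fun.
  by apply: measurable_fun_le_nat => //; exact: measurable_cst.
have h0 t : 0 <= h t by rewrite mulr_ge0.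
have hI : (\int[mu]_(t in `[(- (pi / 2))%R, (pi / 2)%R]) (h t)%:E = (G a - G (- a) - (G (pi / 2) - G (- (pi / 2))))%:E)%E.
  pose k t := g (t + pi) * (~~ (pi - a <= `|t|))%R%:R.
  have mk : measurable_fun setT k.
    have -> : k = fun t => g (t + pi) - h t.
      apply/funext => t; rewrite /k /h; case: (_ <= _) => /=; rewrite ?mulr0 ?mulr1 ?subrr//.
      by rewrite subr0.
    by apply: measurable_funB => //; exact: continuous_measurable_fun.
  have k0 t : 0 <= k t by rewrite mulr_ge0.
  have kI : (\int[mu]_(t in `[(- (pi / 2))%R, (pi / 2)%R]) (k t)%:E = (G (pi + (pi - a)) - G a)%:E)%E.
    have <- : (\int[mu]_(t in `[(- (pi - a))%R, (pi - a)%R]) (g (t + pi)%R)%:E = (G (pi + (pi - a)) - G a)%:E)%E.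
      rewrite (integral_is_derive dGpi)//; last by rewrite -subr_ge0 opprK addr_ge0.
      by congr (_%:E); congr (G _ - G _); [rewrite addrC|rewrite opprB subrK].
    rewrite [RHS](@integral_itv_bndoo _ _ _ _ true false); last first.
      by apply/measurable_EFinP/measurable_funTS; exact: continuous_measurable_fun.
    rewrite integral_mkcond [RHS]integral_mkcond; apply: eq_integral => t _.
    rewrite !patchE !mem_setE !in_itv/= -ler_norml -ltr_norml /k -ltNge.
    have [ta|ta] := ltP `|t| (pi - a); last by rewrite mulr0 if_same.
    by rewrite (le_trans (ltW ta) b2) mulr1.
  have : (\int[mu]_(t in `[(- (pi / 2))%R, (pi / 2)%R]) (h t)%:E +
      \int[mu]_(t in `[(- (pi / 2))%R, (pi / 2)%R]) (k t)%:E =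
      (G (pi / 2 + pi) - G (pi / 2))%:E)%E.
    rewrite -ge0_integralD//; last 4 first.
    - by move=> t _; rewrite lee_fin.
    - exact/measurable_EFinP/measurable_funTS.
    - by move=> t _; rewrite lee_fin.
    - exact/measurable_EFinP/measurable_funTS.
    under eq_integral => t _.
      rewrite -EFinD /h /k -mulrDr (_ : _%:R + _ = 1); last by case: (_ <= _); rewrite ?addr0 ?add0r.
      rewrite mulr1; over.
    rewrite (integral_is_derive dGpi)//; last by rewrite -subr_ge0 opprK addr_ge0// ltW// divr_gt0.
    by rewrite /= (_ : - (pi / 2) + pi = pi / 2)// {2}[pi]splitr addKr.
  rewrite kI; case: (integral _ _ _) => [r| |]//= [E]; congr (_%:E); move: E.
  rewrite (_ : pi + (pi - a) = - a + pi *+ 2); last by ring.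
  rewrite (_ : pi / 2 + pi = - (pi / 2) + pi *+ 2); last by field.
  by rewrite !Gper => E; lra.
transitivity (\int[mu]_(t in `[(- (pi / 2))%R, (pi / 2)%R]) ((g t)%:E + (h t)%:E))%E => //.
rewrite ge0_integralD//; last 4 first.
- by move=> t _; rewrite lee_fin.
- exact/measurable_EFinP/measurable_funTS.
- by move=> t _; rewrite lee_fin.
- exact/measurable_EFinP/measurable_funTS.
rewrite hI (integral_is_derive dG)//; last by lra.
by rewrite -EFinD; congr (_%:E); lra.
Qed.
End sector_angle.

Section sector_integral.
Context {R : realType}.
Local Notation mu := (@lebesgue_measure R).

(** The condition |arg z| <= a, without a division: the second conjunct settles
the origin, where [arg] is pi / 2. *)
Definition sector (a : R) : set (plane R) :=
  [set z | (Normc.normc (cplx z) * cos a <= z.1) &&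
           ((0 < Normc.normc (cplx z)) || (cos a <= 0))].

Lemma measurable_normc : measurable_fun [set: plane R] (fun z => Normc.normc (cplx z)).
Proof.
have -> : (fun z : plane R => Normc.normc (cplx z)) =
    fun z => Num.sqrt (Normc.normc (cplx z) ^+ 2).
  by apply/funext => z; rewrite sqrtr_sqr ger0_norm// /Normc.normc/= sqrtr_ge0.
apply: (@measurableT_comp _ _ _ _ _ _ (@Num.sqrt R)); last exact: measurable_normc2.
by apply: continuous_measurable_fun; exact: sqrt_continuous.
Qed.

Lemma measurable_sector a : measurable (sector a).
Proof.
rewrite -[X in measurable X]setTI.
have m : measurable_fun setT (fun z : plane R => (Normc.normc (cplx z) * cos a <= z.1) &&
           ((0 < Normc.normc (cplx z)) || (cos a <= 0))).
  apply: measurable_and; last apply: measurable_or.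
  - apply: measurable_fun_ler; last exact: measurable_fst.
    by apply: measurable_funM => //; exact: measurable_normc.
  - by apply: measurable_fun_ltr => //; exact: measurable_normc.
  - by apply: measurable_fun_ler => //; exact: measurable_cst.
by have := m measurableT [set true]; exact.
Qed.

Lemma indic_sector a (z : plane R) :
  \1_(sector a) z = ((Normc.normc (cplx z) * cos a <= z.1) &&
           ((0 < Normc.normc (cplx z)) || (cos a <= 0)))%R%:R :> R.
Proof. by rewrite indicE; congr ((nat_of_bool _)%:R); apply/idP/idP => [/set_mem|] h //; exact: mem_set. Qed.

Lemma normc_polar (r x : R) : Normc.normc (cplx ((r * cos x, r * sin x) : plane R)) = `|r|.
Proof.
by rewrite /Normc.normc/= !exprMn -mulrDr cos2Dsin2 mulr1 sqrtr_sqr.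
Qed.

Variables (g G : R -> R) (c : R).
Hypotheses (cg : continuous g) (g0 : forall x, 0 <= g x)
  (dG : forall x, is_derive x (1 : R) G (g x))
  (Gper : forall x, G (x + pi *+ 2) = G x + c).

(** The angular factor integrates to G a - G (- a), whatever the radial factor. *)
Lemma ge0_integral_sector (f : plane R -> R) (F : R -> R) (a : R) :
  measurable_fun setT f -> (forall z, 0 <= f z) ->
  measurable_fun setT F -> (forall r, 0 <= F r) ->
  (forall r x, 0 <= r -> f (r * cos x, r * sin x) = F r * g x) ->
  0 <= a <= pi ->
  (\int[leb2 R]_z (f z * \1_(sector a) z)%:E =
   \int[mu]_(r in `[0%R, +oo[) (r * F r)%:E * (G a - G (- a))%:E)%E.
Proof.
move=> mf f0 mF F0 fE a0pi.
pose T := measurableTypeR R.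
pose f1 (z : plane R) := f z * \1_(sector a) z.
have f1E z : f1 z = f z * ((Normc.normc (cplx z) * cos a <= z.1) &&
           ((0 < Normc.normc (cplx z)) || (cos a <= 0)))%R%:R.
  by rewrite /f1 indic_sector.
have mf1 : measurable_fun setT f1.
  by apply: measurable_funM => //; apply: measurable_indic; exact: measurable_sector.
have f10 z : 0 <= f1 z by rewrite /f1 mulr_ge0// indicE.
rewrite (@ge0_integral_polar _ (fun z => (f1 z)%:E))//; last exact/measurable_EFinP.
pose A t := g t * (cos a <= cos t)%R%:R + g (t + pi) * (cos a <= cos (t + pi))%R%:R.
have A0 t : 0 <= A t by rewrite addr_ge0// mulr_ge0.
have mrF : measurable_fun setT (fun r : T => r * F r) by exact: measurable_funM.
have rF0 (r : R) : `[0, +oo[%classic r -> 0 <= r * F r.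
  by rewrite /= in_itv/= andbT => r0; exact: mulr_ge0.
have mrFE : measurable_fun (`[0, +oo[%classic : set R) (fun r : R => (r * F r)%:E).
  by apply/measurable_EFinP; exact: measurable_funTS.
have rF0E r : `[0, +oo[%classic r -> (0 <= (r * F r)%:E)%E by move=> rI; rewrite lee_fin rF0.
have pull (q : R) : 0 <= q -> (\int[mu]_(r in `[0%R, +oo[) (r * F r)%:E * q%:E =
    \int[mu]_(r in `[0%R, +oo[) ((r * F r)%:E * q%:E))%E.
  by move=> q0; rewrite ge0_integralZr.
have fpos (r t : R) : 0 <= r ->
    r * f1 (r * cos t, r * sin t) =
    r * F r * (g t * (cos a <= cos t)%R%:R).
  rewrite le_eqVlt => /predU1P[<-|r0]; first by rewrite !mul0r.
  rewrite f1E fE; last exact: ltW.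
  rewrite normc_polar/= gtr0_norm// ler_pM2l// r0 andbT.
  by rewrite !mulrA.
have fneg (r t : R) : 0 <= r ->
    r * f1 (- r * cos t, - r * sin t) =
    r * F r * (g (t + pi) * (cos a <= cos (t + pi))%R%:R).
  by move=> r0; rewrite -fpos// cosDpi sinDpi !mulrN !mulNr.
have inner (t : R) :
    (\int[mu]_r (`|r|%:E * (f1 (r * cos t, r * sin t)%R)%:E) =
     \int[mu]_(r in `[0%R, +oo[) (r * F r)%:E * (A t)%:E)%E.
  rewrite ge0_integralT_fold; last 2 first.
  - apply: emeasurable_funM; first by apply/measurable_EFinP; exact: normr_measurable.
    apply/measurable_EFinP; apply: (measurableT_comp mf1).
    by apply: measurable_fun_pair; apply: measurable_funM => //; exact: measurable_cst.
  - by move=> r; rewrite mule_ge0// lee_fin.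
  rewrite /A EFinD ge0_muleDr ?lee_fin ?mulr_ge0//.
  congr (_ + _)%E.
    rewrite pull ?mulr_ge0//.
    apply: eq_integral => r; rewrite mem_setE in_itv/= andbT => r0.
    by rewrite -!EFinM -fpos// ger0_norm.
  rewrite pull ?mulr_ge0//.
  apply: eq_integral => r; rewrite mem_setE in_itv/= andbT => r0.
  by rewrite -!EFinM -fneg// normrN ger0_norm.
transitivity (\int[mu]_(t in `](- (pi / 2))%R, (pi / 2)%R[)
    (\int[mu]_(r in `[0%R, +oo[) (r * F r)%:E * (A t)%:E))%E.
  by apply: eq_integral => t _; exact: inner.
rewrite ge0_integralZl//; last 3 first.
- apply/measurable_EFinP/measurable_funTS.
  have mle (u : R -> R) : continuous u -> measurable_fun setT (fun t : T => (cos a <= u t)%R%:R : R).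
    by move=> cu; apply: measurable_fun_le_nat => //; exact: continuous_measurable_fun.
  have cpi : continuous (fun t : R => t + pi) by move=> t; apply: cvgD => //; exact: cvg_cst.
  apply: measurable_funD; apply: measurable_funM.
  + exact: continuous_measurable_fun.
  + by apply: mle; exact: continuous_cos.
  + by apply: continuous_measurable_fun => t; apply: (@continuous_comp _ _ _ (fun t => t + pi) g); [exact: cpi|exact: cg].
  + apply: mle => t; apply: (@continuous_comp _ _ _ (fun t => t + pi) cos); first exact: cpi.
    exact: continuous_cos.
- by move=> t _; rewrite lee_fin.
- exact: integral_ge0.
by rewrite (integral_sector_angle cg g0 dG Gper).
Qed.
End sector_integral.

(** * Gaussian moments *)

Lemma is_derive_expn (R : realType) n (x : R) :
  is_derive x (1 : R) (fun r : R => r ^+ n.+1) (n.+1%:R * x ^+ n).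
Proof.
have := is_deriveX n.+1 (is_derive_id x (1 : R)).
by rewrite /GRing.scale/= mulr1 exprfctE.
Qed.

Lemma is_derive_scale (R : realType) (c : R) (f : R -> R) (x df : R) :
  is_derive x (1 : R) f df -> is_derive x (1 : R) (fun r : R => c * f r) (c * df).
Proof. by move=> h; have := is_deriveZ c h. Qed.

Section gaussian_moments.
Context {R : realType}.
Local Notation mu := (@lebesgue_measure R).
Implicit Types (a x : R).

Definition gauss a x : R := expR (- (a * x ^+ 2)).

Lemma gauss_gt0 a x : 0 < gauss a x. Proof. exact: expR_gt0. Qed.
Lemma gauss_ge0 a x : 0 <= gauss a x. Proof. exact: expR_ge0. Qed.

Lemma is_derive_gauss a x : is_derive x (1 : R) (gauss a) (- (2 * a * x) * gauss a x).
Proof.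
have d : is_derive x (1 : R) (fun s : R => - (a * s ^+ 2)) (- (2 * a * x)).
  by apply: is_derive_eq; rewrite /GRing.scale/=; ring.
have := is_derive1_comp (is_derive_expR _) d.
by rewrite mulrC.
Qed.

Lemma continuous_gauss a : continuous (gauss a).
Proof. exact: is_derive_continuous (is_derive_gauss a). Qed.

Lemma gauss_slope_ge0 a (s : R) : 0 < a -> 0 <= s -> 0 <= 2 * a * s * gauss a s.
Proof. by move=> a0 s0; rewrite !mulr_ge0 ?gauss_ge0 ?(ltW a0). Qed.

Lemma measurable_gauss a : measurable_fun setT (gauss a).
Proof. by apply: continuous_measurable_fun; exact: continuous_gauss. Qed.

Lemma cvg_gauss a : 0 < a -> gauss a x @[x --> +oo] --> (0 : R).
Proof.
move=> a0; apply: (@cvg_comp _ _ _ (fun x => a * x ^+ 2) (fun y => expR (- y)) +oo +oo);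
  last exact: cvgr_expR.
apply/cvgryPge => A; near=> x.
apply: (@le_trans _ _ (a * x)).
  by rewrite -ler_pdivrMl//; near: x; exact: nbhs_pinfty_ge.
by rewrite ler_pM2l// expr2 ler_peMl//; near: x; exact: nbhs_pinfty_ge.
Unshelve. all: by end_near. Qed.

Lemma integral_gauss_tail a r : 0 < a -> 0 <= r ->
  (\int[mu]_(s in `[r, +oo[) (2 * a * s * gauss a s)%:E = (gauss a r)%:E)%E.
Proof.
move=> a0 r0.
have dF s : is_derive s (1 : R) (fun x => - gauss a x) (2 * a * s * gauss a s).
  apply: (is_derive_eq (is_deriveN (is_derive_gauss a s))).
  by rewrite mulNr opprK.
have cF := is_derive_continuous dF.
rewrite (@ge0_continuous_FTC2y _ _ (fun x => - gauss a x) r 0)//.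
- by rewrite sub0e -EFinN opprK.
- by move=> x rx; rewrite !mulr_ge0 ?gauss_ge0 ?(ltW a0)// (le_trans r0).
- apply: continuous_subspaceT => x; apply: cvgM; last exact: continuous_gauss.
  by apply: cvgM => //; exact: cvg_cst.
- by rewrite -oppr0; apply: cvgN; exact: cvg_gauss.
- by apply: cvg_at_right_filter; exact: cF.
- by move=> x _; rewrite derive1E; exact: derive_val.
Qed.

Lemma ge0_integral_mulc (i : interval R) (f : R -> R) (k : R) :
  measurable_fun setT (f : measurableTypeR R -> R) ->
  (forall x, x \in i -> 0 <= f x) -> 0 <= k ->
  (\int[mu]_(x in [set` i]) (k * f x)%:E = k%:E * \int[mu]_(x in [set` i]) (f x)%:E)%E.
Proof.
move=> mf f0 k0; under eq_integral do rewrite EFinM.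
rewrite ge0_integralZl//.
by apply/measurable_EFinP/measurable_funTS.
Qed.

Definition gmoment a m : \bar R := (\int[mu]_(r in `[0%R, +oo[) (r ^+ m * gauss a r)%:E)%E.

Lemma gmoment1 a : 0 < a -> gmoment a 1 = (2 * a)^-1%:E.
Proof.
move=> a0; have := integral_gauss_tail a0 (lexx 0).
have -> : gauss a 0 = 1 by rewrite /gauss expr0n/= mulr0 oppr0 expR0.
have c0 : 0 < 2 * a by rewrite mulr_gt0.
under eq_integral do rewrite -mulrA.
rewrite ge0_integral_mulc; last 3 first.
- by apply: measurable_funM => //; exact: measurable_gauss.
- by move=> r; rewrite in_itv/= andbT => r0; rewrite mulr_ge0// gauss_ge0.
- exact: ltW.
rewrite -[integral _ _ _]/(gmoment a 1); case: (gmoment a 1) => [x| |]/=.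
- by rewrite -EFinM => -[h]; congr (_%:E); rewrite -[x](mulKf (lt0r_neq0 c0)) h mulr1.
- by rewrite mulry gtr0_sg// mul1e.
- by rewrite mulrNy gtr0_sg// mul1e.
Qed.

Lemma gmoment0 a : 0 < a -> gmoment a 0 = (Num.sqrt pi / (2 * Num.sqrt a))%:E.
Proof.
move=> a0; have s0 : 0 < Num.sqrt a by rewrite sqrtr_gt0.
have h := @ge0_integral_scale_gt0 R (Num.sqrt a)
  (fun x => ((gauss 1 x) * \1_(`[0, +oo[%classic : set R) x)%:E) s0.
have m1 : measurable_fun setT (fun x : R => (gauss 1 x * \1_(`[0, +oo[%classic : set R) x)%:E).
  apply/measurable_EFinP/measurable_funM; first exact: measurable_gauss.
  by apply: measurable_indic; exact: measurable_itv.
have {h} := h m1.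
have restr (u : R -> R) : (\int[mu]_x (u x * \1_(`[0, +oo[%classic : set R) x)%:E =
    \int[mu]_(x in `[0%R, +oo[) (u x)%:E)%E.
  rewrite [RHS]integral_mkcond; apply: eq_integral => x _.
  by rewrite patchE indicE; case: ifP; rewrite ?mulr1 ?mulr0.
rewrite restr.
have -> : (\int[mu]_(x in `[0%R, +oo[) (gauss 1 x)%:E = (Num.sqrt pi / 2)%:E)%E.
  by rewrite -integral0y_gauss; apply: eq_integral => x _; rewrite /gauss mul1r.
have -> : (\int[mu]_x (gauss 1 (Num.sqrt a * x) * \1_(`[0, +oo[%classic : set R) (Num.sqrt a * x)%R)%:E =
    gmoment a 0)%E.
  rewrite /gmoment -restr; apply: eq_integral => x _.
  rewrite expr0 mul1r /gauss exprMn sqr_sqrtr ?(ltW a0)// mul1r; congr ((_ * _)%:E).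
  by rewrite !indicE !mem_setE !in_itv/= !andbT pmulr_rge0.
move=> h; have {}h : ((Num.sqrt a)%:E * gmoment a 0 = (Num.sqrt pi / 2)%:E)%E.
  by apply: h => x; rewrite lee_fin mulr_ge0 ?gauss_ge0// indicE.
move: h; case: (gmoment a 0) => [x| |]/=.
- by rewrite -EFinM => -[h]; congr (_%:E); rewrite invfM mulrA -h mulrAC mulfV ?mul1r ?gt_eqF.
- by rewrite mulry gtr0_sg// mul1e.
- by rewrite mulrNy gtr0_sg// mul1e.
Qed.

(** Tonelli for r^m (2 a s) exp (- a s^2) on the region 0 <= r <= s: integrating
in s first leaves the m-th moment, integrating in r first the (m+2)-nd. *)
Lemma gmoment_rec a m : 0 < a ->
  (m.+1%:R%:E * gmoment a m = (2 * a)%:E * gmoment a m.+2)%E.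
Proof.
move=> a0; pose T := measurableTypeR R.
pose h (z : T * T) : \bar R :=
  (if (0 <= z.1) && (z.1 <= z.2) then z.1 ^+ m * (2 * a * z.2 * gauss a z.2) else 0)%:E.
have h0 z : (0 <= h z)%E.
  rewrite /h lee_fin; case: ifPn => // /andP[z0 z12].
  apply: mulr_ge0; first exact: exprn_ge0.
  exact: gauss_slope_ge0 (le_trans z0 z12).
have hE (r s : R) : h (r, s) =
  (if (0 <= r) && (r <= s) then r ^+ m * (2 * a * s * gauss a s) else 0)%:E by [].
have hneg (r s : R) : s < 0 -> h (r, s) = 0%E.
  move=> s0; rewrite /h/=; case: ifPn => // /andP[r0 rs].
  by have := le_lt_trans (le_trans r0 rs) s0; rewrite ltxx.
have mh : measurable_fun setT h.
  apply/measurable_EFinP/measurable_fun_ifT => //.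
  - apply: measurable_and; apply: measurable_fun_ler => //; try exact: measurable_cst;
      by [exact: measurable_fst|exact: measurable_snd].
  - apply: measurable_funM; first by apply: measurable_funX; exact: measurable_fst.
    apply: measurable_funM; first by apply: measurable_funM => //; exact: measurable_snd.
    by apply: (measurableT_comp (measurable_gauss a)); exact: measurable_snd.
clearbody h.
have EF := @fubini_tonelli _ _ T T R mu mu h mh h0.
have E1 : (\int[mu]_r \int[mu]_s h (r, s) = gmoment a m)%E.
  rewrite /gmoment [RHS]integral_mkcond; apply: eq_integral => r _; rewrite patchE mem_setE in_itv/= andbT.
  case: ifPn => r0; last by apply: integral0_eq => s _; rewrite hE (negbTE r0).
  rewrite EFinM -(integral_gauss_tail a0 r0) -ge0_integral_mulc; last 3 first.
  - by apply: measurable_funM; [exact: measurable_funM|exact: measurable_gauss].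
  - move=> s; rewrite in_itv/= andbT => rs.
    exact: gauss_slope_ge0 (le_trans r0 rs).
  - by rewrite exprn_ge0.
  rewrite [RHS]integral_mkcond; apply: eq_integral => s _.
  rewrite patchE mem_setE in_itv/= andbT hE r0 andTb.
  case: ifP => _; reflexivity.
have E2 : (\int[mu]_s \int[mu]_r h (r, s) =
    \int[mu]_(s in `[0%R, +oo[) ((2 * a / m.+1%:R) * (s ^+ m.+2 * gauss a s))%:E)%E.
  rewrite [RHS]integral_mkcond; apply: eq_integral => s _; rewrite patchE mem_setE in_itv/= andbT.
  case: leP => s0; last by apply: integral0_eq => r _; exact: hneg.
  have c0 := gauss_slope_ge0 a0 s0.
  transitivity (\int[mu]_(r in `[0%R, s]) ((2 * a * s * gauss a s) * r ^+ m)%:E)%E.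
    rewrite [RHS]integral_mkcond; apply: eq_integral => r _.
    rewrite patchE mem_setE in_itv/= hE; case: ifP => _; last reflexivity.
    by rewrite mulrC.
  rewrite ge0_integral_mulc; last 3 first.
  - exact: measurable_funX.
  - by move=> r; rewrite in_itv/= => /andP[r0 _]; rewrite exprn_ge0.
  - exact: c0.
  have dX x : is_derive x (1 : R) (fun r : R => m.+1%:R^-1 * r ^+ m.+1) (x ^+ m).
    apply: (is_derive_eq (is_derive_scale _ (is_derive_expn _ _))).
    by rewrite mulKf// pnatr_eq0.
  rewrite (integral_is_derive dX (@exprn_continuous R m) s0) -EFinM; congr (_%:E).
  rewrite expr0n/= mulr0 subr0 [s ^+ m.+2]exprS; set y := s ^+ m.+1; set q := m.+1%:R^-1.
  by ring.
have k0 : 0 <= 2 * a / m.+1%:R by rewrite !mulr_ge0 ?(ltW a0).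
have {E1 EF E2} := etrans (esym E1) (etrans EF E2).
rewrite ge0_integral_mulc//; last 2 first.
- by apply: measurable_funM => //; exact: measurable_gauss.
- by move=> s; rewrite in_itv/= andbT => s0; rewrite mulr_ge0 ?exprn_ge0 ?gauss_ge0.
rewrite -/(gmoment a m.+2) => ->; rewrite muleA -EFinM; congr (_%:E * _)%E.
by rewrite mulrC divfK// pnatr_eq0.
Qed.
End gaussian_moments.

Section gaussian_moments_fin.
Context {R : realType}.

Definition gmom (a : R) m : R := fine (gmoment a m).

Lemma gmomP (a : R) m : 0 < a ->
  gmoment a m = (gmom a m)%:E /\ gmom a m.+2 = m.+1%:R / (2 * a) * gmom a m.
Proof.
move=> a0; have a20 : 0 < 2 * a by rewrite mulr_gt0.
suff fin : forall m, gmoment a m \is a fin_num.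
  split; first by rewrite /gmom fineK.
  have := gmoment_rec m a0; rewrite -(fineK (fin m)) -(fineK (fin m.+2)) -!EFinM -!/(gmom _ _).
  by move=> [h]; rewrite mulrAC h mulrAC mulfV ?mul1r ?gt_eqF.
move=> {}m; suff : gmoment a m \is a fin_num /\ gmoment a m.+1 \is a fin_num by case.
elim: m => [|m [IH1 IH2]]; first by rewrite gmoment0// gmoment1.
split=> //; have := gmoment_rec m a0; rewrite -(fineK IH1) -EFinM.
case: (gmoment a m.+2) => [r _||]; first by [].
- by rewrite mulry gtr0_sg// mul1e.
- by rewrite mulrNy gtr0_sg// mul1e.
Qed.

Lemma gmom0 (a : R) : 0 < a -> gmom a 0 = Num.sqrt pi / (2 * Num.sqrt a).
Proof. by move=> a0; rewrite /gmom gmoment0. Qed.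

Lemma gmom1 (a : R) : 0 < a -> gmom a 1 = (2 * a)^-1.
Proof. by move=> a0; rewrite /gmom gmoment1. Qed.

Lemma gmom_gt0 (a : R) m : 0 < a -> 0 < gmom a m.
Proof.
move=> a0; suff : 0 < gmom a m /\ 0 < gmom a m.+1 by case.
elim: m => [|m [IH1 IH2]].
  by rewrite gmom0// gmom1// invr_gt0 divr_gt0 ?sqrtr_gt0 ?pi_gt0 ?mulr_gt0// sqrtr_gt0.
by split=> //; rewrite (gmomP m a0).2 mulr_gt0// divr_gt0// mulr_gt0.
Qed.

Lemma gmom_odd (a : R) j : 0 < a -> gmom a (j.*2).+1 = j`!%:R / (2 * a ^+ j.+1).
Proof.
move=> a0; elim: j => [|j IH]; first by rewrite gmom1// expr1 fact0 mul1r.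
rewrite doubleS (gmomP _ a0).2 IH factS natrM [in RHS]exprS -doubleS -muln2 natrM.
have a_ne : a != 0 by rewrite gt_eqF.
have y0 : a ^+ j.+1 != 0 by exact: expf_neq0.
by set y := a ^+ j.+1 in y0 *; field; rewrite ?y0 ?a_ne.
Qed.
End gaussian_moments_fin.

Section sector_moment.
Context {R : realType}.
Local Notation mu := (@lebesgue_measure R).

Lemma ge0_integral_muN (N : nat) (f : plane R -> R) :
  measurable_fun setT f -> (forall z, 0 <= f z) ->
  (\int[muN R N]_z (f z)%:E = \int[leb2 R]_z (f z * gauss_weight N z)%:E)%E.
Proof.
move=> mf f0; rewrite /muN ge0_integral_mdensity//; last exact/measurable_EFinP.
Qed.

Lemma gauss_weightE N (z : plane R) : gauss_weight N z = gauss N%:R (Normc.normc (cplx z)).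
Proof. by []. Qed.

Variables (N : nat) (N0 : (0 < N)%N) (n : nat) (a : R) (a0pi : 0 <= a <= pi).
Let NR : 0 < N%:R :> R. Proof. by rewrite ltr0n. Qed.

Lemma ge0_integral_muN_sector (g G : R -> R) (c : R) (f : plane R -> R) :
  continuous g -> (forall x, 0 <= g x) ->
  (forall x, is_derive x (1 : R) G (g x)) ->
  (forall x, G (x + pi *+ 2) = G x + c) ->
  measurable_fun setT f -> (forall z, 0 <= f z) ->
  (forall r x, 0 <= r -> f (r * cos x, r * sin x) = r ^+ n * g x) ->
  (\int[muN R N]_z (f z * \1_(sector a) z)%:E =
    (gmom N%:R n.+1 * (G a - G (- a)))%:E)%E.
Proof.
move=> cg g0 dG Gper mf f0 fE.
have mS : measurable_fun setT (\1_(sector a) : plane R -> R).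
  by apply: measurable_indic; exact: measurable_sector.
rewrite ge0_integral_muN; last 2 first.
- exact: measurable_funM.
- by move=> z; rewrite mulr_ge0// indicE.
under eq_integral do rewrite mulrAC.
have mw := @measurable_gauss_weight R N.
rewrite (ge0_integral_sector cg g0 dG Gper (F := fun r => `|r| ^+ n * gauss N%:R r))//; last 5 first.
- exact: measurable_funM.
- by move=> z; rewrite mulr_ge0// gauss_weight_ge0.
- apply: measurable_funM; last exact: measurable_gauss.
  by apply: measurable_funX; exact: normr_measurable.
- by move=> r; rewrite mulr_ge0 ?exprn_ge0// gauss_ge0.
- move=> r x r0; rewrite fE// gauss_weightE normc_polar ger0_norm//.
  by rewrite -!mulrA; congr (_ * _); rewrite mulrC.
rewrite EFinM; congr (_ * _)%E; rewrite -(gmomP n.+1 NR).1.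
apply: eq_integral => r; rewrite mem_setE in_itv/= andbT => r0.
by rewrite exprS -mulrA ger0_norm.
Qed.

(** The integral of cos (d t + phi) over [- a, a]. *)
Definition sector_angle (d phi : R) : R :=
  if d == 0 then 2 * a * cos phi else (sin (d * a + phi) + sin (d * a - phi)) / d.

Lemma periodic_natsub (j k : nat) (x phi : R) (f : R -> R) : periodic f (pi *+ 2) ->
  f ((j%:R - k%:R) * (x + pi *+ 2) + phi) = f ((j%:R - k%:R) * x + phi).
Proof.
move=> fp; rewrite -(periodicn fp k) -(periodicn fp j ((j%:R - k%:R) * x + phi)); congr f.
by rewrite -[pi *+ 2 *+ k]mulr_natl -[pi *+ 2 *+ j]mulr_natl; ring.
Qed.

(** Here h changes sign, while polar coordinates are available for nonnegative
functions only: the formula is the difference of those for |z|^n + h and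
for |z|^n. *)
Lemma sector_moment (j k : nat) (phi : R) (h : plane R -> R) :
  (j + k)%N = n ->
  measurable_fun setT h -> (forall z, `|h z| <= Normc.normc (cplx z) ^+ n) ->
  (forall r x, 0 <= r -> h (r * cos x, r * sin x) = r ^+ n * cos ((j%:R - k%:R) * x + phi)) ->
  (muN R N).-integrable setT (EFin \o (fun z => h z * \1_(sector a) z)) /\
  \int[muN R N]_z (h z * \1_(sector a) z) =
    gmom N%:R n.+1 * sector_angle (j%:R - k%:R) phi.
Proof.
move=> jkn mh hn hE; set d : R := j%:R - k%:R.
pose p (z : plane R) : R := Normc.normc (cplx z) ^+ n.
have mp : measurable_fun setT p by apply: measurable_funX; exact: measurable_normc.
have p0 z : 0 <= p z by rewrite exprn_ge0// /Normc.normc/= sqrtr_ge0.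
have mS : measurable_fun setT (\1_(sector a) : plane R -> R).
  by apply: measurable_indic; exact: measurable_sector.
have I1 : (\int[muN R N]_z (p z * \1_(sector a) z)%:E = (gmom N%:R n.+1 * (a - - a))%:E)%E.
  apply: (@ge0_integral_muN_sector (fun=> 1) id (pi *+ 2)) => //.
  - by move=> x; exact: cvg_cst.
  - by move=> r x r0; rewrite /p normc_polar ger0_norm// mulr1.
pose G x : R := if d == 0 then x + x * cos phi else x + d^-1 * sin (d * x + phi).
pose c : R := if d == 0 then pi *+ 2 + pi *+ 2 * cos phi else pi *+ 2.
(* 1 + cos is a nonnegative angular profile with an explicit primitive G. *)
have I2 : (\int[muN R N]_z ((p z + h z) * \1_(sector a) z)%:E =
    (gmom N%:R n.+1 * (G a - G (- a)))%:E)%E.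
  apply: (@ge0_integral_muN_sector (fun x => 1 + cos (d * x + phi)) G c) => //.
  - move=> x; apply: cvgD; first exact: cvg_cst.
    apply: (@continuous_comp _ _ _ (fun x => d * x + phi) cos); last exact: continuous_cos.
    by apply: cvgD; [apply: cvgM => //; exact: cvg_cst|exact: cvg_cst].
  - move=> x; rewrite /G; have [d0|d0] := eqVneq d 0.
      rewrite d0 mul0r add0r; apply: is_derive_eq.
      by rewrite scaler0 add0r /GRing.scale/= mulr1.
    have d1 : is_derive x (1 : R) (fun x : R => d * x + phi) d.
      by apply: (is_derive_eq (is_deriveD (is_derive_scale d (is_derive_id x (1 : R))) (is_derive_cst phi x (1 : R)))); rewrite mulr1 addr0.
    have d2 := is_derive_scale d^-1 (@is_derive1_comp R sin (fun x : R => d * x + phi) x _ _ (is_derive_sin (d * x + phi)) d1).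
    by apply: (is_derive_eq (is_deriveD (is_derive_id x (1 : R)) d2)); rewrite mulrCA mulVf// mulr1.
  - move=> x; rewrite /G /c; case: (d == 0); first by ring.
    by rewrite (periodic_natsub j k x phi (@sinD2pi R)) /d; ring.
  - exact: measurable_funD.
  - by move=> z; rewrite -[h z]opprK subr_ge0 (le_trans _ (hn z))// -normrN ler_norm.
  - by move=> r x r0; rewrite hE// /p normc_polar ger0_norm// mulrDr mulr1.
have fin (u : plane R -> R) (y : R) : measurable_fun setT u -> (forall z, 0 <= u z) ->
    (\int[muN R N]_z (u z)%:E = y%:E)%E -> (muN R N).-integrable setT (EFin \o u).
  move=> mu' u0 E; apply/integrableP; split; first exact/measurable_EFinP.
  rewrite (eq_integral (fun z => (u z)%:E)); last by move=> z _; rewrite /= ger0_norm.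
  by rewrite E ltry.
have i1 : (muN R N).-integrable setT (EFin \o (fun z => p z * \1_(sector a) z)).
  apply: (fin _ _ _ _ I1); first exact: measurable_funM.
  by move=> z; rewrite mulr_ge0// indicE.
have i2 : (muN R N).-integrable setT (EFin \o (fun z => (p z + h z) * \1_(sector a) z)).
  apply: (fin _ _ _ _ I2); first by apply: measurable_funM => //; exact: measurable_funD.
  move=> z; rewrite mulr_ge0// ?indicE//.
  by rewrite -[h z]opprK subr_ge0 (le_trans _ (hn z))// -normrN ler_norm.
have hd z : h z * \1_(sector a) z = (p z + h z) * \1_(sector a) z - p z * \1_(sector a) z.
  by rewrite mulrDl addrAC subrr add0r.
split.
  by rewrite /comp; under eq_fun do rewrite hd EFinB; exact: integrableB.
under eq_Rintegral do rewrite hd.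
rewrite RintegralB// /Rintegral I1 I2/= -mulrBr; congr (_ * _).
rewrite /G /sector_angle; case: ifPn => d0; first by ring.
rewrite (_ : d * - a + phi = - (d * a - phi)); last by ring.
by rewrite sinN; field.
Qed.
End sector_moment.

(** * The orthogonal monomials of the Ginibre ensemble *)

Lemma sin_natM_pi (R : realType) n : sin (n%:R * pi) = 0 :> R.
Proof.
elim: n => [|n IH]; first by rewrite mul0r sin0.
by rewrite -natr1 mulrDl mul1r sinDpi IH oppr0.
Qed.

Section monomials.
Context {R : realType}.

Definition cis (x : R) : R[i] := (cos x +i* sin x)%C.

Lemma cisD (x y : R) : cis (x + y) = cis x * cis y.
Proof. by rewrite /cis cosD sinD; apply/eqP; rewrite eq_complex/= eqxx [_ * sin y]mulrC addrC/= eqxx. Qed.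

Lemma cisX (x : R) n : cis x ^+ n = cis (n%:R * x).
Proof.
elim: n => [|n IH]; first by rewrite expr0 mul0r /cis cos0 sin0.
by rewrite exprS IH -cisD -[in RHS]natr1; congr cis; ring.
Qed.

Lemma conjc_cis (x : R) : conjc (cis x) = cis (- x).
Proof. by rewrite /cis cosN sinN. Qed.

Lemma conjcX (z : R[i]) n : conjc (z ^+ n) = conjc z ^+ n.
Proof. exact: rmorphXn. Qed.

Definition monom (j k : nat) (z : plane R) : R[i] := cplx z ^+ j * conjc (cplx z) ^+ k.

Lemma monom_polar j k (r x : R) :
  monom j k (r * cos x, r * sin x) = (r ^+ (j + k))%:C%C * cis ((j%:R - k%:R) * x).
Proof.
have -> : monom j k (r * cos x, r * sin x) = (r%:C%C * cis x) ^+ j * (r%:C%C * cis (- x)) ^+ k.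
  rewrite /monom -conjc_cis; congr (_ ^+ _ * _ ^+ _); apply/eqP; rewrite eq_complex/=;
  by rewrite !mul0r ?subr0 ?addr0 ?mulrN ?oppr0 !eqxx.
rewrite !exprMn !cisX mulrACA -cisD -exprD -rmorphXn/=.
by congr (_ * cis _); ring.
Qed.

Lemma normc_conjc (z : R[i]) : Normc.normc (conjc z) = Normc.normc z.
Proof. by case: z => a b /=; rewrite sqrrN. Qed.

Lemma normcX (z : R[i]) n : Normc.normc (z ^+ n) = Normc.normc z ^+ n.
Proof.
elim: n => [|n IH]; first by rewrite !expr0 Normc.normc1.
by rewrite !exprS Normc.normcM IH.
Qed.

Lemma normc_monom j k z : Normc.normc (monom j k z) = Normc.normc (cplx z) ^+ (j + k).
Proof. by rewrite Normc.normcM !normcX normc_conjc exprD. Qed.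

Lemma Re_le_normc (z : R[i]) : `|complex.Re z| <= Normc.normc z.
Proof.
by case: z => a b /=; rewrite -(sqrtr_sqr a) ler_wsqrtr// lerDl sqr_ge0.
Qed.

Lemma Im_le_normc (z : R[i]) : `|complex.Im z| <= Normc.normc z.
Proof.
by case: z => a b /=; rewrite -(sqrtr_sqr b) ler_wsqrtr// lerDr sqr_ge0.
Qed.

Definition cmeasurable (f : plane R -> R[i]) :=
  measurable_fun setT (fun z => complex.Re (f z)) /\
  measurable_fun setT (fun z => complex.Im (f z)).

Lemma cmeasurableM f g : cmeasurable f -> cmeasurable g -> cmeasurable (fun z => f z * g z).
Proof.
move=> [f1 f2] [g1 g2]; split.
  by under eq_fun do rewrite ReM; apply: measurable_funB; exact: measurable_funM.
by under eq_fun do rewrite ImM; apply: measurable_funD; exact: measurable_funM.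
Qed.

Lemma cmeasurableX f n : cmeasurable f -> cmeasurable (fun z => f z ^+ n).
Proof.
move=> mf; elim: n => [|n IH].
  by split; under eq_fun do rewrite expr0; exact: measurable_cst.
have := cmeasurableM mf IH; rewrite /cmeasurable.
by under eq_fun do rewrite -exprS; under [X in _ /\ measurable_fun _ X]eq_fun do rewrite -exprS.
Qed.

Lemma cmeasurable_monom j k : cmeasurable (monom j k).
Proof.
apply: cmeasurableM; apply: cmeasurableX; split => /=.
- exact: measurable_fst.
- exact: measurable_snd.
- exact: measurable_fst.
- by apply: measurableT_comp => //; exact: measurable_snd.
Qed.

(** The imaginary part vanishes since the sector is symmetric about the real
axis. *)
Lemma cint_monom_sector (N j k : nat) (a : R) : (0 < N)%N -> 0 <= a <= pi ->
  cintegrable (muN R N) (fun z => monom j k z * ((\1_(sector a) z : R)%:C)%C) /\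
  cint (muN R N) (fun z => monom j k z * ((\1_(sector a) z : R)%:C)%C) =
    ((gmom N%:R (j + k).+1 * sector_angle a (j%:R - k%:R) 0)%:C)%C.
Proof.
move=> N0 api; have [mR mI] := cmeasurable_monom j k.
have hR z : `|complex.Re (monom j k z)| <= Normc.normc (cplx z) ^+ (j + k).
  by rewrite -normc_monom Re_le_normc.
have hI z : `|complex.Im (monom j k z)| <= Normc.normc (cplx z) ^+ (j + k).
  by rewrite -normc_monom Im_le_normc.
have pR (r x : R) : 0 <= r -> complex.Re (monom j k (r * cos x, r * sin x)) =
    r ^+ (j + k) * cos ((j%:R - k%:R) * x + 0).
  by move=> r0; rewrite monom_polar ReM/= mul0r subr0 addr0.
have pI (r x : R) : 0 <= r -> complex.Im (monom j k (r * cos x, r * sin x)) =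
    r ^+ (j + k) * cos ((j%:R - k%:R) * x + - (pi / 2)).
  by move=> r0; rewrite monom_polar ImM/= mul0r addr0 cosBpihalf.
have [iR eR] := sector_moment N0 api erefl mR hR pR.
have [iI eI] := sector_moment N0 api erefl mI hI pI.
have ReE z : complex.Re (monom j k z * ((\1_(sector a) z : R)%:C)%C) =
    complex.Re (monom j k z) * \1_(sector a) z.
  by rewrite ReM/= mulr0 subr0.
have ImE z : complex.Im (monom j k z * ((\1_(sector a) z : R)%:C)%C) =
    complex.Im (monom j k z) * \1_(sector a) z.
  by rewrite ImM/= mulr0 add0r.
split.
  split; rewrite /comp.
    by under eq_fun do rewrite ReE.
  by under eq_fun do rewrite ImE.
rewrite /cint; apply/eqP; rewrite eq_complex/=; apply/andP; split; apply/eqP.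
  by under eq_Rintegral do rewrite ReE.
under eq_Rintegral do rewrite ImE.
rewrite eI /sector_angle; case: ifPn => d0.
  by rewrite cosN cos_pihalf !mulr0.
rewrite sinBpihalf opprK sinDpihalf addNr mul0r mulr0//.
Qed.

(** The sector of half-angle pi is the whole plane, so that orthonormality of the
monomials is the special case a = pi of [ginibre_sector_int]. *)
Lemma sector_pi (z : plane R) : \1_(sector pi) z = 1 :> R.
Proof.
rewrite indic_sector cospi (_ : _ && _ = true)//.
rewrite lerN10 orbT andbT mulrN1 lerNl.
by apply: le_trans (Re_le_normc (cplx z)); rewrite -normrN ler_norm.
Qed.

Lemma sector_angle_pi (j k : nat) :
  sector_angle pi (j%:R - k%:R) 0 = (j == k)%:R * (2 * pi) :> R.
Proof.
rewrite /sector_angle subr_eq0 eqr_nat; case: eqVneq => [_|jk].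
  by rewrite cos0 mulr1 mul1r.
by rewrite addr0 subr0 mulrBl sinB !sin_natM_pi !mul0r mulr0 subrr addr0 !mul0r.
Qed.

End monomials.

Lemma conjcM (R : realType) (x y : R[i]) : conjc (x * y) = conjc x * conjc y.
Proof. exact: rmorphM. Qed.

Lemma conjc_prod (R : realType) (I : Type) (s : seq I) (P : pred I) (F : I -> R[i]) :
  conjc (\prod_(i <- s | P i) F i) = \prod_(i <- s | P i) conjc (F i).
Proof. exact: rmorph_prod. Qed.

Lemma realcM (R : realType) (x y : R) : ((x * y)%:C = x%:C * y%:C)%C.
Proof. exact: rmorphM. Qed.

Lemma realc_prod (R : realType) (I : Type) (s : seq I) (P : pred I) (F : I -> R) :
  ((\prod_(i <- s | P i) F i)%:C)%C = \prod_(i <- s | P i) ((F i)%:C)%C.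
Proof. exact: rmorph_prod. Qed.

Section ginibre_slater.
Context {R : realType}.
Variable N : nat.
Hypothesis N0 : (0 < N)%N.
Let NR : 0 < N%:R :> R. Proof. by rewrite ltr0n. Qed.

(** The squared norm of z^j in L^2(mu_N). *)
Definition monom_norm2 (j : nat) : R := gmom N%:R (j + j).+1 * (2 * pi).

Lemma monom_norm2_gt0 j : 0 < monom_norm2 j.
Proof. by rewrite mulr_gt0 ?gmom_gt0// mulr_gt0// pi_gt0. Qed.

Let c j : R := (Num.sqrt (monom_norm2 j))^-1.
Let c_sqr j : c j * c j = (monom_norm2 j)^-1.
Proof. by rewrite /c -invfM -expr2 sqr_sqrtr// ltW// monom_norm2_gt0. Qed.

Definition ginibre_phi (j : 'I_N) (z : plane R) : R[i] := ((c j)%:C)%C * cplx z ^+ j.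

Lemma ginibre_phiM (i j : 'I_N) (z : plane R) :
  ginibre_phi i z * conjc (ginibre_phi j z) = ((c i * c j)%:C)%C * monom i j z.
Proof.
by rewrite /ginibre_phi conjcM conjc_real conjcX mulrACA realcM.
Qed.

Lemma normc2_mulJ (w : R[i]) : ((Normc.normc w ^+ 2)%:C)%C = w * conjc w.
Proof.
rewrite normc_sqrE; case: w => a b; apply/eqP; rewrite eq_complex/=.
by apply/andP; split; apply/eqP; ring.
Qed.

(** Rescales the columns of the Vandermonde matrix by the norms of the monomials. *)
Lemma vandermonde2_slater (z : N.-tuple (plane R)) :
  (vandermonde2 z)%:C%C =
  ((\prod_(j < N) monom_norm2 j)%:C)%C * (slater ginibre_phi z * conjc (slater ginibre_phi z)).
Proof.
pose a : 'rV[R[i]]_N := \row_k cplx (tnth z k).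
have -> : slater ginibre_phi z = \det (Vandermonde N a) * ((\prod_(j < N) c j)%:C)%C.
  rewrite -det_tr realc_prod.
  have -> : \prod_(j < N) ((c j)%:C)%C = \det (diag_mx (\row_(j < N) ((c j)%:C)%C)).
    by rewrite det_diag; apply: eq_bigr => j _; rewrite mxE.
  rewrite -det_mulmx mul_mx_diag; congr (\det _); apply/matrixP => k j.
  by rewrite !mxE mulrC.
have -> : (vandermonde2 z)%:C%C = \det (Vandermonde N a) * conjc (\det (Vandermonde N a)).
  rewrite det_Vandermonde conjc_prod -big_split/= /vandermonde2 realc_prod.
  under [RHS]eq_bigr do rewrite conjc_prod -big_split/=.
  rewrite [RHS](exchange_big_dep xpredT)//; apply: eq_bigr => k _.
  rewrite realc_prod; apply: eq_bigr => l _.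
  rewrite !mxE normc2_mulJ -mulrNN.
  have -> (w : R[i]) : - conjc w = conjc (- w) by case: w.
  by rewrite !opprB.
rewrite conjcM conjc_real; set D := \det _; set C := ((\prod_(j < N) c j)%:C)%C.
rewrite (_ : _ * (D * C * (conjc D * C)) =
  D * conjc D * (((\prod_(j < N) monom_norm2 j)%:C)%C * (C * C))); last by ring.
rewrite -[LHS]mulr1; congr (_ * _); rewrite /C.
rewrite -!realcM -big_split/= -big_split/=.
rewrite big1// => j _; rewrite c_sqr mulfV// gt_eqF//.
exact: monom_norm2_gt0.
Qed.

Definition ginibre_gram (a : R) (i j : nat) : R :=
  c i * c j * (gmom N%:R (i + j).+1 * sector_angle a (i%:R - j%:R) 0).

Lemma ginibre_sector_int (a : R) : 0 <= a <= pi -> forall i j : 'I_N,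
  cintegrable (muN R N) (fun z => ginibre_phi i z * conjc (ginibre_phi j z) *
    ((\1_(sector a) z : R)%:C)%C) /\
  cint (muN R N) (fun z => ginibre_phi i z * conjc (ginibre_phi j z) *
    ((\1_(sector a) z : R)%:C)%C) = ((ginibre_gram a i j)%:C)%C.
Proof.
move=> api i j.
have E : (fun z => ginibre_phi i z * conjc (ginibre_phi j z) * ((\1_(sector a) z : R)%:C)%C) =
  fun z => ((c i * c j)%:C)%C * (monom i j z * ((\1_(sector a) z : R)%:C)%C).
  by apply/funext => z; rewrite ginibre_phiM mulrA.
have [ci ce] := cint_monom_sector i j N0 api.
rewrite E; split; first exact: cintegrableZ.
by rewrite cintZ// ce -realcM.
Qed.

Lemma ginibre_phi_orth (i j : 'I_N) :
  cintegrable (muN R N) (fun z => ginibre_phi i z * conjc (ginibre_phi j z)) /\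
  cint (muN R N) (fun z => ginibre_phi i z * conjc (ginibre_phi j z)) = (i == j)%:R.
Proof.
have p0 : 0 <= (pi : R) <= pi by rewrite lexx pi_ge0.
have [] := ginibre_sector_int p0 i j.
have -> : (fun z => ginibre_phi i z * conjc (ginibre_phi j z) * ((\1_(sector pi) z : R)%:C)%C) =
    fun z => ginibre_phi i z * conjc (ginibre_phi j z).
  by apply/funext => z; rewrite sector_pi mulr1.
move=> ? ->; split => //; rewrite /ginibre_gram sector_angle_pi -val_eqE/=.
case: eqVneq => [->|_]; last by rewrite mul0r !mulr0.
by rewrite mul1r c_sqr mulVf// gt_eqF// monom_norm2_gt0.
Qed.

Lemma ginibre_gram_mulC (a : R) (i j : nat) : ginibre_gram a i j * ginibre_gram a j i =
  gmom N%:R (i + j).+1 ^+ 2 * (sector_angle a (i%:R - j%:R) 0) ^+ 2 /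
    (monom_norm2 i * monom_norm2 j).
Proof.
rewrite /ginibre_gram.
have -> : sector_angle a (j%:R - i%:R) 0 = sector_angle a (i%:R - j%:R) 0.
  rewrite /sector_angle !subr_eq0 [j%:R == _]eq_sym; case: ifPn => // ij.
  rewrite -(opprB i%:R) !addr0 !subr0 mulNr sinN invrN -opprD mulrNN//.
by rewrite [(j + i)%N]addnC invfM -!c_sqr !expr2; ring.
Qed.

Lemma ginibre_gram_diag (a : R) (i : nat) : ginibre_gram a i i = a / pi.
Proof.
rewrite /ginibre_gram c_sqr subrr /sector_angle eqxx cos0 mulr1 /monom_norm2.
have p0 : (pi : R) != 0 by rewrite gt_eqF// pi_gt0.
have g0 : gmom N%:R (i + i).+1 != 0 :> R by rewrite gt_eqF// gmom_gt0.
rewrite invfM mulrACA mulVf// mul1r invfM mulrACA mulVf ?pnatr_eq0// mul1r.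
by rewrite mulrC.
Qed.
End ginibre_slater.

(** * The variance as a double sum *)

Section ginibre_variance.
Context {R : realType}.
Local Notation mu := (@lebesgue_measure R).

(** The arccosine is decreasing, so |arg z| <= a is a lower bound on the cosine. *)
Lemma sector_argE (a : R) (z : plane R) : 0 <= a <= pi ->
  (- a <= arg (cplx z) <= a) = ((Normc.normc (cplx z) * cos a <= z.1) &&
           ((0 < Normc.normc (cplx z)) || (cos a <= 0))).
Proof.
move=> api; set r := Normc.normc (cplx z).
have r0 : 0 <= r by rewrite /r /Normc.normc/= sqrtr_ge0.
have zr : `|z.1| <= r := Re_le_normc (cplx z).
have x1 : -1 <= z.1 / r <= 1.
  rewrite -ler_norml normrM normfV (ger0_norm r0).
  move: r0 zr; rewrite le_eqVlt => /predU1P[<-|r0 zr]; first by rewrite invr0 mulr0.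
  by rewrite ler_pdivrMr// mul1r.
have acos0 := acos_ge0 x1; have acospi := acos_lepi x1.
have -> : (- a <= arg (cplx z) <= a) = (acos (z.1 / r) <= a).
  rewrite /arg -/r/=; case: ifP => _.
    by rewrite andb_idl// => _; rewrite (le_trans _ acos0)// oppr_le0; case/andP: api.
  by rewrite lerN2 andb_idr// => _; rewrite (le_trans _ (_ : 0 <= a))// ?oppr_le0//; case/andP: api.
have -> : (acos (z.1 / r) <= a) = (cos a <= z.1 / r).
  by rewrite -[in RHS](acosK (x := z.1 / r)) ?in_itv//= ler_cos_itv// acos0 acospi.
move: r0 zr; rewrite le_eqVlt => /predU1P[<-|r0 zr].
  by rewrite normr_le0 => /eqP ->; rewrite !mul0r lexx ltxx.
by rewrite ler_pdivlMr// mulrC r0 andbT.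
Qed.

Lemma count_argE (N : nat) (a : R) (z : N.-tuple (plane R)) : 0 <= a <= pi ->
  count_arg (- a) a z = \sum_(p < N) \1_(sector a) (tnth z p).
Proof.
move=> api; rewrite /count_arg -sum1_card natr_sum big_mkcond/=.
apply: eq_bigr => p _; rewrite indic_sector -sector_argE// !inE.
by case: (_ <= _ <= _).
Qed.

Lemma measurable_count (N : nat) (a : R) :
  measurable_fun setT (fun z : N.-tuple (plane R) => \sum_(p < N) \1_(sector a) (tnth z p) : R).
Proof.
apply: measurable_sum => p; apply: (measurableT_comp _ (measurable_tnth p)).
by apply: measurable_indic; exact: measurable_sector.
Qed.

Variable N : nat.
Hypothesis N0 : (0 < N)%N.
Let Z : R := (\prod_(j < N) @monom_norm2 R N j) * N`!%:R.

Let Z0 : 0 < Z.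
Proof.
rewrite mulr_gt0 ?ltr0n ?fact_gt0//; apply: prodr_gt0 => j _.
exact: monom_norm2_gt0.
Qed.

Lemma vandermonde2_Re (z : N.-tuple (plane R)) : vandermonde2 z =
  \prod_(j < N) @monom_norm2 R N j *
    complex.Re (slater (@ginibre_phi R N) z * conjc (slater (@ginibre_phi R N) z)).
Proof.
have /(congr1 (@complex.Re R)) /= -> := vandermonde2_slater N0 z.
by rewrite ReM/= mul0r subr0.
Qed.

Lemma slater_linear_Re (u : N.-tuple (plane R) -> R) (y : R) :
  let D2 t := slater (@ginibre_phi R N) t * conjc (slater (@ginibre_phi R N) t) in
  cintegrable (mpower (muN R N) N) (fun t => D2 t * ((u t)%:C)%C) ->
  cint (mpower (muN R N) N) (fun t => D2 t * ((u t)%:C)%C) = ((N`!%:R * y)%:C)%C ->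
  (mpower (muN R N) N).-integrable setT (EFin \o (fun t => vandermonde2 t * u t)) /\
  \int[mpower (muN R N) N]_t (vandermonde2 t * u t) = Z * y.
Proof.
move=> D2 [iR _] /(congr1 (@complex.Re R)) /= E.
have ReE t : complex.Re (D2 t * ((u t)%:C)%C) = complex.Re (D2 t) * u t.
  by rewrite ReM/= mulr0 subr0.
have VE : (fun t => vandermonde2 t * u t) = fun t =>
    \prod_(j < N) @monom_norm2 R N j * complex.Re (D2 t * ((u t)%:C)%C).
  by apply/funext => t; rewrite vandermonde2_Re ReE mulrA.
rewrite VE; split; first exact: integrable_mulc.
by rewrite RintegralZl// E /Z mulrA.
Qed.

Section sector_half_angle.
Variable a : R.
Hypothesis api : 0 <= a <= pi.
Let X (z : N.-tuple (plane R)) : R := \sum_(p < N) \1_(sector a) (tnth z p).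
Let K := @ginibre_gram R N a.

Let phi_int i j := (@ginibre_phi_orth R N N0 i j).1.
Let phi_orth i j := (@ginibre_phi_orth R N N0 i j).2.
Let f (z : plane R) : R[i] := ((\1_(sector a) z : R)%:C)%C.
Let f_idem z : f z * f z = f z.
Proof. by rewrite /f -realcM indicE; case: (_ \in _); rewrite ?mulr1 ?mulr0. Qed.
Let f_int i j := (ginibre_sector_int N0 api i j).1.
Let f_cint i j := (ginibre_sector_int N0 api i j).2.

Lemma realc_sum (I : Type) (s : seq I) (P : pred I) (F : I -> R) :
  ((\sum_(i <- s | P i) F i)%:C)%C = \sum_(i <- s | P i) ((F i)%:C)%C.
Proof. exact: raddf_sum. Qed.

Lemma realcD (x y : R) : ((x + y)%:C = x%:C + y%:C)%C.
Proof. exact: rmorphD. Qed.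

Lemma realcB (x y : R) : ((x - y)%:C = x%:C - y%:C)%C.
Proof. exact: rmorphB. Qed.

Let XE z : ((X z)%:C)%C = \sum_(p < N) f (tnth z p).
Proof. by rewrite realc_sum. Qed.

Lemma ginibre_mass :
  (mpower (muN R N) N).-integrable setT (EFin \o (fun t => vandermonde2 t * 1)) /\
  \int[mpower (muN R N) N]_t (vandermonde2 t * 1) = Z * 1.
Proof.
have [i1 e1] := slater_norm phi_int phi_orth.
apply: slater_linear_Re; first by under eq_fun do rewrite mulr1.
under eq_fun do rewrite mulr1.
by rewrite e1 mulr1 rmorph_nat.
Qed.

Lemma ginibre_first :
  (mpower (muN R N) N).-integrable setT (EFin \o (fun t => vandermonde2 t * X t)) /\
  \int[mpower (muN R N) N]_t (vandermonde2 t * X t) = Z * \sum_(i < N) K i i.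
Proof.
have [i1 e1] := slater_mean phi_int phi_orth f_int.
apply: slater_linear_Re; first by under eq_fun do rewrite XE.
under eq_fun do rewrite XE.
rewrite e1 realcM rmorph_nat realc_sum; congr (_ * _).
by apply: eq_bigr => i _; rewrite f_cint.
Qed.

Lemma ginibre_second :
  (mpower (muN R N) N).-integrable setT (EFin \o (fun t => vandermonde2 t * X t ^+ 2)) /\
  \int[mpower (muN R N) N]_t (vandermonde2 t * X t ^+ 2) =
    Z * (\sum_(i < N) K i i + \sum_(i < N) \sum_(j < N) (K i i * K j j - K i j * K j i)).
Proof.
have [i1 e1] := slater_second_moment phi_int phi_orth f_idem f_int.
have X2 z : ((X z ^+ 2)%:C)%C = (\sum_(p < N) f (tnth z p)) ^+ 2.
  by rewrite -XE rmorphXn.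
apply: slater_linear_Re; first by under eq_fun do rewrite X2.
under eq_fun do rewrite X2.
rewrite e1 realcM rmorph_nat; congr (_ * _).
rewrite realcD !realc_sum; congr (_ + _).
  by apply: eq_bigr => i _; rewrite f_cint.
apply: eq_bigr => i _; rewrite realc_sum; apply: eq_bigr => j _.
by rewrite realcB (realcM (K i i)) (realcM (K i j)) !f_cint.
Qed.

(** The partition function is Z, so that normalizing is a division by Z. *)
Lemma ginibre_expectation (g : N.-tuple (plane R) -> R) : measurable_fun setT g ->
  (forall z, 0 <= g z) ->
  (\int[ginibre R N]_z (g z)%:E =
   (Z^-1)%:E * \int[mpower (muN R N) N]_z (vandermonde2 z * g z)%:E)%E.
Proof.
move=> mg g0.
have wT : ginibre_weight R N setT = Z%:E.
  have [i1 e1] := ginibre_mass.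
  rewrite /ginibre_weight/= /mdensity -[Z]mulr1 -e1.
  rewrite /Rintegral fineK; last exact: integrable_fin_num i1.
  by apply: eq_integral => z _; rewrite mulr1.
have Zi0 : 0 <= Z^-1 by rewrite invr_ge0 ltW.
rewrite (eq_measure_integral (mscale (NngNum Zi0) (ginibre_weight R N))); last first.
  move=> A mA _; rewrite /ginibre/= /mnormalize wT eqe gt_eqF//=.
  by rewrite /mscale/= muleC.
have mgE : measurable_fun setT (fun z => (g z)%:E) by exact/measurable_EFinP.
rewrite ge0_integral_mscale//; last by move=> z _; rewrite lee_fin.
congr (_ * _)%E; rewrite /ginibre_weight ge0_integral_mdensity//.
by apply: eq_integral => z _; rewrite -EFinM mulrC.
Qed.

(** The square of the mean cancels (tr K)^2 in the second moment, which leaves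
tr K - tr K^2. *)
Lemma var_count :
  fine 'V_(ginibre R N)[X] = \sum_(i < N) K i i - \sum_(i < N) \sum_(j < N) K i j * K j i.
Proof.
have [i0 e0] := ginibre_mass; have [i1 e1] := ginibre_first; have [i2 e2] := ginibre_second.
have mX : measurable_fun setT X := @measurable_count N a.
have X0 z : 0 <= X z by apply: sumr_ge0 => p _; rewrite indicE.
set m1 := \sum_(i < N) K i i in e1 e2 *.
have EX : fine 'E_(ginibre R N)[X] = m1.
  rewrite unlock ginibre_expectation// -[X in (_ * X)%E]fineK; last exact: integrable_fin_num i1.
  by rewrite (_ : fine (integral _ _ _) = Z * m1)// -EFinM/= mulKf// gt_eqF.
rewrite /variance unlock EX unlock.
have q0 z : 0 <= (X z - m1) ^+ 2 by exact: sqr_ge0.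
have mq : measurable_fun setT (fun z => (X z - m1) ^+ 2).
  by apply: measurable_funX; apply: measurable_funB => //; exact: measurable_cst.
have -> : (\int[ginibre R N]_z (((X \- cst m1) * (X \- cst m1))%R z)%:E =
    \int[ginibre R N]_z ((X z - m1) ^+ 2)%:E)%E by [].
rewrite ginibre_expectation//.
have qE z : vandermonde2 z * (X z - m1) ^+ 2 =
    vandermonde2 z * X z ^+ 2 + (- (2 * m1) * (vandermonde2 z * X z) +
      m1 ^+ 2 * (vandermonde2 z * 1)).
  by ring.
have iq : (mpower (muN R N) N).-integrable setT (EFin \o (fun z =>
    - (2 * m1) * (vandermonde2 z * X z) + m1 ^+ 2 * (vandermonde2 z * 1))).
  rewrite /comp; under eq_fun do rewrite EFinD.
  by apply: integrableD => //; exact: integrable_mulc.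
have iqq : (mpower (muN R N) N).-integrable setT (EFin \o (fun z => vandermonde2 z * (X z - m1) ^+ 2)).
  rewrite /comp; under eq_fun do rewrite qE EFinD.
  exact: integrableD.
rewrite -[X in (_ * X)%E]fineK; last exact: integrable_fin_num iqq.
rewrite -EFinM/= -[fine (integral _ _ _)]/(Rintegral _ _ (fun z => vandermonde2 z * (X z - m1) ^+ 2)).
under eq_Rintegral do rewrite qE.
rewrite RintegralD// RintegralD//; [|exact: integrable_mulc..].
rewrite !RintegralZl// e0 e1 e2.
have -> : \sum_(i < N) \sum_(j < N) (K i i * K j j - K i j * K j i) =
    m1 ^+ 2 - \sum_(i < N) \sum_(j < N) K i j * K j i.
  rewrite expr2 big_distrlr/= -sumrB; apply: eq_bigr => i _; rewrite -sumrB.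
  by apply: eq_bigr => j _.
by field; rewrite gt_eqF.
Qed.
End sector_half_angle.

Lemma var_sectorE (alpha : R) : 0 <= alpha <= 2 * pi ->
  var_sector N alpha = N%:R * (alpha / (2 * pi)) -
    \sum_(i < N) \sum_(j < N) gmom N%:R (i + j).+1 ^+ 2 *
       (sector_angle (alpha / 2) (i%:R - j%:R) 0) ^+ 2 /
    (monom_norm2 N i * monom_norm2 N j).
Proof.
move=> /andP[a0 a2].
have api : 0 <= alpha / 2 <= pi by rewrite divr_ge0//= ler_pdivrMr// mulrC.
rewrite /var_sector.
have -> : @count_arg R (- (alpha / 2)) (alpha / 2) N =
    fun z => \sum_(p < N) \1_(sector (alpha / 2)) (tnth z p).
  by apply/funext => z; exact: count_argE.
rewrite var_count//; congr (_ - _).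
  under eq_bigr do rewrite ginibre_gram_diag//.
  rewrite sumr_const card_ord -[LHS]mulr_natl; congr (_ * _).
  by rewrite -mulrA -invfM.
by apply: eq_bigr => i _; apply: eq_bigr => j _; rewrite ginibre_gram_mulC.
Qed.
End ginibre_variance.

(** * Wallis integrals and overlaps of monomials *)

Section wallis.
Context {R : realType}.
Local Notation mu := (@lebesgue_measure R).

Definition wallis (n : nat) : R := \int[mu]_(t in `[0, (pi / 2)]) cos t ^+ n.

Lemma continuous_cosX n : continuous (fun t : R => cos t ^+ n).
Proof.
move=> t; apply: (@continuous_comp _ _ _ cos (fun x => x ^+ n)); first exact: continuous_cos.
exact: exprn_continuous.
Qed.

Lemma pihalf_ge0 : 0 <= pi / 2 :> R. Proof. by rewrite divr_ge0// pi_ge0. Qed.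

Lemma cos_pihalf_itv (t : R) : 0 <= t <= pi / 2 -> 0 <= cos t <= 1.
Proof.
move=> /andP[t0 t2]; rewrite cos_le1 andbT cos_ge0_pihalf// t2 andbT.
by rewrite (le_trans _ t0)// oppr_le0 pihalf_ge0.
Qed.

Lemma wallis0 : wallis 0 = pi / 2.
Proof.
rewrite /wallis (@Rintegral_is_derive _ id (fun t => cos t ^+ 0)) ?pihalf_ge0 ?subr0//.
exact: continuous_cosX.
Qed.

Lemma wallis1 : wallis 1 = 1.
Proof.
rewrite /wallis (@Rintegral_is_derive _ sin (fun t => cos t ^+ 1)) ?pihalf_ge0//.
- by rewrite sin_pihalf sin0 subr0.
- exact: continuous_cosX.
Qed.

(** Integration by parts: the derivative of cos^(n+1) sin integrates to 0. *)
Lemma wallisSS n : n.+2%:R * wallis n.+2 = n.+1%:R * wallis n.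
Proof.
have d x : is_derive x (1 : R) (fun t : R => cos t ^+ n.+1 * sin t)
    (n.+2%:R * cos x ^+ n.+2 - n.+1%:R * cos x ^+ n).
  have d1 : is_derive x (1 : R) (fun t : R => cos t ^+ n.+1) (n.+1%:R * cos x ^+ n * - sin x).
    exact: (@is_derive1_comp R (fun u => u ^+ n.+1) cos x _ _ (is_derive_expn n (cos x)) (is_derive_cos x)).
  apply: (is_derive_eq (is_deriveM d1 (is_derive_sin x))).
  rewrite /GRing.scale/= -[n.+2%:R]natr1.
  have sE : sin x * sin x = 1 - cos x ^+ 2 by rewrite -expr2 -(cos2Dsin2 x); ring.
  transitivity (cos x ^+ n.+2 - n.+1%:R * cos x ^+ n * (sin x * sin x)).
    by rewrite [cos x ^+ n.+2]exprS [cos x ^+ n.+1]exprS; ring.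
  by rewrite sE [cos x ^+ n.+2]exprS [cos x ^+ n.+1]exprS; ring.
have cc : continuous (fun x => n.+2%:R * cos x ^+ n.+2 - n.+1%:R * cos x ^+ n : R).
  by move=> x; apply: cvgB; apply: cvgM; try exact: cvg_cst; exact: continuous_cosX.
have := Rintegral_is_derive d cc pihalf_ge0.
rewrite cos_pihalf sin0 expr0n/= mul0r mulr0 subrr.
have i m : mu.-integrable `[0, (pi / 2)] (EFin \o (fun t => cos t ^+ m : R)).
  by apply: continuous_integrable; exact: continuous_cosX.
have ic c m : mu.-integrable `[0, (pi / 2)] (EFin \o (fun t => c * cos t ^+ m : R)).
  apply: continuous_integrable => x; apply: cvgM; first exact: cvg_cst.
  exact: continuous_cosX.
rewrite RintegralB// !RintegralZl// => /eqP; rewrite subr_eq0 => /eqP; exact.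
Qed.

Lemma wallis_gt0 n : 0 < wallis n.
Proof.
suff : 0 < wallis n /\ 0 < wallis n.+1 by case.
elim: n => [|n [IH1 IH2]]; first by rewrite wallis0 wallis1 ltr01 divr_gt0// pi_gt0.
split=> //; have := wallisSS n; move/(canRL (mulKf _)) => ->; last by rewrite pnatr_eq0.
by rewrite !mulr_gt0// invr_gt0.
Qed.

Lemma wallis_nonincreasing n : wallis n.+1 <= wallis n.
Proof.
apply: le_Rintegral => //; try by apply: continuous_integrable; exact: continuous_cosX.
move=> t; rewrite /= in_itv/= => /cos_pihalf_itv/andP[c0 c1].
by rewrite exprS ler_piMl// exprn_ge0.
Qed.

(** By [wallisSS] this product does not depend on n; monotonicity then pins
W_n^2 between pi / (2 n + 2) and pi / (2 n). *)
Lemma wallisM n : n.+1%:R * wallis n * wallis n.+1 = pi / 2.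
Proof.
elim: n => [|n IH]; first by rewrite wallis0 wallis1 mul1r mulr1.
by rewrite -IH mulrAC wallisSS.
Qed.

Lemma wallis_sqr_le n : n%:R * wallis n ^+ 2 <= pi / 2.
Proof.
case: n => [|n]; first by rewrite mul0r pihalf_ge0.
rewrite -(wallisM n) expr2 mulrA ler_wpM2r ?(ltW (wallis_gt0 _))//.
by rewrite ler_wpM2l// wallis_nonincreasing.
Qed.

Lemma wallis_sqr_ge n : pi / 2 <= n.+1%:R * wallis n ^+ 2.
Proof.
rewrite -(wallisM n) expr2 -mulrA ler_wpM2l//.
by rewrite ler_wpM2l ?(ltW (wallis_gt0 _))// wallis_nonincreasing.
Qed.

(** Both sides obey the same two-step recursion in n.  The moment of order n + 1 is
a power of a times Gamma (n/2 + 1) / 2, so this is the duplication formula in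
disguise, with Wallis integrals in place of Gamma at half-integers. *)
Lemma gmom_wallis (a : R) n : 0 < a ->
  8 * a ^+ n.+2 * 2 ^+ n * wallis n * gmom a n.+1 ^+ 2 = pi * n`!%:R.
Proof.
move=> a0.
have base0 : 8 * a ^+ 2 * 2 ^+ 0 * wallis 0 * gmom a 1 ^+ 2 = pi * 0`!%:R.
  by rewrite wallis0 gmom1// fact0; field; rewrite gt_eqF.
have base1 : 8 * a ^+ 3 * 2 ^+ 1 * wallis 1 * gmom a 2 ^+ 2 = pi * 1`!%:R.
  rewrite wallis1 (gmomP 0 a0).2 gmom0// factS fact0.
  rewrite (_ : (1 / (2 * a) * (Num.sqrt pi / (2 * Num.sqrt a))) ^+ 2 =
    (Num.sqrt pi) ^+ 2 / (16 * a ^+ 2 * (Num.sqrt a) ^+ 2)); last first.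
    by field; rewrite ?gt_eqF ?sqrtr_gt0.
  by rewrite !sqr_sqrtr ?pi_ge0 ?(ltW a0)//; field; rewrite gt_eqF.
suff : 8 * a ^+ n.+2 * 2 ^+ n * wallis n * gmom a n.+1 ^+ 2 = pi * n`!%:R /\
  8 * a ^+ n.+3 * 2 ^+ n.+1 * wallis n.+1 * gmom a n.+2 ^+ 2 = pi * n.+1`!%:R by case.
elim: n => [//|n [IH1 IH2]]; split=> //.
rewrite !factS !natrM (gmomP n.+1 a0).2.
have -> : wallis n.+2 = n.+1%:R * wallis n / n.+2%:R.
  by rewrite -wallisSS mulrAC mulfV ?mul1r// pnatr_eq0.
have a_ne : a != 0 by rewrite gt_eqF.
have n_ne : n.+2%:R != 0 :> R by rewrite pnatr_eq0.
have -> : a ^+ n.+4 = a ^+ n.+2 * a ^+ 2 by rewrite -exprD addn2.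
have -> : (2 : R) ^+ n.+2 = 2 ^+ n * 4 by rewrite [_ ^+ n.+2]exprS [_ ^+ n.+1]exprS; ring.
transitivity (n.+2%:R * n.+1%:R * (8 * a ^+ n.+2 * 2 ^+ n * wallis n * gmom a n.+1 ^+ 2)).
  clear IH1 IH2 base0 base1; move: (a ^+ n.+2) (2 ^+ n) (wallis n) (gmom a n.+1) (n.+1%:R) (n.+2%:R) n_ne.
  by move=> y z w g p q q_ne; field; apply/andP; split.
by rewrite IH1; ring.
Qed.
End wallis.

Lemma integrable_gmom (R : realType) (a : R) m : 0 < a ->
  (@lebesgue_measure R).-integrable `[0, +oo[ (EFin \o (fun r => r ^+ m * gauss a r)).
Proof.
move=> a0; apply/integrableP; split.
  apply/measurable_EFinP; apply: measurable_funTS.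
  by apply: measurable_funM; [exact: measurable_funX|exact: measurable_gauss].
rewrite (_ : integral _ _ _ = gmoment a m); first by rewrite (gmomP m a0).1 ltry.
apply: eq_integral => r; rewrite mem_setE in_itv/= andbT => r0.
by rewrite /= ger0_norm// mulr_ge0 ?exprn_ge0// gauss_ge0.
Qed.

(** Cauchy-Schwarz, from the integral of r (s r^i - t r^j)^2 gauss a r with s and
t the moments that minimize it. *)
Lemma gmom_log_convex (R : realType) (a : R) (i j : nat) : 0 < a ->
  gmom a (i + j).+1 ^+ 2 <= gmom a (i + i).+1 * gmom a (j + j).+1.
Proof.
move=> a0; pose I : set R := `[0, +oo[%classic.
have mI : measurable I by exact: measurable_itv.
have ig m := integrable_gmom m a0.
set s := gmom a (i + j).+1; set t := gmom a (i + i).+1.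
have t0 : 0 < t by exact: gmom_gt0.
have igc c m : (@lebesgue_measure R).-integrable I (EFin \o (fun r => c * (r ^+ m * gauss a r))).
  exact: integrable_mulc.
have : 0 <= \int[lebesgue_measure]_(r in I) (r * (s * r ^+ i - t * r ^+ j) ^+ 2 * gauss a r).
  apply: Rintegral_ge0 => r; rewrite /I/= in_itv/= andbT => r0.
  by rewrite mulr_ge0 ?gauss_ge0// mulr_ge0// sqr_ge0.
have -> : \int[lebesgue_measure]_(r in I) (r * (s * r ^+ i - t * r ^+ j) ^+ 2 * gauss a r) =
    \int[lebesgue_measure]_(r in I) (s ^+ 2 * (r ^+ (i + i).+1 * gauss a r) +
      (- (2 * s * t) * (r ^+ (i + j).+1 * gauss a r) + t ^+ 2 * (r ^+ (j + j).+1 * gauss a r))).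
  apply: eq_Rintegral => r _; rewrite !exprS !exprD.
  by move: (r ^+ i) (r ^+ j) => x y; ring.
rewrite RintegralD//; last first.
  exact: integrable_addf.
rewrite RintegralD// !RintegralZl//.
rewrite -![\int[_]_(_ in _) _]/(gmom a _) -/s -/t => h.
rewrite -subr_ge0 -(pmulr_rge0 _ t0).
by apply: le_trans h _; rewrite le_eqVlt; apply/orP; left; apply/eqP; ring.
Qed.

Section overlap.
Context {R : realType}.

(** The squared correlation of r^i and r^j for the weight r exp (- r^2) dr; in
terms of Gamma it is Gamma ((i + j) / 2 + 1)^2 / (i! j!).  The form chosen here
shows that it is binomial along antidiagonals. *)
Definition overlap (i j : nat) : R :=
  pi * 'C(i + j, i)%:R / (2 ^+ (i + j).+1 * wallis (i + j)).

Lemma overlap_gmom (N i j : nat) : (0 < N)%N ->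
  gmom N%:R (i + j).+1 ^+ 2 = overlap i j * (gmom N%:R (i + i).+1 * gmom N%:R (j + j).+1).
Proof.
move=> N0; have NR : 0 < N%:R :> R by rewrite ltr0n.
have := gmom_wallis (i + j) NR; rewrite !addnn !gmom_odd// /overlap.
have W0 := wallis_gt0 (R := R) (i + j).
rewrite -(bin_fact (leq_addr j i)) addKn !natrM => h.
have xne : 8 * N%:R ^+ (i + j).+2 * 2 ^+ (i + j) * wallis (i + j) != 0 :> R.
  have p1 : 0 < N%:R ^+ (i + j).+2 :> R by exact: exprn_gt0.
  have p2 : 0 < 2 ^+ (i + j) :> R by exact: exprn_gt0.
  by apply: lt0r_neq0; do 3 (apply: mulr_gt0 => //).
apply: (mulfI xne); rewrite h (_ : (i + j).+2 = i.+1 + j.+1)%N; last by rewrite addSn addnS.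
rewrite exprD [2 ^+ _.+1]exprS.
have y1 : N%:R ^+ i.+1 != 0 :> R by rewrite expf_neq0// gt_eqF.
have y2 : N%:R ^+ j.+1 != 0 :> R by rewrite expf_neq0// gt_eqF.
have y3 : (2 : R) ^+ (i + j) != 0 by rewrite expf_neq0// pnatr_eq0.
have y4 : wallis (i + j) != 0 :> R by rewrite gt_eqF.
clear h xne; move: (N%:R ^+ i.+1) (N%:R ^+ j.+1) (2 ^+ (i + j)) (wallis (i + j)) y1 y2 y3 y4.
by move=> u v x w u0 v0 x0 w0; field; do ?[apply/andP; split].
Qed.

Lemma overlap_ge0 i j : 0 <= overlap i j.
Proof.
by rewrite /overlap divr_ge0 ?mulr_ge0 ?pi_ge0 ?exprn_ge0// ltW// wallis_gt0.
Qed.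

Lemma overlap_le1 i j : overlap i j <= 1.
Proof.
have := gmom_log_convex i j (@ltr01 R); rewrite (@overlap_gmom 1)//.
by rewrite ger_pMl// mulr_gt0// gmom_gt0.
Qed.

Lemma overlap_diag i : overlap i i = 1.
Proof.
have := @overlap_gmom 1 i i erefl; rewrite expr2 -[LHS]mul1r => /mulIf -> //.
by rewrite mulf_neq0// gt_eqF// gmom_gt0.
Qed.

Lemma overlapC i j : overlap i j = overlap j i.
Proof. by rewrite /overlap addnC -bin_sub ?leq_addl// addnK. Qed.

(** The squared modulus of the Fourier coefficient of frequency d of the
indicator of an arc of length alpha. *)
Definition arc_coef2 (alpha d : R) : R :=
  if d == 0 then (alpha / (2 * pi)) ^+ 2 else (sin (d * (alpha / 2)) / (pi * d)) ^+ 2.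

Lemma var_sector_overlap N (alpha : R) : (0 < N)%N -> 0 <= alpha <= 2 * pi ->
  var_sector N alpha = N%:R * (alpha / (2 * pi)) -
    \sum_(i < N) \sum_(j < N) overlap i j * arc_coef2 alpha (i%:R - j%:R).
Proof.
move=> N0 a2; rewrite var_sectorE//; congr (_ - _).
apply: eq_bigr => i _; apply: eq_bigr => j _.
rewrite overlap_gmom// /monom_norm2 /arc_coef2 /sector_angle.
have p0 : pi != 0 :> R by rewrite gt_eqF// pi_gt0.
have g1 : gmom N%:R (i + i).+1 != 0 :> R by rewrite gt_eqF// gmom_gt0// ltr0n.
have g2 : gmom N%:R (j + j).+1 != 0 :> R by rewrite gt_eqF// gmom_gt0// ltr0n.
move: g1 g2 p0; move: (gmom _ _) (gmom _ _) (pi : R) => x y p x0 y0 p0.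
case: ifPn => d0; first by rewrite cos0; field; do ?[apply/andP; split].
rewrite addr0 subr0; move: (sin _) => s; move: (i%:R - j%:R) d0 => d d0.
by field; do ?[apply/andP; split].
Qed.

Lemma arc_coef2_ge0 alpha d : 0 <= arc_coef2 alpha d.
Proof. by rewrite /arc_coef2; case: ifP => _; exact: sqr_ge0. Qed.

Lemma sin_natpi_sub n (x : R) : sin (n%:R * pi - x) ^+ 2 = sin x ^+ 2.
Proof.
elim: n => [|n IH]; first by rewrite mul0r sub0r sinN sqrrN.
by rewrite -natr1 mulrDl mul1r addrAC sinDpi sqrrN.
Qed.

(** Up to a rotation the two arcs are complementary, and complementary arcs have
opposite Fourier coefficients at nonzero frequencies. *)
Lemma arc_coef2_sym alpha (i j : nat) : i != j ->
  arc_coef2 (2 * pi - alpha) (i%:R - j%:R) = arc_coef2 alpha (i%:R - j%:R).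
Proof.
move=> ij; rewrite /arc_coef2 subr_eq0 eqr_nat (negbTE ij) !exprMn; congr (_ * _).
rewrite (_ : (i%:R - j%:R) * ((2 * pi - alpha) / 2) =
  i%:R * pi - (j%:R * pi - (j%:R * (alpha / 2) - i%:R * (alpha / 2)))); last by field.
rewrite !sin_natpi_sub -[LHS]sqrrN -sinN; congr (sin _ ^+ 2); ring.
Qed.

(** A sector and its complement have the same variance; here the equality is read
off from the Fourier coefficients. *)
Lemma var_sector_sym N (alpha : R) : (0 < N)%N -> 0 <= alpha <= 2 * pi ->
  var_sector N (2 * pi - alpha) = var_sector N alpha.
Proof.
move=> N0 /andP[a0 a2]; rewrite !var_sector_overlap//; last 2 first.
- by rewrite a0 a2.
- by rewrite subr_ge0 a2 gerBl.
have split_diag b : N%:R * (b / (2 * pi)) -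
    \sum_(i < N) \sum_(j < N) overlap i j * arc_coef2 b (i%:R - j%:R) =
  N%:R * (b / (2 * pi) - (b / (2 * pi)) ^+ 2) -
    \sum_(i < N) \sum_(j < N | j != i) overlap i j * arc_coef2 b (i%:R - j%:R).
  rewrite mulrBr -addrA; congr (_ + _); rewrite -opprD; congr (- _).
  have -> : N%:R * (b / (2 * pi)) ^+ 2 = \sum_(i < N) (b / (2 * pi)) ^+ 2.
    by rewrite sumr_const card_ord mulr_natl.
  rewrite -big_split/=.
  apply: eq_bigr => i _; rewrite (bigD1 i)//= overlap_diag mul1r; congr (_ + _).
  by rewrite /arc_coef2 subrr eqxx.
rewrite !split_diag; congr (_ * _ - _).
  have p0 : pi != 0 :> R by rewrite gt_eqF// pi_gt0.
  by move: (pi : R) p0 => p p0; field; do ?[apply/andP; split].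
apply: eq_bigr => i _; apply: eq_bigr => j ji.
by rewrite arc_coef2_sym// eq_sym.
Qed.

End overlap.

(** * From the square to the antidiagonals *)

Section triangle.
Context {R : realType}.

Lemma sum_triangle (F : nat -> nat -> R) M :
  \sum_(n < M) \sum_(i < n.+1) F i (n - i)%N = \sum_(i < M) \sum_(j < M | (i + j < M)%N) F i j.
Proof.
have -> : \sum_(i < M) \sum_(j < M | (i + j < M)%N) F i j = \sum_(i < M) \sum_(j < M - i) F i j.
  apply: eq_bigr => i _; rewrite (big_ord_widen M (F i)) ?leq_subr//.
  by apply: eq_bigl => j; rewrite ltn_subRL.
elim: M => [|M IH]; first by rewrite !big_ord0.
rewrite big_ord_recr/= IH [in RHS]big_ord_recr/= [X in _ + X = _]big_ord_recr/=.
rewrite subSnn big_ord1 subnn addrA; congr (_ + _); rewrite -big_split/=.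
by apply: eq_bigr => i _; rewrite subSn ?big_ord_recr//= ltnW.
Qed.

(** The triangle i + j < 2 N consists of the square i, j < N and two congruent
triangles.  In row i < N of such a triangle there are N - i entries, all at
distance at least N - i from the diagonal, hence contributing at most
c / (N - i). *)
Lemma square_triangle (F : nat -> nat -> R) (c : R) N :
  (forall i j, F i j = F j i) ->
  (forall i j : nat, (i < j)%N -> `|F i j| <= c / (j%:R - i%:R) ^+ 2) -> 0 <= c ->
  `|\sum_(i < N) \sum_(j < N) F i j - \sum_(n < N + N) \sum_(i < n.+1) F i (n - i)%N|
    <= 2 * c * \sum_(k < N) (k.+1%:R)^-1.
Proof.
move=> Fsym Fc c0; rewrite sum_triangle; set g := fun i j : nat => if (i + j < N + N)%N then F i j else 0.
have -> : \sum_(i < N + N) \sum_(j < N + N | (i + j < N + N)%N) F i j =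
    \sum_(i < N + N) \sum_(j < N + N) g i j.
  by apply: eq_bigr => i _; rewrite big_mkcond.
have gsym i j : g i j = g j i by rewrite /g addnC Fsym.
have -> : \sum_(i < N + N) \sum_(j < N + N) g i j =
    (\sum_(i < N) \sum_(j < N) g i j + \sum_(i < N) \sum_(j < N) g i (N + j)%N) +
    (\sum_(i < N) \sum_(j < N) g (N + i)%N j + \sum_(i < N) \sum_(j < N) g (N + i)%N (N + j)%N).
  by rewrite big_split_ord/=; congr (_ + _); rewrite -big_split; apply: eq_bigr => i _; rewrite big_split_ord.
have -> : \sum_(i < N) \sum_(j < N) g i j = \sum_(i < N) \sum_(j < N) F i j.
  apply: eq_bigr => i _; apply: eq_bigr => j _; rewrite /g ifT//.
  by rewrite -addSn leq_add// ltnW.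
have -> : \sum_(i < N) \sum_(j < N) g (N + i)%N (N + j)%N = 0.
  apply: big1 => i _; apply: big1 => j _; rewrite /g ifF// ltnNge.
  by rewrite leq_add ?leq_addr.
have -> : \sum_(i < N) \sum_(j < N) g (N + i)%N j = \sum_(i < N) \sum_(j < N) g i (N + j)%N.
  by rewrite exchange_big/=; apply: eq_bigr => i _; apply: eq_bigr => j _.
set S := \sum_(i < N) \sum_(j < N) F i j; set C := \sum_(i < N) \sum_(j < N) g i (N + j)%N.
rewrite (_ : S - _ = - (2 * C)); last by ring.
rewrite normrN normrM ger0_norm// -mulrA ler_wpM2l//.
have -> : \sum_(k < N) (k.+1%:R)^-1 = \sum_(i < N) ((N - i)%:R)^-1 :> R.
  by rewrite (reindex_inj rev_ord_inj)/=; apply: eq_bigr => i _; rewrite subnSK.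
rewrite mulr_sumr; apply: le_trans (ler_norm_sum _ _ _) _; apply: ler_sum => i _.
apply: le_trans (ler_norm_sum _ _ _) _.
have Ni : (0 < N - i)%N by rewrite subn_gt0.
have NiR : 0 < (N - i)%:R :> R by rewrite ltr0n.
apply: (@le_trans _ _ (\sum_(j < N | (j < N - i)%N) c / (N - i)%:R ^+ 2)).
  rewrite [leRHS]big_mkcond/=; apply: ler_sum => j _; rewrite /g addnCA ltn_add2l ltn_subRL.
  case: ifP => ij; last by rewrite normr0.
  apply: le_trans (Fc _ _ _) _; first by rewrite (leq_trans (ltn_ord i))// leq_addr.
  rewrite ler_wpM2l// lef_pV2 ?posrE ?exprn_gt0//; last first.
    by rewrite subr_gt0 ltr_nat (leq_trans (ltn_ord i))// leq_addr.
  rewrite natrB; last exact: ltnW.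
  rewrite lerXn2r ?nnegrE ?subr_ge0 ?ler_nat//; last by rewrite lerB// ler_nat leq_addr.
  - exact: ltnW.
  - by rewrite (leq_trans (ltnW (ltn_ord i)))// leq_addr.
rewrite -(big_ord_widen N (fun=> c / (N - i)%:R ^+ 2)) ?leq_subr//.
rewrite sumr_const card_ord -[leLHS]mulr_natr le_eqVlt; apply/orP; left; apply/eqP.
by field; rewrite gt_eqF.
Qed.

(** The real part of the binomial formula for (exp (- i t) + exp (i t))^n. *)
Lemma sum_bin_cos n (t : R) :
  \sum_(i < n.+1) 'C(n, i)%:R * cos ((i%:R - (n - i)%:R) * t) = 2 ^+ n * cos t ^+ n.
Proof.
have h : (cis (- t) + cis t) ^+ n = ((2 ^+ n * cos t ^+ n)%:C)%C.
  rewrite -exprMn -[RHS]/((real_complex R) _) rmorphXn/=; congr (_ ^+ n).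
  apply/eqP; rewrite eq_complex/= cosN sinN addNr eqxx andbT.
  by apply/eqP; ring.
have /(congr1 (@complex.Re R)) /= <- := h.
rewrite exprDn; have ReS (I : finType) (F : I -> R[i]) : complex.Re (\sum_i F i) = \sum_i complex.Re (F i).
  by apply: (big_morph _ (@ReD R)).
rewrite ReS; apply: eq_bigr => i _.
have ReMn (z : R[i]) k : complex.Re (z *+ k) = k%:R * complex.Re z.
  by rewrite mulr_natl; elim: k => [|k IH]; rewrite ?mulr0n// !mulrS ReD IH.
rewrite !cisX -cisD ReMn/=; congr (_ * cos _); ring.
Qed.

Lemma sum_overlap_cos n (t : R) :
  \sum_(i < n.+1) overlap i (n - i) * cos ((i%:R - (n - i)%:R) * t) =
  pi / (2 * wallis n) * cos t ^+ n.
Proof.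
have W0 : wallis n != 0 :> R by rewrite gt_eqF// wallis_gt0.
have p2 : (2 : R) ^+ n != 0 by rewrite expf_neq0// pnatr_eq0.
have -> : pi / (2 * wallis n) * cos t ^+ n = (pi / (2 ^+ n.+1 * wallis n)) * (2 ^+ n * cos t ^+ n).
  rewrite exprS; move: (2 ^+ n) (wallis n) p2 W0 => x w x0 w0; field; do ?[apply/andP; split] => //.
rewrite -sum_bin_cos mulr_sumr; apply: eq_bigr => i _.
rewrite /overlap subnKC; last by rewrite -ltnS.
by rewrite mulrA; congr (_ * _); rewrite mulrAC.
Qed.
End triangle.

(** * The antidiagonals as integrals of truncated cosine powers *)

Section interval_integrals.
Context {R : realType}.
Local Notation mu := (@lebesgue_measure R).

Lemma Rintegral_split (f : R -> R) (a b c : R) : mu.-integrable `[a, c] (EFin \o f) ->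
  a <= b -> b <= c ->
  \int[mu]_(t in `[a, c]) f t = \int[mu]_(t in `[a, b]) f t + \int[mu]_(t in `[b, c]) f t.
Proof.
move=> cf ab bc; apply/eqP; rewrite addrC -subr_eq; apply/eqP.
rewrite Rintegral_itvB; [|exact: cf|by rewrite bnd_simp|by rewrite bnd_simp].
rewrite Rintegral_itv_obnd_cbnd//.
apply: (integrableS _ _ _ cf) => //.
by apply: subset_itvr; rewrite bnd_simp.
Qed.

Lemma Rintegral_reflect (f : R -> R) (a b c : R) : continuous f -> a <= b ->
  \int[mu]_(t in `[c - b, c - a]) f t = \int[mu]_(t in `[a, b]) f (c - t).
Proof.
move=> cf ab; rewrite /Rintegral; congr fine.
pose F (x : R) := c - x.
have dF (x : R) : is_derive x (1 : R) F (- 1).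
  have := is_deriveB (is_derive_cst c x (1 : R)) (is_derive_id x (1 : R)).
  by rewrite sub0r.
have dF1 : F^`()%classic = fun=> - 1 by apply/funext => x; rewrite derive1E; apply: derive_val.
rewrite -[c - b]/(F b) -[c - a]/(F a).
have cF : continuous F by exact: is_derive_continuous dF.
rewrite (@integration_by_substitution_decreasing R F f a b ab) ?dF1.
- by apply: eq_integral => x _; rewrite /= opprK mulr1.
- by move=> x y _ _ xy; rewrite /F ltrD2l ltrN2.
- by move=> x _; exact: cvg_cst.
- exact: is_cvg_cst.
- exact: is_cvg_cst.
- split; first by move=> x _; exact: ex_derive.
  + by apply: cvg_at_right_filter; exact: cF.
  + by apply: cvg_at_left_filter; exact: cF.
- exact: continuous_subspaceT.
Qed.

Lemma continuous_bigsum (F : nat -> R -> R) n :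
  (forall i, continuous (F i)) -> continuous (fun t => \sum_(i < n) F i t).
Proof.
move=> cF; elim: n => [|n IH].
  by rewrite (_ : (fun _ => _) = fun=> 0); [exact: cst_continuous|apply/funext => t; rewrite big_ord0].
rewrite (_ : (fun _ => _) = (fun t => \sum_(i < n) F i t) \+ F n).
  by move=> x; apply: cvgD; [exact: IH|exact: cF].
by apply/funext => t; rewrite big_ord_recr.
Qed.

Lemma Rintegral_bigsum (F : nat -> R -> R) n (a b : R) :
  (forall i, continuous (F i)) ->
  \int[mu]_(t in `[a, b]) (\sum_(i < n) F i t) = \sum_(i < n) \int[mu]_(t in `[a, b]) F i t.
Proof.
move=> cF; elim: n => [|n IH].
  rewrite big_ord0; under eq_Rintegral do rewrite big_ord0.
  by rewrite /Rintegral integral0.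
rewrite big_ord_recr/= -IH -RintegralD//.
- by apply: eq_Rintegral => t _; rewrite big_ord_recr.
- by apply: continuous_integrable; exact: continuous_bigsum.
- by apply: continuous_integrable.
Qed.

Lemma continuous_minr (a : R) : continuous (fun t : R => Num.min a t).
Proof.
move=> x; apply: (@continuous_min R R^o (fun=> a) id x); first exact: cvg_cst.
exact: cvg_id.
Qed.

Lemma continuous_cosM (d : R) : continuous (fun t : R => cos (d * t)).
Proof.
move=> x; apply: (@continuous_comp _ _ _ (fun t => d * t) cos); last exact: continuous_cos.
by apply: cvgM; [exact: cvg_cst|exact: cvg_id].
Qed.

Lemma continuous_mulf (f g : R -> R) : continuous f -> continuous g -> continuous (fun t => f t * g t).
Proof. by move=> cf cg x; apply: cvgM; [exact: cf|exact: cg]. Qed.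

Lemma Rintegral_min_split (f : R -> R) (a c : R) : continuous f -> 0 <= a <= c ->
  \int[mu]_(t in `[0, c]) (Num.min a t * f t) =
  \int[mu]_(t in `[0, a]) (t * f t) + a * \int[mu]_(t in `[a, c]) f t.
Proof.
move=> cf /andP[a0 ac].
rewrite (@Rintegral_split _ 0 a c)//; last first.
  by apply: continuous_integrable; apply: continuous_mulf => //; exact: continuous_minr.
rewrite -RintegralZl//; last by apply: continuous_integrable.
by congr (_ + _); apply: eq_Rintegral => t; rewrite mem_setE in_itv/= => /andP[t1 t2];
  [rewrite (min_idPr t2)|rewrite (min_idPl t1)].
Qed.
End interval_integrals.

Section truncated_cosine.
Context {R : realType}.
Local Notation mu := (@lebesgue_measure R).

Lemma is_derive_cosM (d x : R) : is_derive x (1 : R) (fun t => cos (d * t)) (- d * sin (d * x)).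
Proof.
have dd : is_derive x (1 : R) (fun t : R => d * t) d.
  by have := is_derive_scale d (is_derive_id x (1 : R)); rewrite mulr1.
have := @is_derive1_comp R cos (fun t => d * t) x _ _ (is_derive_cos (d * x)) dd.
by move/is_derive_eq; apply; ring.
Qed.

Lemma is_derive_sinM (d x : R) : is_derive x (1 : R) (fun t => sin (d * t)) (d * cos (d * x)).
Proof.
have dd : is_derive x (1 : R) (fun t : R => d * t) d.
  by have := is_derive_scale d (is_derive_id x (1 : R)); rewrite mulr1.
have := @is_derive1_comp R sin (fun t => d * t) x _ _ (is_derive_sin (d * x)) dd.
by move/is_derive_eq; apply; ring.
Qed.

(** Integration by parts on [0, a], where min a t = t; the boundary term at pi
vanishes because d is an integer in the applications. *)
Lemma Rintegral_min_cos (a d : R) : 0 <= a <= pi -> d != 0 -> sin (d * pi) = 0 ->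
  \int[mu]_(t in `[0, pi]) (Num.min a t * cos (d * t)) = - 2 * sin (d * (a / 2)) ^+ 2 / d ^+ 2.
Proof.
move=> api d0 sd; have /andP[a0 ap] := api.
rewrite (Rintegral_min_split _ api); last exact: continuous_cosM.
have dp x : is_derive x (1 : R) (fun t => d^-1 * (t * sin (d * t)) + d^-1 ^+ 2 * cos (d * t)) (x * cos (d * x)).
  have d1 := is_derive_scale d^-1 (is_deriveM (is_derive_id x (1 : R)) (is_derive_sinM d x)).
  have d2 := is_derive_scale (d^-1 ^+ 2) (is_derive_cosM d x).
  apply: (is_derive_eq (is_deriveD d1 d2)); rewrite /GRing.scale/=.
  by move: (cos _) (sin _) => u v; field.
have dq x : is_derive x (1 : R) (fun t => d^-1 * sin (d * t)) (cos (d * x)).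
  apply: (is_derive_eq (is_derive_scale d^-1 (is_derive_sinM d x))).
  by rewrite mulrA mulVf// mul1r.
have cq : continuous (fun t : R => cos (d * t)) by exact: continuous_cosM.
have cp : continuous (fun t : R => t * cos (d * t)).
  by apply: continuous_mulf => //; move=> x; exact: cvg_id.
rewrite (Rintegral_is_derive dp cp a0) (Rintegral_is_derive dq cq ap).
rewrite sd [d * 0]mulr0 cos0 mul0r.
have -> : cos (d * a) = 1 - 2 * sin (d * (a / 2)) ^+ 2.
  have -> : d * a = d * (a / 2) + d * (a / 2) by field.
  by rewrite cosD -!expr2 cos2sin2; ring.
by move: (sin _) (sin _) => u v; field.
Qed.

Lemma Rintegral_min_id (a : R) : 0 <= a <= pi ->
  \int[mu]_(t in `[0, pi]) (Num.min a t * cos (0 * t)) = a * pi - a ^+ 2 / 2.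
Proof.
move=> api; have /andP[a0 ap] := api.
rewrite (Rintegral_min_split _ api); last exact: continuous_cosM.
have dp x : is_derive x (1 : R) (fun t => t ^+ 2 / 2) (x * cos (0 * x)).
  have := is_derive_scale (2^-1) (is_derive_expn 1 x).
  rewrite (_ : (fun r => 2^-1 * r ^+ 2) = fun t => t ^+ 2 / 2); last first.
    by apply/funext => t; rewrite mulrC.
  by move/is_derive_eq; apply; rewrite mul0r cos0 expr1; field.
have dq x : is_derive x (1 : R) id (cos (0 * x)).
  by apply: (is_derive_eq (is_derive_id x (1 : R))); rewrite mul0r cos0.
have cq : continuous (fun t : R => cos (0 * t)) by exact: continuous_cosM.
have cp : continuous (fun t : R => t * cos (0 * t)).
  by apply: continuous_mulf => //; move=> x; exact: cvg_id.
rewrite (Rintegral_is_derive dp cp a0) (Rintegral_is_derive dq cq ap).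
by rewrite expr0n/= mul0r subr0; field.
Qed.

(** Up to the normalization, the cosine coefficient of t |-> min a t; by
[arc_kernelE] it is the negative of [arc_coef2] off the diagonal, and on the
diagonal it also absorbs the mean N a / (2 pi) of the variance formula. *)
Definition arc_kernel (a d : R) : R :=
  (2 * pi ^+ 2)^-1 * \int[mu]_(t in `[0, pi]) (Num.min a t * cos (d * t)).

Lemma sin_subn_pi i j : sin ((i%:R - j%:R) * pi) = 0 :> R.
Proof. by rewrite mulrBl sinB !sin_natM_pi mul0r mulr0 subrr. Qed.

Lemma arc_kernelE (a : R) i j : 0 <= a <= pi ->
  arc_kernel a (i%:R - j%:R) = (i == j)%:R * (a / (2 * pi)) - arc_coef2 a (i%:R - j%:R).
Proof.
move=> api; rewrite /arc_kernel /arc_coef2 subr_eq0 eqr_nat.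
have p0 : (pi : R) != 0 by rewrite gt_eqF// pi_gt0.
case: eqP => [->|/eqP ij].
  rewrite subrr Rintegral_min_id//; clear api; move: (pi : R) p0 => p p0.
  by rewrite mul1r; field.
have d0 : i%:R - j%:R != 0 :> R by rewrite subr_eq0 eqr_nat.
rewrite Rintegral_min_cos//; last exact: sin_subn_pi.
move: (sin _) => s; clear api; move: (pi : R) (i%:R - j%:R : R) p0 d0 => p d p0 d0.
by rewrite mul0r sub0r; field; rewrite p0 d0.
Qed.

Lemma var_sector_kernel N (a : R) : (0 < N)%N -> 0 <= a <= pi ->
  var_sector N a = \sum_(i < N) \sum_(j < N) overlap i j * arc_kernel a (i%:R - j%:R).
Proof.
move=> N0 api; have a2 : 0 <= a <= 2 * pi.
  move/andP: api => [-> ap] /=; apply: le_trans ap _.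
  by rewrite ler_peMl ?pi_ge0// ler1n.
rewrite var_sector_overlap//.
have -> : N%:R * (a / (2 * pi)) = \sum_(i < N) \sum_(j < N) overlap i j * ((i == j)%:R * (a / (2 * pi))).
  rewrite mulr_natl -[in LHS](card_ord N) -sumr_const; apply: eq_bigr => i _.
  rewrite (bigD1 i)//= eqxx mul1r overlap_diag mul1r big1 ?addr0// => j ji.
  by rewrite eq_sym (negbTE ji) mul0r mulr0.
rewrite -sumrB; apply: eq_bigr => i _; rewrite -sumrB; apply: eq_bigr => j _.
by rewrite arc_kernelE// mulrBr.
Qed.

Lemma arc_kernelN (a d : R) : arc_kernel a (- d) = arc_kernel a d.
Proof. by rewrite /arc_kernel; congr (_ * _); apply: eq_Rintegral => t _; rewrite mulNr cosN. Qed.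

Lemma arc_kernel_le (a : R) i j : 0 <= a <= pi -> (i < j)%N ->
  `|overlap i j * arc_kernel a (i%:R - j%:R)| <= (pi ^+ 2)^-1 / (j%:R - i%:R) ^+ 2.
Proof.
move=> api ij; rewrite normrM ger0_norm ?overlap_ge0//.
apply: (@le_trans _ _ (1 * `|arc_kernel a (i%:R - j%:R)|)).
  by rewrite ler_wpM2r// overlap_le1.
rewrite mul1r arc_kernelE// /arc_coef2 subr_eq0 eqr_nat ltn_eqF// mul0r sub0r normrN.
rewrite ger0_norm ?sqr_ge0// expr_div_n -[j%:R - i%:R]opprB sqrrN exprMn invfM.
by rewrite ler_piMl ?mulr_ge0 ?invr_ge0 ?sqr_ge0// sin2cos2 gerBl sqr_ge0.
Qed.

Definition cos_moment (a : R) n : R := \int[mu]_(t in `[0, pi]) (Num.min a t * cos t ^+ n).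

Lemma sum_overlap_kernel (a : R) n :
  \sum_(i < n.+1) overlap i (n - i) * arc_kernel a (i%:R - (n - i)%:R) =
  (4 * pi)^-1 * (cos_moment a n / wallis n).
Proof.
have p0 : (pi : R) != 0 by rewrite gt_eqF// pi_gt0.
have W0 : wallis n != 0 :> R by rewrite gt_eqF// wallis_gt0.
have cF i : continuous (fun t : R => overlap i (n - i) * (Num.min a t * cos ((i%:R - (n - i)%:R) * t))).
  apply: continuous_mulf; first exact: cst_continuous.
  by apply: continuous_mulf; [exact: continuous_minr|exact: continuous_cosM].
have cI (c : R) (f : R -> R) : continuous f -> \int[mu]_(t in `[0, pi]) (c * f t) = c * \int[mu]_(t in `[0, pi]) f t.
  by move=> cf; rewrite RintegralZl//; apply: continuous_integrable.
transitivity ((2 * pi ^+ 2)^-1 * \int[mu]_(t in `[0, pi]) (\sum_(i < n.+1)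
    overlap i (n - i) * (Num.min a t * cos ((i%:R - (n - i)%:R) * t)))).
  rewrite (@Rintegral_bigsum _ _ n.+1 0 pi cF) mulr_sumr; apply: eq_bigr => i _.
  rewrite cI /arc_kernel 1?mulrCA//.
  by apply: continuous_mulf; [exact: continuous_minr|exact: continuous_cosM].
have -> : \int[mu]_(t in `[0, pi]) (\sum_(i < n.+1)
    overlap i (n - i) * (Num.min a t * cos ((i%:R - (n - i)%:R) * t))) =
    \int[mu]_(t in `[0, pi]) (pi / (2 * wallis n) * (Num.min a t * cos t ^+ n)).
  apply: eq_Rintegral => t _; rewrite mulrCA -sum_overlap_cos mulr_sumr.
  by apply: eq_bigr => i _; rewrite mulrCA.
rewrite cI; last by apply: continuous_mulf; [exact: continuous_minr|exact: continuous_cosX].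
rewrite -/(cos_moment a n).
move: (pi : R) (wallis n) p0 W0 => p W p0 W0.
by field; rewrite p0 W0.
Qed.

Lemma var_sector_cos_moment N (a : R) : (0 < N)%N -> 0 <= a <= pi ->
  `|var_sector N a - (4 * pi)^-1 * \sum_(n < N + N) cos_moment a n / wallis n|
    <= 2 / pi ^+ 2 * \sum_(k < N) (k.+1%:R)^-1.
Proof.
move=> N0 api; rewrite var_sector_kernel// mulr_sumr.
under [X in _ - X]eq_bigr do rewrite -sum_overlap_kernel.
apply: (@square_triangle R (fun i j => overlap i j * arc_kernel a (i%:R - j%:R))).
- by move=> i j; rewrite overlapC -arc_kernelN opprB.
- by move=> i j ij; exact: arc_kernel_le.
- by rewrite invr_ge0 sqr_ge0.
Qed.
End truncated_cosine.

Section fold_moment.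
Context {R : realType}.
Local Notation mu := (@lebesgue_measure R).

Definition half_moment (a : R) n : R := \int[mu]_(t in `[0, (pi / 2)]) (Num.min a t * cos t ^+ n).

Lemma continuous_min_cosX (a : R) n : continuous (fun t => Num.min a t * cos t ^+ n).
Proof. by apply: continuous_mulf; [exact: continuous_minr|exact: continuous_cosX]. Qed.

(** On [pi/2, pi] put t = pi - u; then cos^n t = (-1)^n cos^n u, and
min a (pi - u) = a - min pi u + min (pi - a) u for u <= pi/2. *)
Lemma cos_moment_fold (a : R) n :
  cos_moment a n = half_moment a n +
    (-1) ^+ n * (a * wallis n - half_moment pi n + half_moment (pi - a) n).
Proof.
have p2 : pi / 2 <= pi :> R by rewrite ler_pdivrMr// ler_peMr ?pi_ge0// ler1n.
rewrite /cos_moment (Rintegral_split (@continuous_integrable R _ 0 pi (@continuous_min_cosX a n)) pihalf_ge0 p2); congr (_ + _).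
have := @Rintegral_reflect _ _ 0 (pi / 2) pi (@continuous_min_cosX a n) pihalf_ge0.
rewrite subr0 (_ : pi - pi / 2 = pi / 2 :> R); last by field.
move=> ->; rewrite /half_moment /wallis.
have ci (f : R -> R) : continuous f -> mu.-integrable `[0, (pi / 2)] (EFin \o f).
  by move=> cf; apply: continuous_integrable.
have cc : continuous (fun t : R => cos t ^+ n) by exact: continuous_cosX.
have ca : continuous (fun t : R => a * cos t ^+ n) by apply: continuous_mulf => //; exact: cst_continuous.
have c1 b := @continuous_min_cosX b n.
have c2 : continuous (fun t : R => a * cos t ^+ n - Num.min pi t * cos t ^+ n).
  by move=> x; apply: cvgB; [exact: ca|exact: c1].
rewrite -(RintegralZl a)//; last exact: ci.
rewrite -RintegralB//; [|exact: ci|exact: ci].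
rewrite -RintegralD//; [|exact: ci|exact: ci].
rewrite -RintegralZl//; last first.
  by apply: ci => x; apply: cvgD; [exact: c2|exact: c1].
apply: eq_Rintegral => t; rewrite mem_setE in_itv/= => /andP[t0 t1].
have -> : cos (pi - t) = - cos t by rewrite cosB cospi sinpi mul0r addr0 mulN1r.
rewrite [(- cos t) ^+ n]exprNn mulrCA; congr (_ * _).
rewrite -mulrBl -mulrDl; congr (_ * _).
rewrite (min_idPr (le_trans t1 p2)).
by case: (leP a (pi - t)); case: (leP (pi - a) t) => *; lra.
Qed.

Definition half_ratio (a : R) n : R := half_moment a n / wallis n.

Lemma cos_moment_ratio (a : R) n : cos_moment a n / wallis n =
  half_ratio a n + (-1) ^+ n * (a - half_ratio pi n + half_ratio (pi - a) n).
Proof.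
have W0 : wallis n != 0 :> R by rewrite gt_eqF// wallis_gt0.
rewrite cos_moment_fold /half_ratio.
by move: (wallis n) (half_moment _ _) (half_moment _ _) (half_moment _ _) W0 => w x y z w0; field.
Qed.
End fold_moment.

(** * Gaussian approximation of cosine powers *)

Section gauss_cos.
Context {R : realType}.
Local Notation mu := (@lebesgue_measure R).

Lemma is_derive_ge0_le (G g : R -> R) (a b : R) :
  (forall x : R, is_derive x (1 : R) G (g x)) -> continuous g -> a <= b ->
  (forall x, a <= x <= b -> 0 <= g x) -> G a <= G b.
Proof.
move=> dG cg ab g0; rewrite -subr_ge0 -(Rintegral_is_derive dG cg ab).
by apply: Rintegral_ge0 => x; rewrite /= in_itv/=; exact: g0.
Qed.

Lemma mul_cos_le_sin (t : R) : 0 <= t <= pi -> t * cos t <= sin t.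
Proof.
move=> /andP[t0 tp]; rewrite -subr_ge0.
have d x : is_derive x (1 : R) (fun t : R => sin t - t * cos t) (x * sin x).
  apply: (is_derive_eq (is_deriveB (is_derive_sin x) (is_deriveM (is_derive_id x (1 : R)) (is_derive_cos x)))).
  by rewrite /GRing.scale/=; ring.
have c : continuous (fun x : R => x * sin x).
  by apply: continuous_mulf; [move=> x; exact: cvg_id|exact: continuous_sin].
have := is_derive_ge0_le d c t0; rewrite sin0 mul0r subrr; apply => x /andP[x0 xt].
by rewrite mulr_ge0// sin_ge0_pi// x0 (le_trans xt).
Qed.

(** The derivative of exp (t^2/2) cos t has the sign of t cos t - sin t. *)
Lemma cos_le_gauss (t : R) : 0 <= t <= pi -> cos t <= gauss 2^-1 t.
Proof.
move=> /andP[t0 tp].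
have d x : is_derive x (1 : R) (fun t : R => - (gauss (- 2^-1) t * cos t))
    (gauss (- 2^-1) x * (sin x - x * cos x)).
  have := is_deriveN (is_deriveM (is_derive_gauss (- 2^-1) x) (is_derive_cos x)).
  by move/is_derive_eq; apply; rewrite /GRing.scale/=; move: (cos x) (sin x) (gauss _ x) => u v w; field.
have c : continuous (fun x : R => gauss (- 2^-1) x * (sin x - x * cos x)).
  apply: continuous_mulf; first exact: continuous_gauss.
  move=> x; apply: cvgB; first exact: continuous_sin.
  by apply: cvgM; [exact: cvg_id|exact: continuous_cos].
have := is_derive_ge0_le d c t0; rewrite cos0 mulr1 lerN2.
have -> : gauss (- 2^-1) 0 = 1 :> R by rewrite /gauss expr0n/= mulr0 oppr0 expR0.
have -> : gauss 2^-1 t = (gauss (- 2^-1) t)^-1 by rewrite /gauss -expRN mulNr !opprK.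
move=> h; rewrite -[leRHS]mul1r ler_pdivlMr ?gauss_gt0// mulrC; apply: h => x /andP[x0 xt].
by rewrite mulr_ge0 ?gauss_ge0// subr_ge0 mul_cos_le_sin// x0 (le_trans xt).
Qed.

Lemma sin_le_id (t : R) : 0 <= t -> sin t <= t.
Proof.
move=> t0; rewrite -subr_ge0.
have d x : is_derive x (1 : R) (fun t : R => t - sin t) (1 - cos x).
  exact: (is_deriveB (is_derive_id x (1 : R)) (is_derive_sin x)).
have c : continuous (fun x : R => 1 - cos x).
  by move=> x; apply: cvgB; [exact: cvg_cst|exact: continuous_cos].
have := is_derive_ge0_le d c t0; rewrite sin0 subrr; apply => x _.
by rewrite subr_ge0 cos_le1.
Qed.

Lemma cos_ge_quadratic (t : R) : 0 <= t -> 1 - t ^+ 2 / 2 <= cos t.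
Proof.
move=> t0.
have d x : is_derive x (1 : R) (fun t : R => 2^-1 * t ^+ 2 + cos t) (x - sin x).
  have := is_deriveD (is_derive_scale 2^-1 (is_derive_expn 1 x)) (is_derive_cos x).
  by move/is_derive_eq; apply; rewrite expr1; field.
have c : continuous (fun x : R => x - sin x).
  by move=> x; apply: cvgB; [exact: cvg_id|exact: continuous_sin].
have h : 0 + 1 <= 2^-1 * t ^+ 2 + cos t.
  have := is_derive_ge0_le d c t0; rewrite cos0 expr0n/= mulr0; apply => x /andP[x0 _].
  by rewrite subr_ge0 sin_le_id.
by lra.
Qed.

Lemma expRN_le_quadratic (u : R) : 0 <= u -> expR (- u) <= 1 - u + u ^+ 2 / 2.
Proof.
move=> u0.
have d x : is_derive x (1 : R) (fun u : R => (2^-1 * u ^+ 2 - u) - expR (- u)) ((x - 1) + expR (- x)).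
  have dN : is_derive x (1 : R) (fun u : R => - u) (- 1) by exact: is_deriveN (is_derive_id x (1 : R)).
  have de := @is_derive1_comp R expR (fun u : R => - u) x _ _ (is_derive_expR (- x)) dN.
  have := is_deriveB (is_deriveB (is_derive_scale 2^-1 (is_derive_expn 1 x)) (is_derive_id x (1 : R))) de.
  by move/is_derive_eq; apply; rewrite expr1; field.
have c : continuous (fun x : R => (x - 1) + expR (- x)).
  move=> x; apply: cvgD; first by apply: cvgB; [exact: cvg_id|exact: cvg_cst].
  apply: (@continuous_comp _ _ _ (fun x : R => - x) expR); last exact: continuous_expR.
  by apply: cvgN; exact: cvg_id.
have h : 0 - 0 - 1 <= 2^-1 * u ^+ 2 - u - expR (- u).
  have := is_derive_ge0_le d c u0; rewrite expr0n/= mulr0 oppr0 expR0; apply => x _.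
  by have := expR_ge1Dx (- x); lra.
by lra.
Qed.

Lemma gauss_sub_cos_le (t : R) : 0 <= t -> gauss 2^-1 t - cos t <= t ^+ 4 / 8.
Proof.
move=> t0; have := cos_ge_quadratic t0.
have := @expRN_le_quadratic (2^-1 * t ^+ 2); rewrite -/(gauss 2^-1 t) => /(_ _)/wrap[].
  by rewrite mulr_ge0// sqr_ge0.
have -> : (2^-1 * t ^+ 2) ^+ 2 / 2 = t ^+ 4 / 8 by field.
by lra.
Qed.

Lemma subX_le (x y : R) n : 0 <= y <= x -> (x ^+ n - y ^+ n) * x <= n%:R * (x - y) * x ^+ n.
Proof.
move=> /andP[y0 yx]; have x0 := le_trans y0 yx.
elim: n => [|n IH]; first by rewrite !expr0 subrr !mul0r.
have -> : (x ^+ n.+1 - y ^+ n.+1) * x = x * ((x ^+ n - y ^+ n) * x) + (x - y) * x * y ^+ n.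
  by rewrite !exprS; ring.
have -> : n.+1%:R * (x - y) * x ^+ n.+1 = x * (n%:R * (x - y) * x ^+ n) + (x - y) * x * x ^+ n.
  by rewrite !exprS -natr1; ring.
apply: lerD; first by rewrite ler_wpM2l.
by rewrite ler_wpM2l ?mulr_ge0 ?subr_ge0// lerXn2r.
Qed.

Lemma gaussX (a t : R) n : gauss a t ^+ n = gauss (n%:R * a) t.
Proof. by rewrite /gauss -expRM_natl; congr expR; ring. Qed.

(** The difference of n-th powers is at most n times the difference of the bases
times the larger power n - 1; replacing n - 1 by n costs the factor
exp (t^2/2) <= exp (pi^2/8). *)
Lemma gauss_sub_cosX_le n (t : R) : 0 <= t <= pi / 2 ->
  0 <= gauss (n%:R / 2) t - cos t ^+ n <= expR (pi ^+ 2 / 8) * n%:R * t ^+ 4 * gauss (n%:R / 2) t.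
Proof.
move=> tp; have /andP[t0 tp2] := tp; have /andP[c0 c1] := cos_pihalf_itv tp.
have p2 : pi / 2 <= pi :> R by rewrite ler_pdivrMr// ler_peMr ?pi_ge0// ler1n.
have cg : cos t <= gauss 2^-1 t by rewrite cos_le_gauss// t0 (le_trans tp2).
rewrite -gaussX; have g0 := gauss_gt0 2^-1 t; apply/andP; split.
  by rewrite subr_ge0 lerXn2r// nnegrE ltW.
have := @subX_le _ _ n (introT andP (conj c0 cg)); rewrite -ler_pdivlMr// => h.
apply: le_trans h _; rewrite mulrAC; apply: ler_wpM2r; first by rewrite exprn_ge0// ltW.
have gi : (gauss 2^-1 t)^-1 <= expR (pi ^+ 2 / 8).
  rewrite /gauss -expRN opprK ler_expR.
  have : t ^+ 2 <= (pi / 2) ^+ 2 by rewrite lerXn2r ?nnegrE// pihalf_ge0.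
  by rewrite expr_div_n; lra.
have gc := gauss_sub_cos_le t0.
have nR : 0 <= n%:R :> R by exact: ler0n.
have t4 : 0 <= t ^+ 4 by rewrite exprn_ge0.
rewrite -[leLHS]mulrA (_ : expR _ * n%:R * t ^+ 4 = n%:R * (t ^+ 4 * expR (pi ^+ 2 / 8))); last by ring.
apply: ler_wpM2l => //; apply: ler_pM => //; [by rewrite subr_ge0|by rewrite invr_ge0 ltW|by lra].
Qed.
End gauss_cos.

Section gaussian_integrals.
Context {R : realType}.
Local Notation mu := (@lebesgue_measure R).

Lemma integrable_gauss_dom (f : R -> R) (a c : R) m : 0 < a ->
  measurable_fun setT f ->
  (forall t, 0 <= t -> `|f t| <= c * (t ^+ m * gauss a t)) ->
  mu.-integrable `[0, +oo[ (EFin \o f).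
Proof.
move=> a0 mf fc.
have ig := integrable_gmom m a0.
apply: (@le_integrable _ _ _ mu _ _ _ (EFin \o (fun r => c * (r ^+ m * gauss a r)))).
- exact: measurable_itv.
- by apply/measurable_EFinP; exact: measurable_funTS.
- move=> t; rewrite /= in_itv/= andbT => t0; rewrite lee_fin.
  by apply: le_trans (fc t t0) _; exact: ler_norm.
- by apply: integrable_mulc => //; exact: measurable_itv.
Qed.

Lemma Rintegral_gauss_dom (f : R -> R) (a c : R) m : 0 < a ->
  measurable_fun setT f ->
  (forall t, 0 <= t -> `|f t| <= c * (t ^+ m * gauss a t)) ->
  `|\int[mu]_(t in `[0, +oo[) f t| <= c * gmom a m.
Proof.
move=> a0 mf fc.
have ifd := integrable_gauss_dom a0 mf fc.
have ig := integrable_gmom m a0.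
apply: le_trans (le_normr_Rintegral _ ifd) _; first exact: measurable_itv.
have -> : gmom a m = \int[mu]_(t in `[0, +oo[) (t ^+ m * gauss a t) by [].
rewrite -RintegralZl//; apply: le_Rintegral => //.
- exact: integrable_abse ifd.
- exact: integrable_mulc.
- by move=> t; rewrite /= in_itv/= andbT; exact: fc.
Qed.

Lemma Rintegral_scale_ray (f : R -> R) (y r : R) : 0 < y -> measurable_fun setT f ->
  (forall t, 0 <= f t) ->
  y * \int[mu]_(t in `[r, +oo[) f (y * t) = \int[mu]_(t in `[y * r, +oo[) f t.
Proof.
move=> y0 mf f0; pose h (t : R) := if y * r <= t then (f t)%:E else 0%E.
have mh : measurable_fun setT h.
  rewrite (_ : h = (EFin \o f) \_ `[y * r, +oo[).
    by apply/measurable_restrict => //; rewrite setTI; apply/measurable_EFinP; exact: measurable_funTS.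
  by apply/funext => t; rewrite /patch/= mem_setE in_itv/= andbT.
have h0 t : (0 <= h t)%E by rewrite /h; case: ifP => // _; rewrite lee_fin.
have := ge0_integral_scale_gt0 y0 mh h0.
have -> : (\int[mu]_x h (y * x)%R)%E = (\int[mu]_(t in `[r, +oo[) (f (y * t))%:E)%E.
  rewrite [RHS]integral_mkcond; apply: eq_integral => t _.
  by rewrite /h/patch/= mem_setE in_itv/= andbT ler_pM2l.
have -> : (\int[mu]_x h x)%E = (\int[mu]_(t in `[(y * r)%R, +oo[) (f t)%:E)%E.
  rewrite [RHS]integral_mkcond; apply: eq_integral => t _.
  by rewrite /h/patch/= mem_setE in_itv/= andbT.
move=> e; rewrite /Rintegral -e; set I := (\int[mu]_(t in _) _)%E.
have I0 : (0 <= I)%E by apply: integral_ge0 => t _; rewrite lee_fin.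
by case: I I0 => [i| |] //= _; rewrite mulry gtr0_sg// mul1e/= mulr0.
Qed.

(** The Gaussian counterpart of [half_moment], for c = n / 2. *)
Definition min_gauss (a c : R) : R := \int[mu]_(t in `[0, +oo[) (Num.min a t * gauss c t).

Definition gauss_ray (r : R) : R := \int[mu]_(t in `[r, +oo[) expR (- t ^+ 2).

Lemma measurable_min_gauss (a c : R) : measurable_fun setT (fun t => Num.min a t * gauss c t).
Proof.
apply: measurable_funM; last exact: measurable_gauss.
by apply: continuous_measurable_fun; exact: continuous_minr.
Qed.

Lemma min_gauss_dom (a c t : R) : 0 <= a -> 0 <= t ->
  `|Num.min a t * gauss c t| <= 1 * (t ^+ 1 * gauss c t).
Proof.
move=> a0 t0; rewrite mul1r expr1 ger0_norm.
  by rewrite ler_wpM2r ?gauss_ge0// ge_min lexx orbT.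
by rewrite mulr_ge0 ?gauss_ge0// le_min a0 t0.
Qed.

Lemma min_gauss_ge0 (a c : R) : 0 <= a -> 0 <= min_gauss a c.
Proof.
move=> a0; apply: Rintegral_ge0 => t; rewrite /= in_itv/= andbT => t0.
by rewrite mulr_ge0 ?gauss_ge0// le_min a0 t0.
Qed.

Lemma min_gauss_le (a c : R) : 0 <= a -> 0 < c -> min_gauss a c <= (2 * c)^-1.
Proof.
move=> a0 c0; rewrite -(gmom1 c0) -[leRHS]mul1r; apply: le_trans (ler_norm _) _.
apply: Rintegral_gauss_dom => //; first exact: measurable_min_gauss.
by move=> t; exact: min_gauss_dom.
Qed.

Lemma min_gauss_split (a c : R) : 0 <= a -> 0 < c ->
  min_gauss a c = (1 - gauss c a) / (2 * c) + a * \int[mu]_(t in `[a, +oo[) gauss c t.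
Proof.
move=> a0 c0.
have im : mu.-integrable `[0, +oo[ (EFin \o (fun t => Num.min a t * gauss c t)).
  apply: (@integrable_gauss_dom _ c 1 1) => //; first exact: measurable_min_gauss.
  by move=> t; exact: min_gauss_dom.
have ig : mu.-integrable `[0, +oo[ (EFin \o gauss c).
  apply: (@integrable_gauss_dom _ c 1 0) => //; first exact: measurable_gauss.
  by move=> t t0; rewrite !mul1r ger0_norm// gauss_ge0.
have sub : `[a, +oo[%classic `<=` `[0, +oo[%classic by apply: subset_itvr; rewrite bnd_simp.
have sub' : `]a, +oo[%classic `<=` `[0, +oo[%classic by apply: subset_itv; rewrite bnd_simp.
have iS (f : R -> R) : mu.-integrable `[0, +oo[ (EFin \o f) -> mu.-integrable `[a, +oo[ (EFin \o f).
  by apply: integrableS => //; exact: measurable_itv.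
have iS' (f : R -> R) : mu.-integrable `[0, +oo[ (EFin \o f) -> mu.-integrable `]a, +oo[ (EFin \o f).
  by apply: integrableS => //; exact: measurable_itv.
have := Rintegral_itvB im.
rewrite /min_gauss => /(_ a); rewrite !bnd_simp a0 => /(_ isT isT).
rewrite Rintegral_itv_obnd_cbnd; last exact: iS'.
move/eqP; rewrite subr_eq addrC => /eqP ->; congr (_ + _).
  have dg x : is_derive x (1 : R) (fun t => - (2 * c)^-1 * gauss c t) (x * gauss c x).
    have := is_derive_scale (- (2 * c)^-1) (is_derive_gauss c x).
    by move/is_derive_eq; apply; move: (gauss c x) => g; field; rewrite gt_eqF.
  have cg : continuous (fun t : R => t * gauss c t).
    by apply: continuous_mulf; [move=> x; exact: cvg_id|exact: continuous_gauss].
  transitivity (\int[mu]_(t in `[0, a]) (t * gauss c t)).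
    by apply: eq_Rintegral => t; rewrite mem_setE in_itv/= => /andP[_ /min_idPr ->].
  rewrite (Rintegral_is_derive dg cg a0).
  have -> : gauss c 0 = 1 by rewrite /gauss expr0n/= mulr0 oppr0 expR0.
  by move: (gauss c a) => g; field; rewrite gt_eqF.
rewrite -RintegralZl//; last exact: iS.
by apply: eq_Rintegral => t; rewrite mem_setE in_itv/= andbT => /min_idPl ->.
Qed.

Lemma gauss_ray_scale (a c : R) : 0 < c ->
  Num.sqrt c * \int[mu]_(t in `[a, +oo[) gauss c t = gauss_ray (Num.sqrt c * a).
Proof.
move=> c0; have s0 : 0 < Num.sqrt c by rewrite sqrtr_gt0.
have mE : measurable_fun setT (fun t : R => expR (- t ^+ 2)).
  have := @measurable_gauss R 1; congr measurable_fun.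
  by apply/funext => t; rewrite /gauss mul1r.
rewrite /gauss_ray -(Rintegral_scale_ray a s0 mE (fun t => expR_ge0 _)).
congr (_ * _); apply: eq_Rintegral => t _.
by rewrite /gauss exprMn sqr_sqrtr// ltW.
Qed.

(** The sum of the two integrands in [I_arg]. At x <= 0 the square root is 0 and
so is the quotient, which leaves b times the half Gaussian integral: the
limit from the right. *)
Definition arg_density (b x : R) : R :=
  (1 - expR (- (b ^+ 2 * x))) / (2 * Num.sqrt x) + b * gauss_ray (b * Num.sqrt x).

Lemma min_gauss_arg_density (a c : R) : 0 <= a -> 0 < c ->
  Num.sqrt c * min_gauss a c = arg_density a c.
Proof.
move=> a0 c0; have s0 : Num.sqrt c != 0 by rewrite gt_eqF// sqrtr_gt0.
rewrite min_gauss_split// mulrDr [X in _ + X = _]mulrCA gauss_ray_scale// /arg_density [a * Num.sqrt c]mulrC.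
congr (_ + _); have -> : gauss c a = expR (- (a ^+ 2 * c)) by rewrite /gauss mulrC.
have cE : Num.sqrt c ^+ 2 = c by rewrite sqr_sqrtr// ltW.
move: (expR _) => e; rewrite -[X in 2 * X]cE.
by move: (Num.sqrt c) s0 => s s0; field.
Qed.

(** In this form monotonicity in x and in b, the Lipschitz bound and the upper
bounds are inherited from the integrand. *)
Lemma arg_densityE (b x : R) : 0 <= b -> 0 < x ->
  arg_density b x = \int[mu]_(s in `[0, +oo[) (Num.min b (s / Num.sqrt x) * gauss 1 s).
Proof.
move=> b0 x0; rewrite -min_gauss_arg_density//.
have s0 : 0 < Num.sqrt x by rewrite sqrtr_gt0.
pose f (s : R) := Num.min b (`|s| / Num.sqrt x) * gauss 1 s.
have mf : measurable_fun setT f.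
  apply: measurable_funM; last exact: measurable_gauss.
  apply: measurable_minr => //; apply: measurable_funM => //; exact: measurable_normr.
have f0 t : 0 <= f t.
  by rewrite mulr_ge0 ?gauss_ge0// le_min b0 divr_ge0// ltW.
have := Rintegral_scale_ray 0 s0 mf f0; rewrite mulr0.
have -> : \int[mu]_(t in `[0, +oo[) f t =
    \int[mu]_(s in `[0, +oo[) (Num.min b (s / Num.sqrt x) * gauss 1 s).
  by apply: eq_Rintegral => t; rewrite mem_setE in_itv/= andbT => t0; rewrite /f ger0_norm.
move=> <-; congr (_ * _); apply: eq_Rintegral => t; rewrite mem_setE in_itv/= andbT => t0.
rewrite /f ger0_norm; last by rewrite mulr_ge0// ltW.
rewrite mulrAC mulfV ?gt_eqF// mul1r; congr (_ * _).
by rewrite /gauss exprMn sqr_sqrtr ?mul1r// ltW.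
Qed.
End gaussian_integrals.

Section moment_comparison.
Context {R : realType}.
Local Notation mu := (@lebesgue_measure R).

(** On [0, pi/2] this is [gauss_sub_cosX_le] integrated against t; beyond pi/2,
where the cosine is cut off, the same bound holds trivially as t >= 1. *)
Lemma half_moment_min_gauss (a : R) n : 0 <= a -> (0 < n)%N ->
  `|half_moment a n - min_gauss a (n%:R / 2)| <= 8 * expR (pi ^+ 2 / 8) / n%:R ^+ 2.
Proof.
move=> a0 n0; have nR : 0 < n%:R :> R by rewrite ltr0n.
have c0 : 0 < n%:R / 2 :> R by rewrite divr_gt0.
pose J : set R := `[0, +oo[%classic; pose I : set R := `[0, (pi / 2)]%classic.
have IJ : I `<=` J by apply: subset_itvl; rewrite bnd_simp.
pose f (t : R) := Num.min a t * cos t ^+ n.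
pose g (t : R) := Num.min a t * gauss (n%:R / 2) t.
have mJ : measurable J by exact: measurable_itv.
have mI : measurable I by exact: measurable_itv.
have mf : measurable_fun setT f by apply: continuous_measurable_fun; exact: continuous_min_cosX.
have mfI : measurable_fun setT (f \_ I).
  by apply/measurable_restrict => //; rewrite setTI; exact: measurable_funTS.
have mg : measurable_fun setT g by exact: measurable_min_gauss.
have ig : mu.-integrable J (EFin \o g).
  apply: (@integrable_gauss_dom _ _ (n%:R / 2) 1 1) => //.
  by move=> t; exact: min_gauss_dom.
have ifI : mu.-integrable J (EFin \o (f \_ I)).
  apply: (@integrable_gauss_dom _ _ (n%:R / 2) 1 1) => // t t0.
  rewrite mul1r expr1 /patch mem_setE in_itv/= t0/=; case: ifP => [tp|_]; last first.
    by rewrite normr0 mulr_ge0// gauss_ge0.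
  have tI : 0 <= t <= pi / 2 by rewrite t0.
  have /andP[cos0 _] := cos_pihalf_itv tI.
  have /andP[h0 _] := gauss_sub_cosX_le n tI.
  have m0 : 0 <= Num.min a t by rewrite le_min a0 t0.
  rewrite /f ger0_norm; last by rewrite mulr_ge0// exprn_ge0.
  apply: ler_pM => //; [exact: exprn_ge0|by rewrite ge_min lexx orbT|by rewrite -subr_ge0].
have -> : half_moment a n = \int[mu]_(t in J) (f \_ I) t.
  rewrite -[half_moment a n]/(\int[mu]_(t in I) f t).
  by rewrite -{1}(setIidr IJ) Rintegral_mkcondr.
rewrite -[min_gauss _ _]/(\int[mu]_(t in J) g t) -RintegralB//.
have -> : 8 * expR (pi ^+ 2 / 8) / n%:R ^+ 2 =
    (expR (pi ^+ 2 / 8) * n%:R) * gmom (n%:R / 2) 5 :> R.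
  have -> : gmom (n%:R / 2) 5 = _ := @gmom_odd R (n%:R / 2) 2 c0.
  rewrite !factS fact0.
  by move: (expR _) (n%:R : R) nR => e x x0; field; rewrite gt_eqF.
apply: Rintegral_gauss_dom => //; first by exact: measurable_funB.
move=> t t0; rewrite distrC.
have m0 : 0 <= Num.min a t by rewrite le_min a0 t0.
have mt : Num.min a t <= t by rewrite ge_min lexx orbT.
have -> : expR (pi ^+ 2 / 8) * n%:R * (t ^+ 5 * gauss (n%:R / 2) t) =
    t * (expR (pi ^+ 2 / 8) * n%:R * t ^+ 4 * gauss (n%:R / 2) t).
  by rewrite [t ^+ 5]exprS; ring.
have e1 : 1 <= expR (pi ^+ 2 / 8) :> R.
  by rewrite -expR0 ler_expR divr_ge0// sqr_ge0.
rewrite /patch/= mem_setE in_itv/= t0/=; case: (leP t (pi / 2)) => tp.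
  have /andP[h0 h1] := @gauss_sub_cosX_le R n t (introT andP (conj t0 tp)).
  rewrite /f /g -mulrBr normrM (ger0_norm m0) (ger0_norm h0).
  by apply: ler_pM.
rewrite subr0.
rewrite /g normrM (ger0_norm m0) (ger0_norm (gauss_ge0 _ _)).
apply: ler_pM => //; first exact: gauss_ge0.
rewrite ler_peMl ?gauss_ge0//.
have t1 : 1 <= t by apply: ltW; apply: le_lt_trans tp; rewrite ler_pdivlMr// mul1r pi_ge2.
have h1 : 1 <= t ^+ 4 by exact: exprn_ege1.
have h2 : 1 <= n%:R :> R by rewrite ler1n.
apply: le_trans e1 _; rewrite -mulrA ler_peMr ?expR_ge0//.
by rewrite -[X in X <= _]mulr1 ler_pM.
Qed.

Lemma wallis_inv_bounds n (w := (wallis n)^-1 : R) (s := Num.sqrt (2 * n%:R / pi)) :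
  (0 < n)%N -> [/\ 0 <= w - s <= 1 & 0 <= w <= 2 * n%:R].
Proof.
move=> n0; have W0 := wallis_gt0 (R := R) n.
have w0 : 0 < w by rewrite invr_gt0.
have s0 : 0 <= s by exact: sqrtr_ge0.
have p0 := pi_gt0 R.
have s2 : s ^+ 2 = 2 * n%:R / pi by rewrite sqr_sqrtr// divr_ge0 ?mulr_ge0// ltW.
have w2 : s ^+ 2 <= w ^+ 2.
  rewrite s2 exprVn ler_pdivrMr// [leRHS]mulrC ler_pdivlMr ?exprn_gt0//.
  by have := wallis_sqr_le (R := R) n; lra.
have w3 : w ^+ 2 <= s ^+ 2 + 2 / pi.
  have -> : s ^+ 2 + 2 / pi = 2 * n.+1%:R / pi.
    by rewrite s2 -natr1; move: (pi : R) p0 => p p0; field; rewrite gt_eqF.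
  rewrite exprVn ler_pdivlMr// [leLHS]mulrC ler_pdivrMr ?exprn_gt0//.
  by have := wallis_sqr_ge (R := R) n; lra.
have p1 : 2 / pi <= 1 :> R by rewrite ler_pdivrMr// mul1r pi_ge2.
have sw : s <= w by rewrite -(@ler_pXn2r _ 2)// nnegrE ltW.
have h2 : 1 <= n%:R :> R by rewrite ler1n.
split; apply/andP; split.
- by rewrite subr_ge0.
- rewrite -(@ler_pXn2r _ 2)// ?nnegrE ?subr_ge0// expr1n.
  suff : (w - s) ^+ 2 <= w ^+ 2 - s ^+ 2 by lra.
  have : 0 <= s * (w - s) by rewrite mulr_ge0// subr_ge0.
  by rewrite !expr2; lra.
- exact: ltW.
- rewrite -(@ler_pXn2r _ 2)// ?nnegrE ?mulr_ge0// ?ltW//.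
  have h3 : s ^+ 2 <= n%:R * 1.
    rewrite s2 mulrAC mulrC ler_wpM2l//.
  have h4 : n%:R * 1 <= n%:R * n%:R :> R by rewrite ler_wpM2l.
  by rewrite exprMn [n%:R ^+ 2]expr2; lra.
Qed.

(** Write q w - s l = (q - l) w + l (w - s), with q the moment of cos^n, l the
Gaussian one, w = 1 / W_n and s = sqrt (2 n / pi): the first product is
O(n^-2) O(n) and the second O(1/n) O(1). *)
Lemma half_ratio_arg_density (a : R) n : 0 <= a -> (0 < n)%N ->
  `|half_ratio a n - 2 / Num.sqrt pi * arg_density a (n%:R / 2)|
    <= (16 * expR (pi ^+ 2 / 8) + 1) / n%:R.
Proof.
move=> a0 n0; have nR : 0 < n%:R :> R by rewrite ltr0n.
have c0 : 0 < n%:R / 2 :> R by rewrite divr_gt0.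
have p0 := pi_gt0 R.
have [/andP[ws0 ws1] /andP[w0 w1]] := wallis_inv_bounds n0.
have hQ := half_moment_min_gauss a0 n0.
have L0 := min_gauss_ge0 (n%:R / 2) a0.
have L1 := min_gauss_le a0 c0.
rewrite -min_gauss_arg_density// /half_ratio.
rewrite mulrA (_ : 2 / Num.sqrt pi * Num.sqrt (n%:R / 2) = Num.sqrt (2 * n%:R / pi)); last first.
  apply/eqP; rewrite -(@eqrXn2 _ 2) ?mulr_ge0 ?divr_ge0 ?sqrtr_ge0//.
  rewrite exprMn expr_div_n !sqr_sqrtr ?divr_ge0 ?mulr_ge0 ?(ltW p0) ?(ltW nR)//.
  by apply/eqP; move: (pi : R) p0 => p p0; field; rewrite gt_eqF.
move: ws0 ws1 w0 w1; move: ((wallis n)^-1) (Num.sqrt (2 * n%:R / pi)) => w s ws0 ws1 w0 w1.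
move: (half_moment a n) (min_gauss a (n%:R / 2)) (expR _) hQ L0 L1 => Q L e hQ L0 L1.
rewrite (_ : Q * w - s * L = (Q - L) * w + L * (w - s)); last by ring.
have e0 : 0 <= 8 * e / n%:R ^+ 2 by apply: le_trans hQ; exact: normr_ge0.
apply: le_trans (ler_normD _ _) _; rewrite !normrM (ger0_norm w0) (ger0_norm L0) (ger0_norm ws0).
have h1 : `|Q - L| * w <= 8 * e / n%:R ^+ 2 * (2 * n%:R) by apply: ler_pM.
have h2 : L * (w - s) <= (2 * (n%:R / 2))^-1 * 1 by apply: ler_pM.
apply: le_trans (lerD h1 h2) _; rewrite le_eqVlt; apply/orP; left; apply/eqP.
by move: (n%:R : R) nR => x x0; field; rewrite gt_eqF.
Qed.
End moment_comparison.

(** * The limiting density and its integral *)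

Section arg_density_theory.
Context {R : realType}.
Local Notation mu := (@lebesgue_measure R).

Lemma integrable_min_ratio (b y : R) : 0 <= b -> 0 <= y ->
  mu.-integrable `[0, +oo[ (EFin \o (fun s => Num.min b (s / y) * gauss 1 s)).
Proof.
move=> b0 y0; apply: (@integrable_gauss_dom _ _ 1 b 0) => //.
  apply: measurable_funM; last exact: measurable_gauss.
  by apply: measurable_minr => //; exact: measurable_funM.
move=> t t0; rewrite mul1r ger0_norm; first by rewrite ler_wpM2r ?gauss_ge0// ge_min lexx.
by rewrite mulr_ge0 ?gauss_ge0// le_min b0 divr_ge0.
Qed.

Lemma gauss_ray_ge0 (r : R) : 0 <= gauss_ray r.
Proof. by apply: Rintegral_ge0 => t _; exact: expR_ge0. Qed.

Lemma gauss_ray0 : gauss_ray 0 = gmom 1 0 :> R.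
Proof. by apply: eq_Rintegral => t _; rewrite /gauss expr0 !mul1r. Qed.

Lemma gmom10_le1 : gmom 1 0 <= 1 :> R.
Proof.
rewrite gmom0// sqrtr1 mulr1 ler_pdivrMr// mul1r -(@ler_pXn2r _ 2)// ?nnegrE ?sqrtr_ge0//.
rewrite sqr_sqrtr ?pi_ge0//; have := pihalf_lt2 R; lra.
Qed.

Lemma arg_density_le0 (b x : R) : x <= 0 -> arg_density b x = b * gmom 1 0.
Proof. by move=> x0; rewrite /arg_density ler0_sqrtr// !mulr0 invr0 mulr0 add0r gauss_ray0. Qed.

Lemma Rintegral_gauss_cst (c : R) : \int[mu]_(s in `[0, +oo[) (c * gauss 1 s) = c * gmom 1 0.
Proof.
rewrite RintegralZl//.
  by congr (_ * _); apply: eq_Rintegral => t _; rewrite expr0 mul1r.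
apply: (@integrable_gauss_dom _ _ 1 1 0) => //; first exact: measurable_gauss.
by move=> t t0; rewrite !mul1r ger0_norm// gauss_ge0.
Qed.

Lemma integrable_gauss_cst (c : R) : mu.-integrable `[0, +oo[ (EFin \o (fun s => c * gauss 1 s)).
Proof.
apply: (@integrable_gauss_dom _ _ 1 `|c| 0) => //.
  by apply: measurable_funM => //; exact: measurable_gauss.
by move=> t t0; rewrite mul1r normrM (ger0_norm (gauss_ge0 _ _)).
Qed.

Lemma arg_density_le_gmom (b x : R) : 0 <= b -> arg_density b x <= b * gmom 1 0.
Proof.
move=> b0; case: (leP x 0) => x0; first by rewrite arg_density_le0.
have s0 := sqrtr_ge0 x.
rewrite arg_densityE// -Rintegral_gauss_cst; apply: le_Rintegral => //.
- exact: integrable_min_ratio.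
- exact: integrable_gauss_cst.
- by move=> t _; rewrite ler_wpM2r ?gauss_ge0// ge_min lexx.
Qed.

Lemma arg_density_le (b x : R) : 0 <= b -> arg_density b x <= b.
Proof.
move=> b0; apply: le_trans (arg_density_le_gmom x b0) _.
by rewrite ler_piMr// gmom10_le1.
Qed.

Lemma arg_density_ge (b x : R) : 0 <= b ->
  (1 - expR (- (b ^+ 2 * x))) / (2 * Num.sqrt x) <= arg_density b x.
Proof. by move=> b0; rewrite /arg_density lerDl mulr_ge0// gauss_ray_ge0. Qed.

Lemma arg_density_ge0 (b x : R) : 0 <= b -> 0 <= arg_density b x.
Proof.
move=> b0; case: (leP x 0) => x0.
  by rewrite arg_density_le0// mulr_ge0// -gauss_ray0 gauss_ray_ge0.
apply: le_trans (arg_density_ge x b0); rewrite divr_ge0 ?mulr_ge0 ?sqrtr_ge0//.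
by rewrite subr_ge0 -expR0 ler_expR oppr_le0 mulr_ge0 ?sqr_ge0// ltW.
Qed.

Lemma arg_density_le_inv (b x : R) : 0 <= b -> 0 < x -> arg_density b x <= (2 * Num.sqrt x)^-1.
Proof.
move=> b0 x0; have s0 : 0 < Num.sqrt x by rewrite sqrtr_gt0.
rewrite -min_gauss_arg_density//.
have := min_gauss_le b0 x0; rewrite -(ler_pM2l s0) => /le_trans; apply.
rewrite -{2}(sqr_sqrtr (ltW x0)) le_eqVlt; apply/orP; left; apply/eqP.
by move: (Num.sqrt x) s0 => s s0; field; rewrite gt_eqF.
Qed.

Lemma arg_density_nonincreasing (b : R) : 0 <= b -> nonincreasing_fun (arg_density b).
Proof.
move=> b0 x y xy; case: (leP x 0) => x0.
  by rewrite [leRHS]arg_density_le0// arg_density_le_gmom.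
have y0 := lt_le_trans x0 xy.
have sx : 0 < Num.sqrt x by rewrite sqrtr_gt0.
have sy : 0 < Num.sqrt y by rewrite sqrtr_gt0.
rewrite !arg_densityE//; apply: le_Rintegral => //.
- by apply: integrable_min_ratio => //; exact: ltW.
- by apply: integrable_min_ratio => //; exact: ltW.
move=> t; rewrite /= in_itv/= andbT => t0; rewrite ler_wpM2r ?gauss_ge0//.
rewrite le_min ge_min lexx/= ge_min; apply/orP; right.
by apply: ler_wpM2l => //; rewrite lef_pV2 ?posrE//; apply: ler_wsqrtr.
Qed.

Lemma arg_density_homo (b b' x : R) : 0 <= b -> b <= b' ->
  arg_density b x <= arg_density b' x <= arg_density b x + (b' - b).
Proof.
move=> b0 bb; have b'0 := le_trans b0 bb.
have d0 : 0 <= b' - b by rewrite subr_ge0.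
have g0 : 0 <= gmom 1 0 :> R by rewrite -gauss_ray0 gauss_ray_ge0.
have g1 : (b' - b) * gmom 1 0 <= b' - b by rewrite ler_piMr// gmom10_le1.
case: (leP x 0) => x0.
  have h : 0 <= (b' - b) * gmom 1 0 by rewrite mulr_ge0.
  by rewrite !arg_density_le0//; apply/andP; split; lra.
have s0 := sqrtr_ge0 x.
rewrite !arg_densityE//; apply/andP; split.
  apply: le_Rintegral => //; try exact: integrable_min_ratio.
  move=> t; rewrite /= in_itv/= andbT => t0; rewrite ler_wpM2r ?gauss_ge0//.
  by rewrite le_min !ge_min lexx bb orbT.
apply: (@le_trans _ _ (\int[mu]_(s in `[0, +oo[) (Num.min b (s / Num.sqrt x) * gauss 1 s) +
    (b' - b) * gmom 1 0)); last by rewrite lerD2l.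
rewrite -Rintegral_gauss_cst -RintegralD//; last 2 first.
- exact: integrable_min_ratio.
- exact: integrable_gauss_cst.
apply: le_Rintegral => //.
- exact: integrable_min_ratio.
- by apply: integrable_addf => //; [exact: integrable_min_ratio|exact: integrable_gauss_cst].
move=> t _; rewrite -mulrDl ler_wpM2r ?gauss_ge0//.
by case: (leP b (t / Num.sqrt x)); case: (leP b' (t / Num.sqrt x)) => *; lra.
Qed.

Lemma arg_density_scale (a x c : R) : 0 < c -> 0 <= x ->
  Num.sqrt c * arg_density a x = arg_density (Num.sqrt c * a) (x / c).
Proof.
rewrite le_eqVlt => c0 /predU1P[<-|x0]; first by rewrite mul0r !arg_density_le0// mulrA.
have sc : 0 < Num.sqrt c by rewrite sqrtr_gt0.
have sx : 0 < Num.sqrt x by rewrite sqrtr_gt0.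
rewrite /arg_density sqrtrM ?(ltW x0)// sqrtrV ?(ltW c0)// exprMn sqr_sqrtr ?(ltW c0)//.
rewrite mulrDr [X in _ + X = _]mulrA; congr (_ + _ * gauss_ray _).
- have -> : c * a ^+ 2 * (x / c) = a ^+ 2 * x by field; rewrite gt_eqF.
  move: (expR _) (Num.sqrt c) (Num.sqrt x) sc sx => e s t s0 t0.
  by field; rewrite !gt_eqF.
- move: (Num.sqrt c) (Num.sqrt x) sc sx => s t s0 t0.
  by field; rewrite !gt_eqF.
Qed.
End arg_density_theory.

Section riemann_sum.
Context {R : realType}.
Local Notation mu := (@lebesgue_measure R).

Lemma integrable_monotone (f : R -> R) (a b M : R) :
  nonincreasing_fun f -> (forall x, 0 <= f x <= M) -> mu.-integrable `[a, b] (EFin \o f).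
Proof.
move=> fm fM; have mI : measurable `[a, b]%classic by exact: measurable_itv.
have ic : mu.-integrable `[a, b] (EFin \o (fun _ : R => M)).
  by apply: continuous_integrable; exact: cst_continuous.
apply: (@le_integrable _ _ _ mu _ _ _ (EFin \o (fun _ : R => M))) => //.
  by apply/measurable_EFinP; exact: nonincreasing_measurable.
move=> t _; rewrite lee_fin; have /andP[f0 f1] := fM t.
by rewrite /= ger0_norm// (le_trans f1)// ler_norm.
Qed.

Lemma Rintegral_bounds (f : R -> R) (a b l u : R) : mu.-integrable `[a, b] (EFin \o f) ->
  a <= b -> (forall x, a <= x <= b -> l <= f x <= u) ->
  (b - a) * l <= \int[mu]_(t in `[a, b]) f t <= (b - a) * u.
Proof.
move=> fi ab fb.
have ic c : \int[mu]_(t in `[a, b]) (fun _ : R => c) t = (b - a) * c.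
  have d x : is_derive x (1 : R) (fun t : R => c * t) c.
    by have := is_derive_scale c (is_derive_id x (1 : R)); rewrite mulr1.
  have cc : continuous (fun _ : R => c) by exact: cst_continuous.
  by rewrite (Rintegral_is_derive d cc ab); ring.
have ii c : mu.-integrable `[a, b] (EFin \o (fun _ : R => c)).
  by apply: continuous_integrable; exact: cst_continuous.
rewrite -!ic; apply/andP; split; apply: le_Rintegral => // x; rewrite /= in_itv/= => /fb /andP[] //.
Qed.

Lemma riemann_sum_step (f : R -> R) (h M : R) k : 0 <= h ->
  nonincreasing_fun f -> (forall x, 0 <= f x <= M) ->
  h * \sum_(n < k) f (n.+1%:R * h) <= \int[mu]_(t in `[0, (k%:R * h)]) f t
    <= h * \sum_(n < k) f (n%:R * h).
Proof.
move=> h0 fm fM; elim: k => [|k IH].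
  by rewrite !big_ord0 mulr0 mul0r set_itv1 Rintegral_set1 lexx.
have kh : 0 <= k%:R * h by rewrite mulr_ge0.
have kk : k%:R * h <= k.+1%:R * h by rewrite ler_wpM2r// ler_nat.
rewrite (@Rintegral_split _ f 0 (k%:R * h))//; last exact: integrable_monotone fM.
rewrite !big_ord_recr/= !mulrDr.
have [/andP[l1 u1] hb] : (k.+1%:R * h - k%:R * h) * f (k.+1%:R * h)
    <= \int[mu]_(t in `[(k%:R * h), (k.+1%:R * h)]) f t <=
    (k.+1%:R * h - k%:R * h) * f (k%:R * h) /\ (k.+1%:R * h - k%:R * h = h).
  split; last by rewrite -natr1; ring.
  apply: Rintegral_bounds => //; first exact: integrable_monotone fM.
  by move=> x /andP[x1 x2]; rewrite !fm.
rewrite hb in l1 u1; have /andP[l2 u2] := IH.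
by apply/andP; split; apply: lerD.
Qed.

Lemma riemann_sum (f : R -> R) (M : R) m : (0 < m)%N ->
  nonincreasing_fun f -> (forall x, 0 <= f x <= M) ->
  m%:R^-1 * \sum_(n < m) f (n.+1%:R / m%:R) <= \int[mu]_(t in `[0, 1]) f t
    <= m%:R^-1 * \sum_(n < m) f (n%:R / m%:R).
Proof.
move=> m0 fm fM; have mR : 0 < m%:R :> R by rewrite ltr0n.
have i0 : 0 <= m%:R^-1 :> R by rewrite invr_ge0 ltW.
have := riemann_sum_step m i0 fm fM.
by rewrite mulfV// gt_eqF.
Qed.
End riemann_sum.

Section I_arg_theory.
Context {R : realType}.
Local Notation mu := (@lebesgue_measure R).

Lemma arg_density_bounds (b : R) : 0 <= b -> forall x, 0 <= arg_density b x <= b.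
Proof. by move=> b0 x; rewrite arg_density_ge0// arg_density_le. Qed.

Lemma I_argE (b : R) : 0 <= b -> I_arg b = \int[mu]_(x in `[0, 1]) arg_density b x.
Proof.
move=> b0.
pose g (x : R) := gauss_ray (b * Num.sqrt x).
have mono x y : 0 <= x -> x <= y -> gauss_ray y <= gauss_ray x :> R.
  move=> x0 xy; have ig : mu.-integrable `[0, +oo[ (EFin \o (fun t => expR (- t ^+ 2))).
    have := integrable_gauss_cst (1 : R); congr (_.-integrable _ _).
    by apply/funext => t; rewrite /= /gauss !mul1r.
  have iS (z : R) : 0 <= z -> mu.-integrable `[z, +oo[ (EFin \o (fun t => expR (- t ^+ 2))).
    move=> z0; apply: (integrableS _ _ _ ig) => //.
    by apply: subset_itvr; rewrite bnd_simp.
  have y0 := le_trans x0 xy.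
  have := Rintegral_itvB (iS x x0); rewrite /gauss_ray => /(_ y).
  rewrite !bnd_simp xy => /(_ isT isT); rewrite Rintegral_itv_obnd_cbnd; last first.
    apply: (integrableS _ _ _ (iS y y0)) => //.
    by apply: subset_itvr; rewrite bnd_simp.
  move=> <-; rewrite gerBl; apply: Rintegral_ge0 => t _; exact: expR_ge0.
have gm : nonincreasing_fun g.
  move=> x y xy; apply: mono; first by rewrite mulr_ge0// sqrtr_ge0.
  by rewrite ler_wpM2l// ler_wsqrtr.
have g01 x : 0 <= g x <= 1.
  rewrite gauss_ray_ge0/=; apply: le_trans (_ : gauss_ray 0 <= 1).
    by apply: mono; rewrite ?mulr_ge0 ?sqrtr_ge0.
  by rewrite gauss_ray0 gmom10_le1.
have ig : mu.-integrable `[0, 1] (EFin \o g) by exact: integrable_monotone g01.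
have igb : mu.-integrable `[0, 1] (EFin \o (fun x => b * g x)) by exact: integrable_mulc.
have ia : mu.-integrable `[0, 1] (EFin \o arg_density b).
  exact: integrable_monotone (arg_density_nonincreasing b0) (arg_density_bounds b0).
have -> : I_arg b = \int[mu]_(x in `[0, 1]) ((1 - expR (- (b ^+ 2 * x))) / (2 * Num.sqrt x)) +
    b * \int[mu]_(x in `[0, 1]) g x by [].
rewrite -RintegralZl// -RintegralD//.
have -> : (fun x => (1 - expR (- (b ^+ 2 * x))) / (2 * Num.sqrt x)) =
    (fun x => arg_density b x + (- 1) * (b * g x)).
  by apply/funext => x; rewrite /arg_density mulN1r addrK.
by apply: integrable_addf => //; apply: integrable_mulc.
Qed.

Lemma I_arg_bounds (b : R) m : 0 <= b -> (0 < m)%N ->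
  m%:R^-1 * \sum_(n < m) arg_density b (n.+1%:R / m%:R) <= I_arg b
    <= m%:R^-1 * \sum_(n < m) arg_density b (n%:R / m%:R).
Proof.
move=> b0 m0; rewrite I_argE//.
exact: riemann_sum (arg_density_nonincreasing b0) (arg_density_bounds b0).
Qed.

Lemma I_arg_ge (b : R) : 0 <= b -> (1 - expR (- b ^+ 2)) / 2 <= I_arg b.
Proof.
move=> b0; have /andP[h _] := @I_arg_bounds b 1 b0 isT; apply: le_trans h.
rewrite big_ord1 invr1 mul1r mulr1; apply: le_trans (arg_density_ge 1 b0).
by rewrite sqrtr1 !mulr1.
Qed.

Lemma I_arg_ge0 (b : R) : 0 <= b -> 0 <= I_arg b.
Proof.
move=> b0; apply: le_trans (I_arg_ge b0).
by rewrite divr_ge0// subr_ge0 -expR0 ler_expR oppr_le0 sqr_ge0.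
Qed.

Lemma I_arg_gt0 (b : R) : 0 < b -> 0 < I_arg b.
Proof.
move=> b0; apply: lt_le_trans (I_arg_ge (ltW b0)).
by rewrite divr_gt0// subr_gt0 -expR0 ltr_expR oppr_lt0 exprn_gt0.
Qed.

Lemma I_arg_le (b : R) : 0 <= b -> I_arg b <= b.
Proof.
move=> b0; have /andP[_ h] := @I_arg_bounds b 1 b0 isT; apply: le_trans h _.
by rewrite big_ord1 invr1 mul1r arg_density_le.
Qed.

Lemma I_arg_homo (b b' : R) : 0 <= b -> b <= b' -> I_arg b <= I_arg b' <= I_arg b + (b' - b).
Proof.
move=> b0 bb; have b'0 := le_trans b0 bb.
have ia c : 0 <= c -> mu.-integrable `[0, 1] (EFin \o arg_density c).
  move=> c0; exact: integrable_monotone (arg_density_nonincreasing c0) (arg_density_bounds c0).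
rewrite !I_argE//; apply/andP; split.
  apply: le_Rintegral => //; [exact: ia|exact: ia|].
  by move=> x _; have /andP[] := arg_density_homo x b0 bb.
have mI : measurable `[0, 1 : R]%classic by exact: measurable_itv.
have ic : mu.-integrable `[0, 1] (EFin \o (fun _ : R => b' - b)).
  by apply: continuous_integrable; exact: cst_continuous.
have icE : \int[mu]_(x in `[0, 1]) (fun _ : R => b' - b) x = b' - b.
  have := Rintegral_bounds ic ler01; move=> /(_ (b' - b) (b' - b)) h.
  apply/eqP; rewrite eq_le andbC; have := h (fun _ _ => introT andP (conj (lexx _) (lexx _))).
  by rewrite subr0 mul1r.
rewrite -[X in _ + X]icE -RintegralD//; [|exact: ia].
apply: le_Rintegral => //; [exact: ia|apply: integrable_addf => //; exact: ia|].
by move=> x _; have /andP[] := arg_density_homo x b0 bb.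
Qed.

Lemma I_arg_lipschitz (b b' : R) : 0 <= b -> 0 <= b' -> `|I_arg b - I_arg b'| <= `|b - b'|.
Proof.
wlog bb : b b' / b <= b' => [h b0 b'0|b0 _].
  by case: (leP b b') => [|/ltW] bb; [exact: h|rewrite distrC [leRHS]distrC; exact: h].
have /andP[h1 h2] := I_arg_homo b0 bb.
move: h1 h2; move: (I_arg b) (I_arg b') => u v h1 h2.
have d1 : 0 <= v - u by rewrite subr_ge0.
have d2 : 0 <= b' - b by rewrite subr_ge0.
rewrite distrC [leRHS]distrC (ger0_norm d1) (ger0_norm d2); lra.
Qed.

(** From exp (- u^2) <= 2 / (1 + u)^2, whose right-hand side has an algebraic
primitive. *)
Lemma arg_density_ge_decay (b x : R) : 0 <= b -> 0 < x ->
  (2 * Num.sqrt x)^-1 - (Num.sqrt x * (1 + b * Num.sqrt x) ^+ 2)^-1 <= arg_density b x.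
Proof.
move=> b0 x0; apply: le_trans (arg_density_ge x b0).
have xE : x = Num.sqrt x ^+ 2 by rewrite sqr_sqrtr// ltW.
have s0 : 0 < Num.sqrt x by rewrite sqrtr_gt0.
rewrite {4}xE -exprMn; move: (Num.sqrt x) s0 => s s0.
have bs : 0 <= b * s by rewrite mulr_ge0// ltW.
have q0 : 0 < (1 + b * s) ^+ 2 by rewrite exprn_gt0// ltr_wpDr.
have e0 := expR_gt0 ((b * s) ^+ 2).
have h : (1 + b * s) ^+ 2 <= 2 * expR ((b * s) ^+ 2).
  have := expR_ge1Dx ((b * s) ^+ 2); have := sqr_ge0 (1 - b * s).
  by rewrite !expr2; lra.
have p1 : 0 < expR ((b * s) ^+ 2) * (2 * s) by rewrite !mulr_gt0.
have p2 : 0 < s * (1 + b * s) ^+ 2 by rewrite mulr_gt0.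
rewrite mulrBl mul1r lerD2l lerN2 expRN -invfM lef_pV2 ?posrE//.
by rewrite (_ : expR _ * (2 * s) = s * (2 * expR ((b * s) ^+ 2))) ?ler_pM2l//; ring.
Qed.

Lemma sqrt_step (x y : R) : 0 <= x -> x < y ->
  (2 * Num.sqrt y)^-1 * (y - x) <= Num.sqrt y - Num.sqrt x.
Proof.
move=> x0 xy; have y0 := le_lt_trans x0 xy.
have sy : 0 < Num.sqrt y by rewrite sqrtr_gt0.
have sx : 0 <= Num.sqrt x by exact: sqrtr_ge0.
have sxy : Num.sqrt x <= Num.sqrt y by rewrite ler_wsqrtr// ltW.
move: (sqr_sqrtr (ltW y0)) (sqr_sqrtr x0).
move: (Num.sqrt x) (Num.sqrt y) sy sx sxy => s t t0 s0 st <- <-.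
rewrite mulrC ler_pdivrMr ?mulr_gt0//.
have : 0 <= (t - s) ^+ 2 by exact: sqr_ge0.
by rewrite !expr2; lra.
Qed.

Lemma sqrt_step_ge (x y : R) : 0 < x -> x <= y ->
  Num.sqrt y - Num.sqrt x <= (2 * Num.sqrt x)^-1 * (y - x).
Proof.
move=> x0 xy; have y0 := lt_le_trans x0 xy.
have sx : 0 < Num.sqrt x by rewrite sqrtr_gt0.
have sxy : Num.sqrt x <= Num.sqrt y by rewrite ler_wsqrtr.
move: (sqr_sqrtr (ltW y0)) (sqr_sqrtr (ltW x0)).
move: (Num.sqrt x) (Num.sqrt y) sx sxy => s t s0 st <- <-.
rewrite [leRHS]mulrC ler_pdivlMr ?mulr_gt0//.
have : 0 <= (t - s) ^+ 2 by exact: sqr_ge0.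
by rewrite !expr2; lra.
Qed.

Lemma decay_step (b x y : R) : 0 <= b -> 0 <= x -> x < y ->
  (Num.sqrt y * (1 + b * Num.sqrt y) ^+ 2)^-1 * (y - x) <=
  2 * (Num.sqrt y / (1 + b * Num.sqrt y) - Num.sqrt x / (1 + b * Num.sqrt x)).
Proof.
move=> b0 x0 xy; have := sqrt_step x0 xy.
have y0 := le_lt_trans x0 xy.
have sy : 0 < Num.sqrt y by rewrite sqrtr_gt0.
have sx : 0 <= Num.sqrt x by exact: sqrtr_ge0.
have sxy : Num.sqrt x <= Num.sqrt y by rewrite ler_wsqrtr// ltW.
move: (Num.sqrt x) (Num.sqrt y) sy sx sxy => s t t0 s0 st h.
have qs : 0 < 1 + b * s by rewrite ltr_wpDr// mulr_ge0.
have qt : 0 < 1 + b * t by rewrite ltr_wpDr// mulr_ge0// ltW.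
have qst : 1 + b * s <= 1 + b * t by rewrite lerD2l ler_wpM2l.
have -> : t / (1 + b * t) - s / (1 + b * s) = (t - s) / ((1 + b * t) * (1 + b * s)).
  by field; rewrite !gt_eqF.
have -> : (t * (1 + b * t) ^+ 2)^-1 * (y - x) = 2 * ((2 * t)^-1 * (y - x)) / (1 + b * t) ^+ 2.
  by field; rewrite !gt_eqF.
rewrite -mulrA ler_pM2l//; apply: ler_pM.
- by rewrite mulr_ge0 ?invr_ge0 ?mulr_ge0 ?subr_ge0// ltW.
- by rewrite invr_ge0 sqr_ge0.
- exact: h.
- by rewrite lef_pV2 ?posrE ?exprn_gt0 ?mulr_gt0// expr2 ler_pM2l.
Qed.

(** Compare [arg_density b] with 1 / (2 sqrt x) at the nodes of a Riemann sum with
at least b^2 terms.  Both telescope there, 1 / (2 sqrt x) against increments of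
sqrt and the defect against increments of s / (1 + b s), s = sqrt x; this
replaces the improper integrals, and the number of nodes keeps the
discretization error below 1 / b. *)
Lemma I_arg_to1 (b : R) : 0 < b -> `|1 - I_arg b| <= 3 / b.
Proof.
move=> b0; have b0' := ltW b0.
(* With m >= b^2 nodes, both 1 / sqrt m and b / m are at most 1 / b. *)
pose m := (Num.truncn (b ^+ 2)).+1.
have mb : b ^+ 2 <= m%:R by rewrite ltW// truncnS_gt.
have mR : 0 < m%:R :> R by rewrite ltr0n.
have mE (n : nat) : n.+1%:R / m%:R - n%:R / m%:R = m%:R^-1 :> R.
  by rewrite -mulrBl -natrB// subSnn mul1r.
have mlt n : n%:R / m%:R < n.+1%:R / m%:R :> R by rewrite ltr_pM2r ?invr_gt0// ltr_nat.
have n0 n : 0 <= n%:R / m%:R :> R by rewrite divr_ge0// ltW.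
have n1 n : 0 < n.+1%:R / m%:R :> R by rewrite divr_gt0.
have /andP[hl hu] := @I_arg_bounds b m b0' isT.
have m1 : m%:R / m%:R = 1 :> R by rewrite mulfV// gt_eqF.
have bm : b / m%:R <= b^-1.
  by rewrite ler_pdivrMr// mulrC ler_pdivlMr// -expr2.
rewrite ler_norml; apply/andP; split.
  suff : I_arg b <= 1 + b / m%:R.
    have : 0 <= b^-1 by rewrite invr_ge0.
    lra.
  apply: le_trans hu _; rewrite /m big_ord_recl/= -/m mulrDr addrC; apply: lerD; last first.
    by rewrite mulrC ler_wpM2r ?invr_ge0 ?(ltW mR)// mul0r arg_density_le.
  apply: (@le_trans _ _ (\sum_(n < m) (Num.sqrt (n.+1%:R / m%:R) - Num.sqrt (n%:R / m%:R)))).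
    rewrite [leRHS]big_ord_recr/=; apply: ler_wpDr.
      by rewrite subr_ge0 ler_wsqrtr// ltW.
    rewrite mulr_sumr; apply: ler_sum => n _.
    apply: le_trans (sqrt_step (n0 n) (mlt n)); rewrite mE mulrC ler_wpM2r ?invr_ge0 ?(ltW mR)//.
    exact: arg_density_le_inv.
  rewrite -(big_mkord xpredT (fun n => Num.sqrt (n.+1%:R / m%:R) - Num.sqrt (n%:R / m%:R))).
  by rewrite (telescope_sumr (fun n => Num.sqrt (n%:R / m%:R)))// m1 mul0r sqrtr0 sqrtr1 subr0.
suff : 1 - Num.sqrt (1 / m%:R) - 2 * (1 / (1 + b)) <= I_arg b.
  have h1 : Num.sqrt (1 / m%:R) <= b^-1.
    rewrite -(@ler_pXn2r _ 2)// ?nnegrE ?sqrtr_ge0 ?invr_ge0// sqr_sqrtr ?divr_ge0 ?(ltW mR)//.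
    by rewrite mul1r exprVn lef_pV2 ?posrE// exprn_gt0.
  have h2 : 1 / (1 + b) <= b^-1.
    by rewrite mul1r lef_pV2 ?posrE// ?lerDr// ltr_wpDr.
  lra.
apply: le_trans hl.
pose G (n : nat) := Num.sqrt (n.+1%:R / m%:R) - 2 * (Num.sqrt (n%:R / m%:R) / (1 + b * Num.sqrt (n%:R / m%:R))).
have -> : 1 - Num.sqrt (1 / m%:R) - 2 * (1 / (1 + b)) =
    G m - G 0 - (Num.sqrt (m.+1%:R / m%:R) - 1).
  by rewrite /G m1 mul0r sqrtr0 sqrtr1 mul0r mulr1; ring.
apply: (@le_trans _ _ (G m - G 0)).
  have h0 : 1 <= m.+1%:R / m%:R :> R by rewrite -[leLHS]m1; exact/ltW/mlt.
  by rewrite gerBl subr_ge0 -[leLHS]sqrtr1 ler_wsqrtr.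
rewrite -(@telescope_sumr _ 0 m G (leq0n m)) big_mkord mulr_sumr; apply: ler_sum => n _.
have h1 := @sqrt_step_ge _ _ (n1 n) (ltW (mlt n.+1)).
have h2 := decay_step b0' (n0 n) (mlt n).
rewrite mE in h1; rewrite mE in h2.
have h3 := arg_density_ge_decay b0' (n1 n).
have i0 : 0 <= m%:R^-1 :> R by rewrite invr_ge0 ltW.
have := ler_wpM2l i0 h3; rewrite mulrBr /G.
move: h1 h2; rewrite ![_^-1 * m%:R^-1]mulrC; lra.
Qed.
End I_arg_theory.

(** * The uniform estimate *)

Section uniform_estimate.
Context {R : realType}.

Lemma alternating_sum_bounds (u : nat -> R) m :
  (forall n, 0 <= u n) -> (forall n, u n.+1 <= u n) ->
  0 <= \sum_(n < m) (-1) ^+ n * u n <= u 0.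
Proof.
elim: m u => [|m IH] u u0 ud; first by rewrite big_ord0 lexx u0.
rewrite big_ord_recl expr0 mul1r.
have -> : \sum_(n < m) (-1) ^+ (lift ord0 n) * u (lift ord0 n) =
    - \sum_(n < m) (-1) ^+ n * u n.+1.
  by rewrite -sumrN; apply: eq_bigr => n _; rewrite /= /bump/= add1n exprS !mulN1r mulNr.
have /andP[h0 h1] := IH (fun n => u n.+1) (fun n => u0 n.+1) (fun n => ud n.+1).
have := ud 0; by move=> ?; apply/andP; split; lra.
Qed.

Definition harmonic_sum m : R := \sum_(k < m) (k.+1%:R)^-1.

Lemma harmonic_sum_ge0 m : 0 <= harmonic_sum m.
Proof. by apply: sumr_ge0 => k _; rewrite invr_ge0. Qed.

Lemma sumr_harmonic_le (X : nat -> R) (c k : R) m : 0 <= c -> 0 <= k ->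
  `|X 0| <= c -> (forall n, `|X n.+1| <= k / n.+1%:R) ->
  \sum_(n < m) `|X n| <= c + k * harmonic_sum m.
Proof.
move=> c0 k0 X0 Xn; case: m => [|m].
  by rewrite big_ord0 addr_ge0// mulr_ge0// harmonic_sum_ge0.
rewrite big_ord_recl; apply: lerD => //.
rewrite /harmonic_sum big_ord_recr/= mulrDr mulr_sumr; apply: ler_wpDr.
  by rewrite mulr_ge0// invr_ge0.
by apply: ler_sum => n _; exact: Xn.
Qed.

Lemma half_moment_bounds (a : R) n : 0 <= a -> 0 <= half_moment a n <= a * wallis n.
Proof.
move=> a0; have ci (f : R -> R) : continuous f ->
    (@lebesgue_measure R).-integrable `[0, (pi / 2)] (EFin \o f).
  by move=> cf; apply: continuous_integrable.
have ic : continuous (fun t : R => cos t ^+ n) by exact: continuous_cosX.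
apply/andP; split.
  apply: Rintegral_ge0 => t; rewrite /= in_itv/= => tI.
  have /andP[t0 _] := tI; have /andP[cos0 _] := cos_pihalf_itv tI.
  by rewrite mulr_ge0 ?exprn_ge0// le_min a0 t0.
rewrite /wallis -RintegralZl//; last exact: ci.
apply: le_Rintegral => //.
- by apply: ci; exact: continuous_min_cosX.
- by apply: ci; apply: continuous_mulf => //; exact: cst_continuous.
move=> t; rewrite /= in_itv/= => /cos_pihalf_itv/andP[cos0 _].
by rewrite ler_wpM2r ?exprn_ge0// ge_min lexx.
Qed.

Lemma half_ratio_bounds (a : R) n : 0 <= a -> 0 <= half_ratio a n <= a.
Proof.
move=> a0; have W0 := wallis_gt0 (R := R) n.
have /andP[h0 h1] := half_moment_bounds n a0.
by rewrite /half_ratio divr_ge0 ?(ltW W0)//= ler_pdivrMr.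
Qed.

(** [half_ratio] with cos^n t and W_n replaced by their Gaussian approximations. *)
Definition gauss_half_ratio (a : R) n : R := 2 / Num.sqrt pi * arg_density a (n%:R / 2).

Lemma two_div_sqrt_pi : 0 <= 2 / Num.sqrt (pi : R) <= 2.
Proof.
have p1 : 1 <= Num.sqrt pi :> R.
  by rewrite -[leLHS]sqrtr1 ler_wsqrtr//; have := pi_ge2 R; lra.
rewrite divr_ge0 ?sqrtr_ge0//= ler_pdivrMr ?(lt_le_trans _ p1)//.
by rewrite ler_peMr.
Qed.

Lemma gauss_half_ratio_ge0 (a : R) n : 0 <= a -> 0 <= gauss_half_ratio a n.
Proof. by move=> a0; have /andP[? _] := two_div_sqrt_pi; rewrite mulr_ge0// arg_density_ge0. Qed.

Lemma gauss_half_ratio_nonincreasing (a : R) n : 0 <= a -> gauss_half_ratio a n.+1 <= gauss_half_ratio a n.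
Proof.
move=> a0; have /andP[? _] := two_div_sqrt_pi; rewrite ler_wpM2l//.
by apply: arg_density_nonincreasing => //; rewrite ler_pM2r// ler_nat.
Qed.

Lemma gauss_half_ratio0_le (a : R) : 0 <= a -> gauss_half_ratio a 0 <= a + a.
Proof.
move=> a0; have /andP[p0 p2] := two_div_sqrt_pi.
have := arg_density_bounds a0 (0%:R / 2) => /andP[h0 h1].
by rewrite /gauss_half_ratio; have := ler_pM p0 h0 p2 h1; lra.
Qed.

Let K : R := 16 * expR (pi ^+ 2 / 8) + 1.

Lemma K_ge0 : 0 <= K. Proof. by rewrite /K addr_ge0// mulr_ge0// expR_ge0. Qed.

Lemma sum_dist_half_ratio (a : R) m : 0 <= a <= pi ->
  \sum_(n < m) `|half_ratio a n - gauss_half_ratio a n| <= 3 * pi + K * harmonic_sum m.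
Proof.
move=> /andP[a0 ap]; apply: (@sumr_harmonic_le (fun n => half_ratio a n - gauss_half_ratio a n)).
- by rewrite mulr_ge0 ?pi_ge0.
- exact: K_ge0.
- have /andP[h0 h1] := half_ratio_bounds 0 a0; have := gauss_half_ratio0_le a0; have := gauss_half_ratio_ge0 0 a0 => h2 h3.
  by rewrite ler_norml; apply/andP; split; lra.
- by move=> n; exact: half_ratio_arg_density.
Qed.

(** Up to errors O(1/n) the sequence is monotone, and Leibniz bounds the
alternating sums of a monotone one by its first term. *)
Lemma sum_alternating_half_ratio (a : R) m : 0 <= a <= pi ->
  `|\sum_(n < m) (-1) ^+ n * half_ratio a n| <= 5 * pi + K * harmonic_sum m.
Proof.
move=> api; have /andP[a0 ap] := api.
have -> : \sum_(n < m) (-1) ^+ n * half_ratio a n =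
    \sum_(n < m) (-1) ^+ n * (half_ratio a n - gauss_half_ratio a n) + \sum_(n < m) (-1) ^+ n * gauss_half_ratio a n.
  by rewrite -big_split/=; apply: eq_bigr => n _; rewrite -mulrDr subrK.
apply: le_trans (ler_normD _ _) _.
have h1 : `|\sum_(n < m) (-1) ^+ n * (half_ratio a n - gauss_half_ratio a n)| <= 3 * pi + K * harmonic_sum m.
  apply: le_trans (ler_norm_sum _ _ _) _.
  under eq_bigr do rewrite normrM normrX normrN1 expr1n mul1r.
  exact: sum_dist_half_ratio.
have /andP[h2 h3] := alternating_sum_bounds m (fun n => gauss_half_ratio_ge0 n a0) (fun n => gauss_half_ratio_nonincreasing n a0).
have h4 := gauss_half_ratio0_le a0; rewrite (ger0_norm h2); lra.
Qed.

(** The left Riemann sum with 2 N nodes for the integral defining I_arg at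
b = sqrt N a; it exceeds the integral by at most its first term over 2 N, and
the scaling leaves an error a. *)
Lemma sum_gauss_half_ratio (a : R) N : (0 < N)%N -> 0 <= a <= pi ->
  `|\sum_(n < N + N) gauss_half_ratio a n - 4 / Num.sqrt pi * (Num.sqrt N%:R * I_arg (Num.sqrt N%:R * a))| <= 2 * pi.
Proof.
move=> N0 /andP[a0 ap]; have NR : 0 < N%:R :> R by rewrite ltr0n.
set b := Num.sqrt N%:R * a; have s0 : 0 < Num.sqrt N%:R :> R by rewrite sqrtr_gt0.
have b0 : 0 <= b by rewrite mulr_ge0// ltW.
have m0 : (0 < N + N)%N by rewrite addn_gt0 N0.
have mR : 0 < (N + N)%:R :> R by rewrite ltr0n.
have /andP[hl hu] := I_arg_bounds b0 m0.
pose S := \sum_(n < N + N) arg_density a (n%:R / 2).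
have -> : \sum_(n < N + N) gauss_half_ratio a n = 2 / Num.sqrt pi * S by rewrite mulr_sumr.
have SE : Num.sqrt N%:R * S = \sum_(n < N + N) arg_density b (n%:R / (N + N)%:R).
  rewrite mulr_sumr; apply: eq_bigr => n _.
  have n0 : 0 <= n%:R / 2 :> R by rewrite divr_ge0.
  rewrite (arg_density_scale a NR n0) natrD -/b; congr (arg_density b _).
  move: (N%:R : R) NR => x x0; field.
  by do ?[apply/andP; split]; rewrite gt_eqF// addr_gt0.
have SE' : \sum_(n < N + N) arg_density b (n%:R / (N + N)%:R) <=
    b + \sum_(n < N + N) arg_density b (n.+1%:R / (N + N)%:R).
  case: {hl hu SE}(N + N)%N m0 mR => // m _ mR.
  rewrite big_ord_recl [in leRHS]big_ord_recr/= addrA; apply: ler_wpDr; last first.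
    by apply: lerD => //; exact: arg_density_le.
  exact: arg_density_ge0.
have h1 : `|S - 2 * (Num.sqrt N%:R * I_arg b)| <= a.
  rewrite -(ler_pM2l s0) -{1}(gtr0_norm s0) -normrM mulrBr SE -/b.
  rewrite (_ : Num.sqrt N%:R * (2 * (Num.sqrt N%:R * I_arg b)) = (N + N)%:R * I_arg b); last first.
    have sN : Num.sqrt N%:R * Num.sqrt N%:R = N%:R :> R by rewrite -expr2 sqr_sqrtr// ltW.
    by rewrite natrD mulrA mulrAC mulrA sN; ring.
  rewrite mulrC ler_pdivrMr// in hl; rewrite mulrC ler_pdivlMr// in hu.
  by rewrite ler_norml; apply/andP; split; lra.
have /andP[p0 p2] := two_div_sqrt_pi.
rewrite (_ : _ - _ = 2 / Num.sqrt pi * (S - 2 * (Num.sqrt N%:R * I_arg b))); last by ring.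
rewrite normrM (ger0_norm p0); apply: ler_pM => //; exact: le_trans h1 ap.
Qed.

Lemma powR_3_2 (x : R) : 0 <= x -> x `^ (3 / 2) = x * Num.sqrt x.
Proof.
move=> x0; rewrite -powR12_sqrt// -{2}(powRr1 x0) -powRD; last first.
  by apply/implyP => /eqP; lra.
by congr powR; field.
Qed.

Lemma var_sector_harmonic (a : R) N : (0 < N)%N -> 0 <= a <= pi ->
  `|var_sector N a - Num.sqrt N%:R * (pi `^ (3 / 2))^-1 * I_arg (Num.sqrt N%:R * a)|
    <= (5 + K) * (1 + harmonic_sum (N + N)).
Proof.
move=> N0 api; have /andP[a0 ap] := api.
have p0 := pi_gt0 R.
have bpi : 0 <= pi - a <= pi by apply/andP; split; lra.
have ppi : 0 <= (pi : R) <= pi by rewrite (ltW p0) lexx.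
have h1 := var_sector_cos_moment N0 api.
have h2 := sum_dist_half_ratio (N + N) api.
have h3 := sum_alternating_half_ratio (N + N) ppi.
have h4 := sum_alternating_half_ratio (N + N) bpi.
have h5 := sum_gauss_half_ratio N0 api.
have /andP[h6 h7] := alternating_sum_bounds (N + N) (fun _ => a0) (fun _ => lexx a).
have E : \sum_(n < N + N) cos_moment a n / wallis n =
    \sum_(n < N + N) half_ratio a n + (\sum_(n < N + N) (-1) ^+ n * a
    - \sum_(n < N + N) (-1) ^+ n * half_ratio pi n + \sum_(n < N + N) (-1) ^+ n * half_ratio (pi - a) n).
  rewrite -sumrB -!big_split/=; apply: eq_bigr => n _; rewrite cos_moment_ratio.
  by rewrite mulrDr mulrBr.
have h2' : `|\sum_(n < N + N) half_ratio a n - \sum_(n < N + N) gauss_half_ratio a n| <= 3 * pi + K * harmonic_sum (N + N).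
  rewrite -sumrB; exact: le_trans (ler_norm_sum _ _ _) h2.
rewrite E -/(harmonic_sum N) in h1.
have hN : harmonic_sum N <= harmonic_sum (N + N).
  rewrite /harmonic_sum big_split_ord/= lerDl; apply: sumr_ge0 => k _; by rewrite invr_ge0.
have -> : Num.sqrt N%:R * (pi `^ (3 / 2))^-1 * I_arg (Num.sqrt N%:R * a) =
    (4 * pi)^-1 * (4 / Num.sqrt pi * (Num.sqrt N%:R * I_arg (Num.sqrt N%:R * a))).
  rewrite powR_3_2 ?(ltW p0)//; have : Num.sqrt pi != 0 :> R by rewrite gt_eqF// sqrtr_gt0.
  move: (I_arg _) => y; move: (Num.sqrt N%:R) => x; move: (Num.sqrt pi) => s.
  clear - p0; move: (pi : R) p0 => p p0 s0.
  by field; rewrite s0 gt_eqF.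
set V := var_sector N a in h1 *; set J := 4 / _ * _ in h5 *.
move: h1 h2' h3 h4 h5 h6 h7 hN (harmonic_sum_ge0 N) (harmonic_sum_ge0 (N + N)) K_ge0.
move: (\sum_(n < N + N) half_ratio a n) (\sum_(n < N + N) gauss_half_ratio a n)
  (\sum_(n < N + N) (-1) ^+ n * a) (\sum_(n < N + N) (-1) ^+ n * half_ratio pi n)
  (\sum_(n < N + N) (-1) ^+ n * half_ratio (pi - a) n) (harmonic_sum N) (harmonic_sum (N + N))
  => X1 X2 X3 X4 X5 H1 H2 h1 h2' h3 h4 h5 h6 h7 hN hH0 hH1 K0.
have c1 : 2 / pi ^+ 2 * H1 <= H2.
  apply: le_trans hN; rewrite ler_piMl// ler_pdivrMr ?exprn_gt0// mul1r.
  have := pi_ge2 R => p2; have : 2 * 2 <= pi * pi :> R by apply: ler_pM.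
  by rewrite expr2; lra.
have c2 : `|X1 + (X3 - X4 + X5) - J| <= 16 * pi + 3 * K * H2.
  have : `|X3| <= pi by rewrite ger0_norm// (le_trans h7).
  move: h2' h3 h4 h5; rewrite !ler_norml => /andP[? ?] /andP[? ?] /andP[? ?] /andP[? ?] /andP[? ?].
  by apply/andP; split; lra.
have i0 : 0 <= (4 * pi)^-1 :> R by rewrite invr_ge0 mulr_ge0// ltW.
have c3 : `|(4 * pi)^-1 * (X1 + (X3 - X4 + X5) - J)| <= 4 + K * H2.
  rewrite normrM (ger0_norm i0); apply: le_trans (ler_wpM2l i0 c2) _.
  rewrite mulrC ler_pdivrMr ?mulr_gt0//.
  have : 0 <= K * H2 * (pi - 2) by rewrite !mulr_ge0// subr_ge0 pi_ge2.
  have : 0 <= K * H2 by rewrite mulr_ge0.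
  by move=> ? ?; rewrite (_ : (4 + K * H2) * (4 * pi) = 16 * pi + 4 * (K * H2 * (pi - 2)) + 8 * (K * H2));
    [lra|ring].
have KH : 0 <= K * H2 by rewrite mulr_ge0.
move: h1 c3; rewrite mulrBr !ler_norml => /andP[? ?] /andP[? ?].
by apply/andP; split; lra.
Qed.

End uniform_estimate.

(** * Small sectors and the logarithm *)

Section small_arcs.
Context {R : realType}.

(** cos^2 t + t^2 is nondecreasing for t >= 0, since |sin t cos t| <= t. *)
Lemma sqr_sin_le (x : R) : sin x ^+ 2 <= x ^+ 2.
Proof.
have h (y : R) : 0 <= y -> sin y ^+ 2 <= y ^+ 2.
  move=> y0; have y1 : 1 - y ^+ 2 <= cos y ^+ 2.
    have d z : is_derive z (1 : R) (fun t : R => cos t ^+ 2 + t ^+ 2) (2 * (z - sin z * cos z)).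
      have d1 := @is_derive1_comp R (fun u => u ^+ 2) cos z _ _ (is_derive_expn 1 (cos z)) (is_derive_cos z).
      have := is_deriveD d1 (is_derive_expn 1 z).
      by move/is_derive_eq; apply; rewrite !expr1; ring.
    have c : continuous (fun z : R => 2 * (z - sin z * cos z)).
      apply: continuous_mulf; first exact: cst_continuous.
      move=> z; apply: cvgB; first exact: cvg_id.
      by apply: cvgM; [exact: continuous_sin|exact: continuous_cos].
    have : cos 0 ^+ 2 + 0 ^+ 2 <= cos y ^+ 2 + y ^+ 2.
      apply: (is_derive_ge0_le d c y0) => z /andP[z0 _]; rewrite mulr_ge0// subr_ge0.
      case: (leP 0 (sin z)) => s0.
        by apply: le_trans (sin_le_id z0); rewrite ler_piMr// cos_le1.
      have := sin_le_id z0; have : - sin z <= z.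
        have d' u : is_derive u (1 : R) (fun t : R => t + sin t) (1 + cos u).
          exact: is_deriveD (is_derive_id u (1 : R)) (is_derive_sin u).
        have c' : continuous (fun u : R => 1 + cos u).
          by move=> u; apply: cvgD; [exact: cvg_cst|exact: continuous_cos].
        have := is_derive_ge0_le d' c' z0; rewrite sin0 addr0 => /(_ _)/wrap[] => [u _|].
          by have := cos_geN1 u; lra.
        lra.
      move=> h1 h2; have : - sin z * (- cos z) <= - sin z.
        by rewrite ler_piMr ?oppr_ge0 ?(ltW s0)//; have := cos_geN1 z; lra.
      by rewrite mulrNN; lra.
    by rewrite cos0 expr1n expr0n/= addr0; lra.
  by rewrite sin2cos2; lra.
case: (leP 0 x) => x0; first exact: h.
by have := h (- x); rewrite sinN !sqrrN; apply; rewrite oppr_ge0 ltW.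
Qed.

Lemma arc_coef2_le (a : R) i j : arc_coef2 a (i%:R - j%:R) <= (a / (2 * pi)) ^+ 2.
Proof.
rewrite /arc_coef2; case: ifPn => [//|d0].
have p0 : (pi : R) != 0 by rewrite gt_eqF// pi_gt0.
move: (_ - _ : R) d0 => d d0; rewrite expr_div_n.
rewrite ler_pdivrMr; last by rewrite exprn_even_gt0//= mulf_neq0.
apply: le_trans (sqr_sin_le _) _; rewrite le_eqVlt; apply/orP; left; apply/eqP.
by move: (pi : R) p0 => p p0; field.
Qed.

(** For nonnegative entries the square is simply a part of the triangle. *)
Lemma sum_square_le_triangle (F : nat -> nat -> R) N : (forall i j, 0 <= F i j) ->
  \sum_(i < N) \sum_(j < N) F i j <= \sum_(n < N + N) \sum_(i < n.+1) F i (n - i)%N.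
Proof.
move=> F0; rewrite sum_triangle big_split_ord/=.
apply: ler_wpDr; first by apply: sumr_ge0 => i _; apply: sumr_ge0.
apply: ler_sum => i _; rewrite big_mkcond big_split_ord/=.
apply: ler_wpDr; first by apply: sumr_ge0.
rewrite [leRHS]big_mkcond/=; apply: ler_sum => j _.
by have -> : (i + j < N + N)%N by rewrite -addSn leq_add// ltnW.
Qed.

Lemma wallis_inv_le n : (wallis n)^-1 <= Num.sqrt n.+1%:R :> R.
Proof.
have W0 := wallis_gt0 (R := R) n; have h := wallis_sqr_ge (R := R) n.
rewrite -(@ler_pXn2r _ 2)// ?nnegrE ?sqrtr_ge0 ?invr_ge0 ?(ltW W0)//.
rewrite sqr_sqrtr// exprVn -[leLHS]mul1r ler_pdivrMr ?exprn_gt0//.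
by have := pi_ge2 R; lra.
Qed.

(** As |sin x| <= |x|, the double sum is at most (a / 2 pi)^2 times the sum of all
overlaps, and by the case t = 0 of [sum_overlap_cos] the antidiagonal i + j = n
of overlaps sums to pi / (2 W_n) = O(sqrt n). *)
Lemma var_sector_small (a : R) N : (0 < N)%N -> 0 <= a <= pi ->
  `|var_sector N a - N%:R * a / (2 * pi)| <= N%:R * a / (2 * pi) * (2 * (Num.sqrt N%:R * a)).
Proof.
move=> N0 api; have /andP[a0 ap] := api; have p0 := pi_gt0 R.
have NR : 0 < N%:R :> R by rewrite ltr0n.
have a2 : 0 <= a <= 2 * pi by apply/andP; split; lra.
rewrite var_sector_overlap// mulrA addrAC subrr sub0r normrN ger0_norm; last first.
  by apply: sumr_ge0 => i _; apply: sumr_ge0 => j _; rewrite mulr_ge0 ?overlap_ge0 ?arc_coef2_ge0.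
have T n : \sum_(i < n.+1) overlap i (n - i) = pi / (2 * wallis n) :> R.
  have := sum_overlap_cos n (0 : R); rewrite cos0 expr1n mulr1 => <-.
  by apply: eq_bigr => i _; rewrite mulr0 cos0 mulr1.
have S : \sum_(i < N) \sum_(j < N) overlap i j <= (N + N)%:R * (pi / 2 * Num.sqrt (N + N)%:R) :> R.
  apply: le_trans (sum_square_le_triangle N _) _; first by move=> i j; exact: overlap_ge0.
  apply: (@le_trans _ _ (\sum_(n < N + N) (pi / 2 * Num.sqrt (N + N)%:R))).
    apply: ler_sum => n _; rewrite T invfM mulrA; apply: ler_wpM2l; first exact: pihalf_ge0.
    by apply: le_trans (wallis_inv_le n) _; rewrite ler_wsqrtr// ler_nat.
  by rewrite sumr_const card_ord mulr_natl.
apply: (@le_trans _ _ ((a / (2 * pi)) ^+ 2 * \sum_(i < N) \sum_(j < N) overlap i j)).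
  rewrite mulr_sumr; apply: ler_sum => i _; rewrite mulr_sumr; apply: ler_sum => j _.
  by rewrite mulrC ler_wpM2r ?overlap_ge0// arc_coef2_le.
apply: le_trans (ler_wpM2l (sqr_ge0 _) S) _.
have s2 : Num.sqrt (N + N)%:R <= 2 * Num.sqrt N%:R :> R.
  rewrite -(@ler_pXn2r _ 2)// ?nnegrE ?sqrtr_ge0 ?mulr_ge0 ?sqrtr_ge0//.
  by rewrite exprMn !sqr_sqrtr// natrD; lra.
have pr : Num.sqrt (N + N)%:R * (N%:R * a ^+ 2 / (4 * pi)) <=
    2 * Num.sqrt N%:R * (N%:R * a ^+ 2 / (4 * pi)) :> R.
  by rewrite ler_wpM2r// divr_ge0 ?mulr_ge0 ?sqr_ge0// ltW.
have e1 : (a / (2 * pi)) ^+ 2 * ((N + N)%:R * (pi / 2 * Num.sqrt (N + N)%:R)) =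
    Num.sqrt (N + N)%:R * (N%:R * a ^+ 2 / (4 * pi)).
  move: (Num.sqrt _) => s; rewrite natrD; clear -p0; move: (pi : R) p0 => p p0.
  by field; rewrite gt_eqF.
have e2 : N%:R * a / (2 * pi) * (2 * (Num.sqrt N%:R * a)) =
   2 * (2 * Num.sqrt N%:R * (N%:R * a ^+ 2 / (4 * pi))).
  move: (Num.sqrt _) => s; clear -p0; move: (pi : R) p0 => p p0.
  by field; rewrite gt_eqF.
rewrite e1 e2; apply: le_trans pr _; rewrite ler_peMl// ?ler1n//.
by rewrite !mulr_ge0 ?invr_ge0 ?mulr_ge0 ?sqrtr_ge0 ?sqr_ge0// ltW.
Qed.
End small_arcs.

Section logarithmic_bound.
Context {R : realType}.

Lemma harmonic_sum_le_ln m : (0 < m)%N -> harmonic_sum m <= 1 + ln m%:R :> R.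
Proof.
case: m => // m _; elim: m => [|m IH].
  by rewrite /harmonic_sum big_ord1 invr1 ln1 addr0.
rewrite /harmonic_sum big_ord_recr/= -/(harmonic_sum m.+1).
have m2 : 0 < m.+2%:R :> R by rewrite ltr0n.
have m1 : 0 < m.+1%:R :> R by rewrite ltr0n.
have i1 : - (m.+2%:R)^-1 > - 1 :> R.
  by rewrite ltrN2 invf_lt1// ltr1n.
have := le_ln1Dx i1.
have -> : 1 + - (m.+2%:R)^-1 = m.+1%:R / m.+2%:R :> R.
  have -> : m.+1%:R = m.+2%:R - 1 :> R by rewrite -[m.+2%:R]natr1 addrK.
  by move: (m.+2%:R : R) m2 => x x0; field; rewrite gt_eqF.
rewrite lnM ?posrE ?invr_gt0// lnV ?posrE//.
move: IH; move: (harmonic_sum _) (ln _) (ln _) (m.+2%:R^-1) => h x y z h1 h2.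
lra.
Qed.

Lemma var_sector_log : exists C : R, 0 < C /\ forall N a, (1 < N)%N -> 0 <= a <= pi ->
  `|var_sector N a - Num.sqrt N%:R * (pi `^ (3 / 2))^-1 * I_arg (Num.sqrt N%:R * a)| <= C * ln N%:R.
Proof.
have l2 : 0 < ln 2 :> R by rewrite ln_gt0// ltr1n.
set K : R := 5 + (16 * expR (pi ^+ 2 / 8) + 1).
have K0 : 0 < K by rewrite /K; have := expR_gt0 (pi ^+ 2 / 8 : R); lra.
exists (K * (2 / ln 2 + 2)); split.
  by rewrite mulr_gt0// addr_gt0// divr_gt0.
move=> N a N1 api; have N0 := ltnW N1; have NR : 0 < N%:R :> R by rewrite ltr0n.
apply: le_trans (var_sector_harmonic N0 api) _; rewrite -/K -mulrA; apply: ler_wpM2l; first exact: ltW.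
have m0 : (0 < N + N)%N by rewrite addn_gt0 N0.
have := harmonic_sum_le_ln m0.
have -> : (N + N)%:R = 2 * N%:R :> R by rewrite natrD; ring.
rewrite lnM ?posrE// => h.
have lN : ln 2 <= ln N%:R :> R by rewrite ler_ln ?posrE// ler_nat.
have : 1 <= ln N%:R / ln 2 :> R by rewrite ler_pdivlMr// mul1r.
rewrite (_ : (2 / ln 2 + 2) * ln N%:R = 2 * (ln N%:R / ln 2) + 2 * ln N%:R); last by ring.
lra.
Qed.

Lemma ln_le_sqrt (x : R) : 0 < x -> ln x <= 4 * Num.sqrt (Num.sqrt x).
Proof.
move=> x0; have h (y : R) : 0 < y -> ln y <= y.
  move=> y0; have y1 : - 1 < y - 1 by lra.
  by have := le_ln1Dx y1; rewrite [1 + _]addrC subrK; lra.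
have s0 : 0 < Num.sqrt x by rewrite sqrtr_gt0.
have t0 : 0 < Num.sqrt (Num.sqrt x) by rewrite sqrtr_gt0.
have l (y : R) : 0 < y -> ln y = 2 * ln (Num.sqrt y).
  move=> y0; rewrite -{1}(sqr_sqrtr (ltW y0)) expr2 lnM ?posrE ?sqrtr_gt0//; ring.
rewrite (l _ x0) (l _ s0); have := h _ t0; lra.
Qed.
End logarithmic_bound.

(** * Asymptotics *)

Section asymptotics.
Context {R : realType}.

Lemma eqO_ln (f : nat -> R) (C : R) :
  (\forall N \near \oo, `|f N| <= C * ln N%:R) -> f =O_\oo (fun N : nat => ln N%:R : R).
Proof.
move=> h; apply/eqO_exP; exists (`|C| + 1); first by rewrite ltr_wpDl.
near=> N; have hN : `|f N| <= C * ln N%:R by near: N.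
have N1 : (1 < N)%N by near: N; exact: nbhs_infty_gt.
have l0 : 0 <= ln N%:R :> R by rewrite ln_ge0// ler1n ltnW.
rewrite (ger0_norm l0); apply: le_trans hN _; rewrite ler_wpM2r//.
by apply: le_trans (ler_norm C) _; rewrite lerDl.
Unshelve. all: by end_near. Qed.

Lemma equiv_nearP (f g : nat -> R) :
  (forall e, 0 < e -> \forall N \near \oo, `|f N - g N| <= e * `|g N|) -> f ~_\oo g.
Proof. by move=> h; apply/eqaddoP => e e0; exact: h. Qed.

Lemma near_sqrt_ge (K : R) : \forall N \near \oo, K <= Num.sqrt N%:R.
Proof.
near=> N; have h : K ^+ 2 <= N%:R by near: N; exact: nbhs_infty_ger.
case: (leP K 0) => K0; first by apply: le_trans K0 _; exact: sqrtr_ge0.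
rewrite -(@ler_pXn2r _ 2)// ?nnegrE ?sqrtr_ge0//; last exact: ltW.
by rewrite sqr_sqrtr.
Unshelve. all: by end_near. Qed.

Lemma near_ln_le_sqrt (C e : R) : 0 < C -> 0 < e ->
  \forall N \near \oo, C * ln N%:R <= e * Num.sqrt N%:R.
Proof.
move=> C0 e0; near=> N.
have N0 : (0 < N)%N by near: N; exact: nbhs_infty_gt.
have NR : 0 < N%:R :> R by rewrite ltr0n.
have h : (C * 4 / e) ^+ 2 <= Num.sqrt N%:R by near: N; exact: near_sqrt_ge.
have l := ln_le_sqrt NR.
have s0 : 0 < Num.sqrt N%:R :> R by rewrite sqrtr_gt0.
have sE : Num.sqrt N%:R = Num.sqrt (Num.sqrt N%:R) ^+ 2 :> R by rewrite sqr_sqrtr// ltW.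
have t0 : 0 < Num.sqrt (Num.sqrt N%:R) :> R by rewrite sqrtr_gt0.
have q0 : 0 <= C * 4 / e by rewrite divr_ge0 ?mulr_ge0// ltW.
have k : C * 4 / e <= Num.sqrt (Num.sqrt N%:R).
  by rewrite -(@ler_pXn2r _ 2)// ?nnegrE ?sqrtr_ge0// -sE.
apply: le_trans (ler_wpM2l (ltW C0) l) _.
move: (Num.sqrt (Num.sqrt _)) sE t0 k => t sE t0 k.
rewrite sE expr2 !mulrA ler_pM2r//.
by rewrite -ler_pdivrMl// mulrC.
Unshelve. all: by end_near. Qed.

Lemma near_small_arc (alpha : nat -> R) : alpha @ \oo --> 0^'+ ->
  \forall N \near \oo, 0 < alpha N <= pi.
Proof.
move=> h; have h1 : \forall x \near (0 : R)^'+, 0 < x by exact: nbhs_right_gt.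
have h2 : \forall x \near (0 : R)^'+, x <= pi by exact: nbhs_right_le (pi_gt0 R).
have := h _ h1; have := h _ h2; rewrite /nbhs/= /nbhs/= => g2 g1.
near=> N; apply/andP; split; near: N; [exact: g1|exact: g2].
Unshelve. all: by end_near. Qed.

Lemma dist_main_term (v w x y : R) : 0 <= w ->
  `|v - w * y| <= `|v - w * x| + w * `|x - y|.
Proof.
move=> w0; rewrite (_ : v - w * y = (v - w * x) + w * (x - y)); last by ring.
by apply: le_trans (ler_normD _ _) _; rewrite [X in _ + X <= _]normrM (ger0_norm w0).
Qed.

Let c : R := (pi `^ (3 / 2))^-1.
Let c0 : 0 < c. Proof. by rewrite invr_gt0 powR_gt0// pi_gt0. Qed.

(** A common form of the two regimes where sqrt N dominates log N: L is the limit
of I_arg (sqrt N alpha), and d controls the rate. *)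
Lemma var_sector_equiv (alpha d : nat -> R) (L : R) : 0 < L -> alpha @ \oo --> 0^'+ ->
  d @ \oo --> 0 ->
  (\forall N \near \oo, `|I_arg (Num.sqrt N%:R * alpha N) - L| <= d N) ->
  (fun N : nat => var_sector N (alpha N)) ~_\oo (fun N : nat => Num.sqrt N%:R * c * L).
Proof.
move=> L0 ha hd hI; have [C [C0 hC]] := @var_sector_log R.
have s0 := near_small_arc ha.
apply: equiv_nearP => e e0.
have e1 : 0 < e / 2 * c * L by rewrite !mulr_gt0// divr_gt0.
have e2 : 0 < e / 2 * L by rewrite mulr_gt0// divr_gt0.
have h1 := near_ln_le_sqrt C0 e1.
move/cvgrPdist_le: hd => /(_ _ e2) h2.
near=> N.
have N1 : (1 < N)%N by near: N; exact: nbhs_infty_gt.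
have /andP[a0 ap] : 0 < alpha N <= pi by near: N.
have h3 : `|I_arg (Num.sqrt N%:R * alpha N) - L| <= d N by near: N.
have h4 : C * ln N%:R <= e / 2 * c * L * Num.sqrt N%:R by near: N.
have h5 : `|0 - d N| <= e / 2 * L by near: N.
have api : 0 <= alpha N <= pi by rewrite (ltW a0).
have h6 := hC N (alpha N) N1 api.
have q0 : 0 <= Num.sqrt N%:R :> R by exact: sqrtr_ge0.
have sc0 : 0 <= Num.sqrt N%:R * c by rewrite mulr_ge0// ltW.
have h7 : d N <= e / 2 * L by apply: le_trans h5; rewrite sub0r normrN ler_norm.
have h8 : Num.sqrt N%:R * c * `|I_arg (Num.sqrt N%:R * alpha N) - L| <= Num.sqrt N%:R * c * (e / 2 * L).
  by rewrite ler_wpM2l// (le_trans h3).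
rewrite (ger0_norm (mulr_ge0 sc0 (ltW L0))).
rewrite -/c in h6.
apply: le_trans (dist_main_term _ (I_arg (Num.sqrt N%:R * alpha N)) _ sc0) _.
apply: le_trans (lerD (le_trans h6 h4) h8) _.
by rewrite le_eqVlt; apply/orP; left; apply/eqP; field.
Unshelve. all: by end_near. Qed.

Lemma var_sector_fixed (alpha : R) : 0 < alpha < 2 * pi ->
  (fun N : nat => var_sector N alpha - Num.sqrt N%:R * c) =O_\oo (fun N : nat => ln N%:R : R).
Proof.
move=> /andP[al0 al1]; have p0 := pi_gt0 R.
have [C [C0 hC]] := @var_sector_log R.
pose a := if alpha <= pi then alpha else 2 * pi - alpha.
have [a0 ap va] : [/\ 0 < a, a <= pi & forall N, (0 < N)%N -> var_sector N alpha = var_sector N a].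
  rewrite /a; case: (leP alpha pi) => h; split => //; try lra.
  move=> N N0; rewrite var_sector_sym//.
  by apply/andP; split; lra.
have l2 : 0 < ln 2 :> R by rewrite ln_gt0// ltr1n.
have k0 : 0 <= c * (3 / a) by rewrite mulr_ge0 ?divr_ge0// ltW.
apply: (@eqO_ln _ (C + c * (3 / a) / ln 2)); near=> N.
have N1 : (1 < N)%N by near: N; exact: nbhs_infty_gt.
have N0 := ltnW N1.
have NR : 0 < N%:R :> R by rewrite ltr0n.
have q0 : 0 < Num.sqrt N%:R :> R by rewrite sqrtr_gt0.
have api : 0 <= a <= pi by rewrite (ltW a0).
have h1 := hC N a N1 api; rewrite -/c in h1.
have h2 := I_arg_to1 (mulr_gt0 q0 a0).
have sc0 : 0 <= Num.sqrt N%:R * c by rewrite mulr_ge0// ltW.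
have h3 := ler_wpM2l sc0 h2.
have lN : ln 2 <= ln N%:R :> R by rewrite ler_ln ?posrE// ler_nat.
have h4 : 1 <= ln N%:R / ln 2 :> R by rewrite ler_pdivlMr// mul1r.
have h5 := ler_wpM2l k0 h4.
rewrite va//.
rewrite -[X in _ - X]mulr1.
apply: le_trans (dist_main_term _ (I_arg (Num.sqrt N%:R * a)) _ sc0) _.
rewrite [`|I_arg _ - 1|]distrC.
apply: le_trans (lerD h1 h3) _; rewrite [leRHS]mulrDl lerD2l.
have -> : Num.sqrt N%:R * c * (3 / (Num.sqrt N%:R * a)) = c * (3 / a) * 1.
  by move: (Num.sqrt _) q0 => s s0; field; rewrite !gt_eqF.
by apply: le_trans h5 _; rewrite mulrA mulrAC.
Unshelve. all: by end_near. Qed.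

Lemma var_sector_log_sqrt (alpha : nat -> R) : alpha @ \oo --> 0^'+ ->
  (fun N : nat => var_sector N (alpha N) - Num.sqrt N%:R * c * I_arg (Num.sqrt N%:R * alpha N))
    =O_\oo (fun N : nat => ln N%:R : R).
Proof.
move=> ha; have [C [C0 hC]] := @var_sector_log R.
have s0 := near_small_arc ha.
apply: (@eqO_ln _ C); near=> N.
have N1 : (1 < N)%N by near: N; exact: nbhs_infty_gt.
have /andP[a0 ap] : 0 < alpha N <= pi by near: N.
by apply: hC => //; rewrite (ltW a0).
Unshelve. all: by end_near. Qed.

(** The Lipschitz bound on I_arg turns the rate of convergence of sqrt N alpha
into an error of the same order. *)
Lemma var_sector_log_rate (alpha : nat -> R) (b : R) : 0 < b -> alpha @ \oo --> 0^'+ ->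
  (fun N : nat => Num.sqrt N%:R * (Num.sqrt N%:R * alpha N - b)) =O_\oo (fun N : nat => ln N%:R : R) ->
  (fun N : nat => var_sector N (alpha N) - Num.sqrt N%:R * c * I_arg b)
    =O_\oo (fun N : nat => ln N%:R : R).
Proof.
move=> b0 ha /eqO_exP[k k0 hk]; have [C [C0 hC]] := @var_sector_log R.
have s0 := near_small_arc ha.
apply: (@eqO_ln _ (C + c * k)); near=> N.
have N1 : (1 < N)%N by near: N; exact: nbhs_infty_gt.
have /andP[a0 ap] : 0 < alpha N <= pi by near: N.
have h1 : `|Num.sqrt N%:R * (Num.sqrt N%:R * alpha N - b)| <= k * `|ln N%:R| by near: N.
have l0 : 0 <= ln N%:R :> R by rewrite ln_ge0// ler1n ltnW.
rewrite normrM (ger0_norm l0) (ger0_norm (sqrtr_ge0 _)) in h1.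
have api : 0 <= alpha N <= pi by rewrite (ltW a0).
have h2 := hC N (alpha N) N1 api; rewrite -/c in h2.
have q0 : 0 <= Num.sqrt N%:R :> R by exact: sqrtr_ge0.
have h3 := I_arg_lipschitz (mulr_ge0 q0 (ltW a0)) (ltW b0).
have sc0 : 0 <= Num.sqrt N%:R * c by rewrite mulr_ge0// ltW.
apply: le_trans (dist_main_term _ (I_arg (Num.sqrt N%:R * alpha N)) _ sc0) _.
rewrite [leRHS]mulrDl; apply: lerD => //.
apply: le_trans (ler_wpM2l sc0 h3) _; rewrite mulrAC mulrC -mulrA; apply: ler_wpM2l => //.
exact: ltW.
Unshelve. all: by end_near. Qed.

Lemma var_sector_equiv_small (alpha : nat -> R) : alpha @ \oo --> 0^'+ ->
  (fun N : nat => Num.sqrt N%:R * alpha N) @ \oo --> 0 ->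
  (fun N : nat => var_sector N (alpha N)) ~_\oo (fun N : nat => N%:R * alpha N / (2 * pi)).
Proof.
move=> ha hb; have s0 := near_small_arc ha; have p0 := pi_gt0 R.
apply: equiv_nearP => e e0.
have e2 : 0 < e / 2 by rewrite divr_gt0.
move/cvgrPdist_le: hb => /(_ _ e2) h2.
near=> N.
have N0 : (0 < N)%N by near: N; exact: nbhs_infty_gt.
have /andP[a0 ap] : 0 < alpha N <= pi by near: N.
have h3 : `|0 - Num.sqrt N%:R * alpha N| <= e / 2 by near: N.
have api : 0 <= alpha N <= pi by rewrite (ltW a0).
apply: le_trans (var_sector_small N0 api) _.
have g0 : 0 <= N%:R * alpha N / (2 * pi) by rewrite divr_ge0 ?mulr_ge0// ltW.
rewrite (ger0_norm g0) mulrC; apply: ler_wpM2r => //.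
have : Num.sqrt N%:R * alpha N <= e / 2 by apply: le_trans h3; rewrite sub0r normrN ler_norm.
lra.
Unshelve. all: by end_near. Qed.

Lemma I_arg_cvg0 : I_arg b @[b --> (0 : R)^'+] --> (0 : R).
Proof.
apply/cvgrPdist_le => e e0; near=> b.
have b0 : 0 < b by near: b; exact: nbhs_right_gt.
have be : b <= e by near: b; exact: nbhs_right_le.
rewrite sub0r normrN ger0_norm ?I_arg_ge0 ?(ltW b0)//.
by apply: le_trans (I_arg_le (ltW b0)) be.
Unshelve. all: by end_near. Qed.

Lemma I_arg_cvg1 : I_arg b @[b --> +oo] --> (1 : R).
Proof.
apply/cvgrPdist_le => e e0; near=> b.
have b0 : 0 < b by near: b; exact: nbhs_pinfty_gt.
have be : 3 / e <= b by near: b; apply: nbhs_pinfty_ge; exact: num_real.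
apply: le_trans (I_arg_to1 b0) _; rewrite ler_pdivrMr// mulrC -ler_pdivrMr//.
Unshelve. all: by end_near. Qed.
End asymptotics.

Theorem theorem1p5 (R : realType) :
  [/\ (* (i) *)
      forall alpha : R, 0 < alpha < 2 * pi ->
        (fun N : nat => var_sector N alpha - Num.sqrt N%:R * (pi `^ (3 / 2))^-1)
          =O_\oo (fun N : nat => ln N%:R : R),
      (* (ii) *)
      forall alpha : nat -> R,
        alpha @ \oo --> 0^'+ ->
        (fun N : nat => N%:R * alpha N) @ \oo --> +oo ->
        [/\ (fun N : nat => Num.sqrt N%:R * alpha N) @ \oo --> +oo ->
              (fun N : nat => var_sector N (alpha N)) ~_\oo
              (fun N : nat => Num.sqrt N%:R * (pi `^ (3 / 2))^-1),
            forall beta : R, 0 < beta ->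
              (fun N : nat => Num.sqrt N%:R * alpha N) @ \oo --> beta ->
              (* The error term is O(log N) with I_arg taken at sqrt N alpha, and
                 with I_arg taken at beta as soon as sqrt N alpha is within
                 O(log N / sqrt N) of beta, e.g. alpha = beta / sqrt N.
                 Without a rate it is o(sqrt N). *)
              [/\ (fun N : nat => var_sector N (alpha N) -
                     Num.sqrt N%:R * (pi `^ (3 / 2))^-1
                       * I_arg (Num.sqrt N%:R * alpha N))
                    =O_\oo (fun N : nat => ln N%:R : R),
                  (fun N : nat => var_sector N (alpha N)) ~_\oo
                  (fun N : nat => Num.sqrt N%:R * (pi `^ (3 / 2))^-1 * I_arg beta) &
                  (fun N : nat => Num.sqrt N%:R * (Num.sqrt N%:R * alpha N - beta))
                    =O_\oo (fun N : nat => ln N%:R : R) ->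
                  (fun N : nat => var_sector N (alpha N) -
                     Num.sqrt N%:R * (pi `^ (3 / 2))^-1 * I_arg beta)
                    =O_\oo (fun N : nat => ln N%:R : R)]
          & (fun N : nat => Num.sqrt N%:R * alpha N) @ \oo --> 0 ->
              (fun N : nat => var_sector N (alpha N)) ~_\oo
              (fun N : nat => N%:R * alpha N / (2 * pi))],
      forall beta : R, 0 < beta -> 0 <= I_arg beta,
      I_arg beta @[beta --> (0 : R)^'+] --> (0 : R) &
      I_arg beta @[beta --> +oo] --> (1 : R)].
Proof.
split; [exact: var_sector_fixed| |by move=> b b0; exact/I_arg_ge0/ltW|exact: I_arg_cvg0|exact: I_arg_cvg1].
move=> alpha ha _; have a0 := near_small_arc ha; split.
- move=> /cvgryPge hb.
  rewrite (_ : (fun N => Num.sqrt N%:R * _) = fun N => Num.sqrt N%:R * (pi `^ (3 / 2))^-1 * 1); last first.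
    by apply/funext => N; rewrite mulr1.
  apply: (@var_sector_equiv _ _ (fun N => 3 / (Num.sqrt N%:R * alpha N))) => //.
    apply/cvgrPdist_le => e e0; near=> N.
    have b0 : 1 <= Num.sqrt N%:R * alpha N by near: N; exact: hb.
    have be : 3 / e <= Num.sqrt N%:R * alpha N by near: N; exact: hb.
    have b1 : 0 < Num.sqrt N%:R * alpha N by exact: lt_le_trans b0.
    rewrite sub0r normrN ger0_norm; last by rewrite divr_ge0// ltW.
    by rewrite ler_pdivrMr// mulrC -ler_pdivrMr.
  near=> N; have b0 : 1 <= Num.sqrt N%:R * alpha N by near: N; exact: hb.
  by rewrite distrC I_arg_to1// (lt_le_trans _ b0).
- move=> beta b0 hb; split.
  + exact: var_sector_log_sqrt.
  + apply: (@var_sector_equiv _ _ (fun N => `|Num.sqrt N%:R * alpha N - beta|)) => //.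
    * exact: I_arg_gt0.
    * rewrite -(normr0 R) -(subrr beta); apply: cvg_norm; apply: cvgB => //; exact: cvg_cst.
    * near=> N; have /andP[aN _] : 0 < alpha N <= pi by near: N.
      by apply: I_arg_lipschitz; rewrite ?(ltW b0)// mulr_ge0 ?sqrtr_ge0// ltW.
  + exact: var_sector_log_rate.
- exact: var_sector_equiv_small.
Unshelve. all: by end_near. Qed.
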